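(* Let $n\ge1$, $T>0$, and let $V,\sigma:\mathbb{R}^n\to\mathbb{R}^{n\times n}$ be Lipschitz continuous and bounded and $b:\mathbb{R}^n\to\mathbb{R}^n$ be Lipschitz continuous. Let $(W_k,\ 0\le k\le T)$ be an $n$-dimensional Brownian motion. For $R>0$ and a progressively measurable process $q=(q_k,\ 0\le k\le T)$ taking values in $B_R=\{q\in\mathbb{R}^n:|q|\le R\}$, let $(X_k^{q}(x,t),\ t\le k\le T)$ denote the strong solution of $$dX_k^{q}=[b(X_k^{q})-V(X_k^{q})q_k]\,dk+\sigma(X_k^{q})\,dW_k$$ started from $x\in\mathbb{R}^n$ at time $t\in[0,T]$. Then there exists a constant $\tilde L>0$, which does not depend on the choice of the radius $R>0$, such that for every $R>0$ and every such process $q$ with values in $B_R$, $$\mathbb{E}\sup_{t\le k\le T}e^{-\frac12\int_t^k|q_s|^2ds}\,\bigl|X_k^{q}(x,t)-X_k^{q}(\bar x,t)\bigr|\le\tilde L|x-\bar x|,\qquad x,\bar x\in\mathbb{R}^n,\ t\in[0,T].$$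
   Context: For $x,\bar x\in\mathbb{R}^n$ the solutions $X^q(x,t)$ and $X^q(\bar x,t)$ are driven by the same Brownian motion $W$ and the same control process $q$. *)

(* Defs.v *)
From HB Require Import structures.
From mathcomp Require Import all_boot all_order all_algebra.
From mathcomp Require Import all_classical all_reals all_analysis.
Set Implicit Arguments.
Unset Strict Implicit.
Unset Printing Implicit Defensive.
Import Order.TTheory GRing.Theory Num.Theory.
Import numFieldNormedType.Exports.
Local Open Scope classical_set_scope.
Local Open Scope ring_scope.

(* Euclidean norm of a vector, Frobenius norm of a matrix. The library norm
   `|A| on matrices is the max-norm. *)
Definition enorm (R : realType) (m n : nat) (A : 'M[R]_(m, n)) : R :=
  Num.sqrt (\sum_i \sum_j A i j ^+ 2).

Definition lipschitz_euclid (R : realType) (n m p : nat)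
    (f : 'cV[R]_n -> 'M[R]_(m, p)) : Prop :=
  exists K : R, forall x y, enorm (f x - f y) <= K * enorm (x - y).

Definition bounded_euclid (R : realType) (n m p : nat)
    (f : 'cV[R]_n -> 'M[R]_(m, p)) : Prop :=
  exists K : R, forall x, enorm (f x) <= K.

(* All processes are indexed by R; only their values at the times of the
   relevant interval are ever constrained or used. *)

Definition filtration (d : measure_display) (Omega : measurableType d)
    (R : realType) (T : R) (F : R -> set (set Omega)) : Prop :=
  (forall k, 0 <= k <= T ->
     sigma_algebra setT (F k) /\ F k `<=` measurable) /\
  (forall s k : R, 0 <= s -> s <= k -> k <= T -> F s `<=` F k).

Definition measurable_wrt (d : measure_display) (Omega : measurableType d)
    (R : realType) (G : set (set Omega)) (f : Omega -> R) : Prop :=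
  measurable_fun setT (f : g_sigma_algebraType G -> R).

Definition adapted (d : measure_display) (Omega : measurableType d)
    (R : realType) (F : R -> set (set Omega)) (a b : R) (n : nat)
    (Y : R -> Omega -> 'cV[R]_n) : Prop :=
  forall k, a <= k <= b ->
    forall i, measurable_wrt (F k) (fun w => Y k w i 0).

(* (s, w) |-> h s w is B([a, k]) (x) F_k-measurable on [a, k] x Omega. *)
Definition progressive (d : measure_display) (Omega : measurableType d)
    (R : realType) (F : R -> set (set Omega)) (a b : R)
    (h : R -> Omega -> R) : Prop :=
  forall k, a <= k <= b ->
    measurable_fun (`[a, k] `*` setT)
      (fun z : R * g_sigma_algebraType (F k) => h z.1 z.2).

Definition continuous_paths (Omega : Type) (R : realType) (a b : R) (n : nat)
    (Y : R -> Omega -> 'cV[R]_n) : Prop :=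
  forall w, {within `[a, b], continuous (fun k => Y k w)}.

(* n-dimensional standard F-Brownian motion on [0, T]: the increments
   W_k - W_s are N(0, (k - s) I_n) and independent of F_s, where both the law
   and the independence are tested on the boxes B_1 x ... x B_n, a pi-system
   generating the Borel sets of R^n. The second parameter of normal_prob is the
   standard deviation. *)
Definition brownian_motion (d : measure_display) (Omega : measurableType d)
    (R : realType) (P : probability Omega R) (T : R)
    (F : R -> set (set Omega)) (n : nat) (W : R -> Omega -> 'cV[R]_n) : Prop :=
  let incr_in s k (B : 'I_n -> set R) :=
    [set w | forall i, B i ((W k w - W s w) i 0)] in
  [/\ {ae P, forall w, W 0 w = 0},
      continuous_paths 0 T W,
      adapted F 0 T W,
      forall s k : R, 0 <= s -> s < k -> k <= T ->
        forall B : 'I_n -> set R, (forall i, measurable (B i)) ->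
          P (incr_in s k B) =
          (\prod_i normal_prob 0 (Num.sqrt (k - s)) (B i))%E
    & forall s k : R, 0 <= s -> s < k -> k <= T ->
        forall (A : set Omega) (B : 'I_n -> set R), F s A ->
          (forall i, measurable (B i)) ->
          P (A `&` incr_in s k B) = (P A * P (incr_in s k B))%E].

(* The process sum_(l < size) coef_l 1_(]time_l, time_(l+1)]). *)
Record step_process (Omega : Type) (R : realType) := StepProcess {
  step_size : nat ;
  step_time : nat -> R ;
  step_coef : nat -> Omega -> R }.

Definition is_step_process (d : measure_display) (Omega : measurableType d)
    (R : realType) (F : R -> set (set Omega)) (a b : R)
    (phi : step_process Omega R) : Prop :=
  [/\ step_time phi 0 = a,
      step_time phi (step_size phi) = b,
      forall l, (l < step_size phi)%N ->
        step_time phi l <= step_time phi l.+1,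
      forall l, (l < step_size phi)%N ->
        measurable_wrt (F (step_time phi l)) (step_coef phi l)
    & exists C : R, forall l w, (l < step_size phi)%N ->
        `|step_coef phi l w| <= C].

Definition step_value (Omega : Type) (R : realType)
    (phi : step_process Omega R) (s : R) (w : Omega) : R :=
  \sum_(l < step_size phi)
    step_coef phi l w *
      \1_(`]step_time phi l, step_time phi l.+1]%classic : set R) s.

Definition step_integral (Omega : Type) (R : realType)
    (phi : step_process Omega R) (B : R -> Omega -> R) (k : R) (w : Omega) : R :=
  \sum_(l < step_size phi)
    step_coef phi l w * (B (Num.min k (step_time phi l.+1)) w
                         - B (Num.min k (step_time phi l)) w).

(* I is (a continuous version of) the Ito integral k |-> int_a^k h_s dB_s,
   a <= k <= b, of h in L^2(ds (x) P), defined as the L^2-limit of the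
   integrals of step processes converging to h in L^2(ds (x) P). B is meant to
   be a scalar F-Brownian motion. *)
Definition ito_integral (d : measure_display) (Omega : measurableType d)
    (R : realType) (P : probability Omega R) (F : R -> set (set Omega))
    (B : R -> Omega -> R) (a b : R) (h I : R -> Omega -> R) : Prop :=
  [/\ progressive F a b h,
      (\int[P]_w \int[@lebesgue_measure R]_(s in `[a, b])
         (h s w ^+ 2)%:E < +oo)%E,
      forall w, {within `[a, b], continuous (fun k => I k w)},
      forall k, a <= k <= b -> measurable_fun setT (I k)
    & exists phi : nat -> step_process Omega R,
        [/\ forall m, is_step_process F a b (phi m),
            (fun m => \int[P]_w \int[@lebesgue_measure R]_(s in `[a, b])
               ((step_value (phi m) s w - h s w) ^+ 2)%:E)%E @ \oo --> 0%E
          & forall k, a <= k <= b ->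
            (fun m => \int[P]_w
               ((step_integral (phi m) B k w - I k w) ^+ 2)%:E)%E
              @ \oo --> 0%E]].

Definition control (d : measure_display) (Omega : measurableType d)
    (R : realType) (F : R -> set (set Omega)) (T : R) (n : nat) (rad : R)
    (q : R -> Omega -> 'cV[R]_n) : Prop :=
  (forall i, progressive F 0 T (fun s w => q s w i 0)) /\
  (forall s w, 0 <= s <= T -> enorm (q s w) <= rad).

(* X solves dX = [b(X) - V(X) q] dk + sigma(X) dW on [t, T], X_t = x, on the
   given filtered probability space and for the given W and q. M i j is the
   process int_t^. sigma_ij(X_s) dW^j_s. *)
Definition strong_solution (d : measure_display) (Omega : measurableType d)
    (R : realType) (P : probability Omega R) (F : R -> set (set Omega)) (T : R)
    (n : nat) (W : R -> Omega -> 'cV[R]_n)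
    (b : 'cV[R]_n -> 'cV[R]_n) (V sigma : 'cV[R]_n -> 'M[R]_n)
    (q : R -> Omega -> 'cV[R]_n) (x : 'cV[R]_n) (t : R)
    (X : R -> Omega -> 'cV[R]_n) : Prop :=
  [/\ continuous_paths t T X,
      adapted F t T X
    & exists M : 'I_n -> 'I_n -> R -> Omega -> R,
        (forall i j, ito_integral P F (fun k w => W k w j 0) t T
           (fun s w => sigma (X s w) i j) (M i j)) /\
        {ae P, forall w, forall k, t <= k <= T -> forall i,
           X k w i 0 = x i 0
             + \int[@lebesgue_measure R]_(s in `[t, k])
                 (b (X s w) - V (X s w) *m q s w) i 0
             + \sum_j M i j k w}].

(* Main.v *)
From HB Require Import structures.
Require Import Defs.
From mathcomp Require Import all_boot all_order all_algebra.
From mathcomp Require Import all_classical all_reals all_analysis.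
From mathcomp Require Import measurable_realfun ring lra.
Set Implicit Arguments.
Unset Strict Implicit.
Unset Printing Implicit Defensive.
Import Order.TTheory GRing.Theory Num.Theory.
Import numFieldNormedType.Exports.
Local Open Scope classical_set_scope.
Local Open Scope ring_scope.

(** Write D = X - Xbar, A_k = int_t^k |q|^2, E_k = exp(-A_k/2), and let M be the
    difference of the two martingale parts. The drift part of D is Lipschitz in D
    up to the term (V(X) - V(Xbar)) q, whose size |D||q| is not controlled
    uniformly in R; by AM-GM it is at most (C + |q|^2/64)|D|, and the second half
    is absorbed by the decay of E. Freezing E on the cells of a uniform grid, whose
    mesh (but no other constant) depends on R, gives the pathwise estimate
    E|D| <= C (|D_t| + sup |N|) with N = sum_l E_(g_l) (M_(g_(l+1)) - M_(g_l)), so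
    that neither Ito's formula nor the Burkholder-Davis-Gundy inequality is needed:
    N is again an Ito integral, with integrand bounded by E |sigma(X) - sigma(Xbar)|,
    and Doob's L2 inequality with the Ito isometry bounds E sup N^2 by
    int E (E|D|)^2. A discrete Gronwall argument along the grid concludes. *)

(** * Pathwise estimate on a grid *)

(** A direct Gronwall argument for [|D|] would produce [exp(C int |q|)], hence a constant depending
    on the radius. The weight [E] must pay before absolute values are taken, and this is arranged by
    following [Y = E D - N] along the grid. Subtracting [N] removes the martingale increments. What
    remains in one cell is a convex combination of [Y] and [-N], whose weight [rho] is the relative
    loss of [E], plus the drift error. The error contains [|q|^2] only through the energy [Q] of the
    cell, and [Q <= 4 rho], so the small coefficient [1/64] is beaten by [rho]. The order of choices
    gives uniformity: all constants are built from the Lipschitz constants, [n] and [T], and only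
    then is the mesh chosen small with respect to the radius; powers such as [(1 + 6 c del)^m] are
    bounded by exponentials of [T], so the mesh disappears again. Moments are taken of squares,
    where the isometry works. Gronwall needs a finite quantity to start from; this comes from the
    square integrability of [sigma(X)] that is part of [ito_integral]. The first moment is recovered
    at the end from [y <= (lam + y^2 / lam) / 2] with [lam] close to [|x - xbar|]. *)

Section grid.
Context {R : realType}.
Implicit Types (t del : R) (l m : nat).

Definition grid t del l : R := t + l%:R * del.

Lemma grid0 t del : grid t del 0 = t.
Proof. by rewrite /grid mul0r addr0. Qed.

Lemma gridS t del l : grid t del l.+1 = grid t del l + del.
Proof. by rewrite /grid -natr1 mulrDl mul1r addrA. Qed.

Lemma le_grid t del l m : 0 <= del -> (l <= m)%N -> grid t del l <= grid t del m.
Proof. by move=> d0 lm; rewrite /grid lerD2l ler_wpM2r// ler_nat. Qed.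

Lemma grid_cell t del m s : 0 < del -> (0 < m)%N ->
  t <= s <= grid t del m ->
  exists2 l, (l < m)%N & grid t del l <= s <= grid t del l.+1.
Proof.
move=> d0; elim: m => // m IH _ /andP[ts sm].
have [ms|sm'] := leP (grid t del m) s; first by exists m => //; rewrite ms.
case: m => [|m] in IH sm sm' *.
  by move: sm'; rewrite grid0 ltNge ts.
by have [//||l lm ls] := IH; [rewrite ts ltW|exists l => //; exact: ltnW].
Qed.

(** From [e^x >= 1 + x] one gets [1 - e^(-x) >= x / (1 + x)]. Taken at half the energy of a cell,
    this compares the energy spent there with the relative loss of [E]. *)
Lemma one_sub_expRN (x : R) : 0 <= x <= 1 -> x / 2 <= 1 - expR (- x).
Proof.
move=> /andP[x0 x1]; rewrite expRN.
have h := expR_ge1Dx x.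
have e0 := expR_gt0 x.
have : (expR x)^-1 <= (1 + x)^-1 by rewrite lef_pV2 ?posrE//; lra.
suff : (1 + x)^-1 <= 1 - x / 2 by lra.
rewrite -[X in X <= _]mul1r ler_pdivrMr; nra.
Qed.

(** Since [e^(-x) >= 1 - x], one has [e^x (1 - x) <= 1]. It bounds the change of [E^2] inside one
    cell by a factor 2. *)
Lemma expR_le2 (x : R) : x <= 2^-1 -> expR x <= 2.
Proof.
move=> x1; have := expR_ge1Dx (- x); rewrite expRN => h.
have e0 := expR_gt0 x.
have : (expR x) * (1 - x) <= 1.
  by rewrite -[leRHS](@divff _ (expR x)) ?gt_eqF// ler_wpM2l// ltW.
nra.
Qed.

End grid.

(* The step version of [s |-> int_t^s E dM], [E] being frozen at the left end of
   each cell. *)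
Definition grid_transform (R : realType) (V : lmodType R) (t del : R) (m : nat)
    (E : nat -> R) (M : R -> V) (s : R) : V :=
  \sum_(l < m) E l *: (M (Num.min s (grid t del l.+1))
                       - M (Num.min s (grid t del l))).

(** This is the discrete form of [dN = E dM]. At a time of cell [l] the truncation by [Num.min] has
    completed all earlier summands and annihilated all later ones, so that only summand [l]
    moves. *)
Lemma grid_transform_cell (R : realType) (V : lmodType R) (t del : R) (m : nat)
    (E : nat -> R) (M : R -> V) (l : nat) (s : R) :
  0 < del -> (l < m)%N -> grid t del l <= s <= grid t del l.+1 ->
  grid_transform t del m E M s =
  grid_transform t del m E M (grid t del l) + E l *: (M s - M (grid t del l)).
Proof.
move=> d0 lm /andP[ls sl]; apply/eqP; rewrite addrC -subr_eq; apply/eqP.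
rewrite /grid_transform -sumrB (bigD1 (Ordinal lm))//= big1 ?addr0; last first.
  move=> i /eqP il; have [lti|gti|eqi] := ltngtP i l; last first.
  - by exfalso; apply: il; exact: val_inj.
  - have li : grid t del l.+1 <= grid t del i by apply: le_grid => //; exact: ltW.
    have ii : grid t del i <= grid t del i.+1 by apply: le_grid => //; exact: ltW.
    have ll : grid t del l <= grid t del l.+1 by apply: le_grid => //; exact: ltW.
    rewrite (@min_l _ _ s (grid t del i.+1)) ; last by lra.
    rewrite (@min_l _ _ s (grid t del i)); last by lra.
    rewrite (@min_l _ _ (grid t del l) (grid t del i.+1)); last by lra.
    rewrite (@min_l _ _ (grid t del l) (grid t del i)); last by lra.
    by rewrite !subrr.
  - have li : grid t del i.+1 <= grid t del l by apply: le_grid => //; exact: ltW.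
    have ii : grid t del i <= grid t del i.+1 by apply: le_grid => //; exact: ltW.
    rewrite (@min_r _ _ s (grid t del i.+1)) ; last by lra.
    rewrite (@min_r _ _ s (grid t del i)); last by lra.
    rewrite (@min_r _ _ (grid t del l) (grid t del i.+1)); last by lra.
    rewrite (@min_r _ _ (grid t del l) (grid t del i)); last by lra.
    by rewrite subrr.
have ll : grid t del l <= grid t del l.+1 by apply: le_grid => //; exact: ltW.
by rewrite (min_l sl) (min_r ls) (min_l ll) minxx subrr scaler0 subr0.
Qed.

Lemma grid_transform0 (R : realType) (V : lmodType R) (t del : R) (m : nat)
    (E : nat -> R) (M : R -> V) :
  0 < del -> grid_transform t del m E M t = 0.
Proof.
move=> d0; rewrite /grid_transform big1// => i _.
have h k : t <= grid t del k.
  by rewrite -{1}(grid0 t del); apply: le_grid => //; exact: ltW.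
by rewrite !min_l// subrr scaler0.
Qed.

Section pathwise.
Context {R : realType} {V : normedModType R}.
Variables (t del c rad : R) (m : nat) (A : R -> R) (D M : R -> V) (Nst : R).
Hypotheses (del0 : 0 < del) (c0 : 0 <= c).
Hypothesis (small : c * del + rad ^+ 2 * del <= 2^-1).
Let g := grid t del.
Hypothesis A0 : A t = 0.
Hypothesis A_nd : forall u v, t <= u -> u <= v -> v <= g m -> A u <= A v.
Hypothesis A_lip : forall u v, t <= u -> u <= v -> v <= g m ->
  A v - A u <= rad ^+ 2 * (v - u).
Hypothesis D_bnd : exists d0, forall s, t <= s <= g m -> `|D s| <= d0.
Hypothesis D_eq : forall u v d, t <= u -> u <= v -> v <= g m ->
  (forall s, u <= s <= v -> `|D s| <= d) ->
  `|D v - D u - (M v - M u)| <= d * (c * (v - u) + 64^-1 * (A v - A u)).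

Let E s := expR (- (2^-1 * A s)).
Let N := grid_transform t del m (fun l => E (g l)) M.
Hypothesis N_bnd : forall s, t <= s <= g m -> `|N s| <= Nst.

Let E0 s : 0 < E s. Proof. exact: expR_gt0. Qed.

Let gS l : g l.+1 = g l + del. Proof. exact: gridS. Qed.

Let tg l : t <= g l.
Proof. by rewrite /g -{1}(grid0 t del); apply: le_grid => //; exact: ltW. Qed.

Let gm l : (l <= m)%N -> g l <= g m.
Proof. by move=> lm; apply: le_grid => //; exact: ltW. Qed.

Let Nst0 : 0 <= Nst.
Proof.
have h : t <= t <= g m by rewrite lexx tg.
by rewrite (le_trans (normr_ge0 _) (N_bnd h)).
Qed.

(** With the weight frozen at [g l], the weighted oscillation of [M] in the cell is exactly the
    oscillation of [N]. *)
Let M_cell l s : (l < m)%N -> g l <= s <= g l.+1 ->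
  E (g l) * `|M s - M (g l)| <= 2 * Nst.
Proof.
move=> lm ls; have /andP[ls1 ls2] := ls.
have h := grid_transform_cell (fun l => E (g l)) M del0 lm ls.
have -> : E (g l) * `|M s - M (g l)| = `|N s - N (g l)|.
  by rewrite /N h addrAC subrr add0r normrZ gtr0_norm.
have := ler_normB (N s) (N (g l)).
have := @N_bnd s; have := @N_bnd (g l); rewrite !tg gm ?(ltnW lm)// => /(_ isT).
have -> : t <= s <= g m.
  by rewrite (le_trans (tg l))//= (le_trans ls2)// gm.
move=> h1 /(_ isT) h2; lra.
Qed.

(** The drift over one cell costs at most half of the supremum [d] of [|D|] on that cell, and this
    half is moved to the left-hand side. [D_bnd] makes [d] finite, so the subtraction is legitimate;
    it doubles the other constants. *)
Let D_cell l s : (l < m)%N -> g l <= s <= g l.+1 ->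
  E (g l) * `|D s| <= 2 * (E (g l) * `|D (g l)|) + 4 * Nst.
Proof.
move=> lm ls.
have ll : g l <= g l.+1 by rewrite gS lerDl ltW.
have lm1 : g l.+1 <= g m by exact: gm.
pose S := [set `|D u| | u in `[g l, g l.+1]].
have S0 : S !=set0 by exists `|D (g l)|, (g l) => //=; rewrite in_itv/= lexx.
have hS : has_sup S.
  split => //; have [d0 hd0] := D_bnd; exists d0 => _ [u /= + <-]; rewrite in_itv/=.
  move=> /andP[u1 u2]; apply: hd0.
  by rewrite (le_trans (tg l))//= (le_trans u2).
set d := sup S.
have Dd u : g l <= u <= g l.+1 -> `|D u| <= d.
  by move=> hu; apply: sup_upper_bound => //; exists u => //=; rewrite in_itv.
have hl : g l <= g l <= g l.+1 by rewrite lexx.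
have d0 : 0 <= d := le_trans (normr_ge0 _) (Dd _ hl).
have step u : g l <= u <= g l.+1 ->
    E (g l) * `|D u| <= E (g l) * `|D (g l)| + E (g l) * d * 2^-1 + 2 * Nst.
  move=> hu; have /andP[u1 u2] := hu.
  have um : u <= g m by apply: le_trans lm1.
  have h1 := @D_eq (g l) u d (tg l) u1 um.
  have := A_lip (tg l) u1 um; have := A_nd (tg l) u1 um => an al.
  have {}h1 : `|D u - D (g l) - (M u - M (g l))| <= d * 2^-1.
    apply: le_trans (h1 _) _.
      by move=> s' /andP[a b]; apply: Dd; rewrite a (le_trans b).
    apply: ler_wpM2l => //.
    have ud : u - g l <= del by move: u2; rewrite gS; lra.
    have : c * (u - g l) <= c * del by exact: ler_wpM2l.
    have : rad ^+ 2 * (u - g l) <= rad ^+ 2 * del.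
      by apply: ler_wpM2l => //; exact: sqr_ge0.
    have := small; lra.
  have h2 := M_cell lm hu.
  have : `|D u| <= `|D (g l)| + d * 2^-1 + `|M u - M (g l)|.
    have -> : D u = D (g l) + (D u - D (g l) - (M u - M (g l))) + (M u - M (g l)).
      by rewrite -(addrA (D (g l))) subrK addrC subrK.
    apply: le_trans (ler_normD _ _) _; rewrite lerD2r.
    by apply: le_trans (ler_normD _ _) _; rewrite lerD2l.
  move=> /(ler_wpM2l (ltW (E0 (g l)))); lra.
have : E (g l) * d <= 2 * (E (g l) * `|D (g l)|) + 4 * Nst.
  suff : d <= (2 * (E (g l) * `|D (g l)|) + 4 * Nst) / E (g l).
    by rewrite ler_pdivlMr// mulrC.
  have : d <= (E (g l) * `|D (g l)| + E (g l) * d * 2^-1 + 2 * Nst) / E (g l).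
    apply: sup_le_ub => // _ [u /= + <-]; rewrite in_itv/= => hu.
    by rewrite ler_pdivlMr// mulrC; exact: step.
  rewrite !ler_pdivlMr//; lra.
apply: le_trans; apply: ler_wpM2l; [exact: ltW|exact: Dd].
Qed.

(** Subtracting [N] leaves a quantity driven only by the drift error and the decay of [E], so norms
    may be taken cell by cell without losing the cancellations of the martingale part. *)
Let Y l := E (g l) *: D (g l) - N (g l).

(* [rho = 1 - E (g l.+1) / E (g l)] dominates a quarter of the energy spent in the
   cell, so the drift error [64^-1 * Q] only costs a fraction of the contraction. *)
Let Y_step l : (l < m)%N -> exists2 rho, 0 <= rho <= 1 &
  `|Y l.+1| <= (1 - 7 / 8 * rho + 2 * c * del) * `|Y l|
             + (11 / 8 * rho + 6 * c * del) * Nst.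
Proof.
move=> lm.
have lm1 : g l.+1 <= g m by exact: gm.
have ll : g l <= g l.+1 by rewrite gS lerDl ltW.
set e := E (g l); set e' := E (g l.+1).
pose Q := A (g l.+1) - A (g l).
have Q0 : 0 <= Q by rewrite subr_ge0; exact: A_nd.
have Q1 : Q <= rad ^+ 2 * del.
  by have := A_lip (tg l) ll lm1; rewrite {2}gS addrAC subrr add0r.
have ee' : e' = e * expR (- (2^-1 * Q)).
  rewrite /e' /e /E -expRD; congr expR; rewrite /Q; lra.
set x := expR (- (2^-1 * Q)) in ee'.
have x0 : 0 < x by exact: expR_gt0.
have cd : 0 <= c * del by rewrite mulr_ge0// ltW.
have r0 : 0 <= rad ^+ 2 * del by rewrite mulr_ge0// ?sqr_ge0// ltW.
have sm := small.
have hx : Q / 4 <= 1 - x.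
  have := @one_sub_expRN _ (2^-1 * Q); rewrite -/x => h.
  have : 2^-1 * Q / 2 <= 1 - x by apply: h; apply/andP; split; lra.
  lra.
exists (1 - x); first by apply/andP; split; lra.
set b := D (g l.+1) - D (g l) - (M (g l.+1) - M (g l)).
have hN : N (g l.+1) = N (g l) + e *: (M (g l.+1) - M (g l)).
  by apply: grid_transform_cell => //; rewrite ll lexx.
(* A discrete product rule. Since [e (D + dM)] at [g l] equals [Y l + N (g l.+1)], replacing [e] by
   [e' = x e] gives a convex combination of [Y l] and [- N (g l.+1)], up to the drift error [b]. *)
have YE : Y l.+1 = x *: Y l - (1 - x) *: N (g l.+1) + e' *: b.
  have hD : D (g l.+1) = D (g l) + (M (g l.+1) - M (g l)) + b.
    by rewrite -(addrA (D (g l))) [_ + b]addrC subrK addrC subrK.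
  have hY : e *: (D (g l) + (M (g l.+1) - M (g l))) = Y l + N (g l.+1).
    by rewrite scalerDr hN addrA /Y subrK.
  rewrite {1}/Y -/e' hD scalerDr {1}ee' mulrC -scalerA hY scalerDr scalerBl scale1r.
  by rewrite opprB addrA -(addrA _ (e' *: b)) [e' *: b + _]addrC addrA.
have hb : e' * `|b| <= (2 * (e * `|D (g l)|) + 4 * Nst)
                        * (c * del + 64^-1 * Q).
  have dd : forall s, g l <= s <= g l.+1 ->
      `|D s| <= (2 * (e * `|D (g l)|) + 4 * Nst) / e.
    by move=> s /(D_cell lm); rewrite (ler_pdivlMr _ _ (E0 (g l))) mulrC.
  have gd : g l.+1 - g l = del by rewrite gS addrAC subrr add0r.
  have := D_eq (tg l) ll lm1 dd; rewrite -/b -/Q gd.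
  move=> /(ler_wpM2l (ltW (E0 (g l)))); rewrite -/e => h.
  apply: (@le_trans _ _ (e * `|b|)).
    apply: ler_wpM2r => //; rewrite ee' ler_piMr//; first exact: ltW (E0 _).
    by rewrite /x -[leRHS]expR0 ler_expR; lra.
  apply: le_trans h _.
  set Z := 2 * _ + _; rewrite mulrA [e * _]mulrC divfK// gt_eqF//; exact: E0.
have hZ : e * `|D (g l)| <= `|Y l| + Nst.
  have -> : e * `|D (g l)| = `|Y l + N (g l)|.
    by rewrite /Y subrK normrZ gtr0_norm//; exact: E0.
  apply: le_trans (ler_normD _ _) _; rewrite lerD2l; apply: N_bnd.
  by rewrite tg gm// ltnW.
have hY : `|Y l.+1| <= x * `|Y l| + (1 - x) * Nst + e' * `|b|.
  rewrite YE; apply: le_trans (ler_normD _ _) _.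
  rewrite [`|e' *: b|]normrZ (gtr0_norm (E0 _)) lerD2r.
  apply: le_trans (ler_normB _ _) _; rewrite !normrZ (gtr0_norm x0).
  rewrite (@ger0_norm _ (1 - x)); last by lra.
  by rewrite lerD2l; apply: ler_wpM2l; [lra|apply: N_bnd; rewrite tg].
apply: (le_trans hY); move: hb hZ; set z := e * _ => hb hZ.
have y0 := normr_ge0 (Y l).
have k0 : 0 <= c * del + 64^-1 * Q by lra.
have : e' * `|b| <= (2 * `|Y l| + 6 * Nst) * (c * del + 64^-1 * Q).
  by apply: (le_trans hb); apply: ler_wpM2r => //; lra.
(* [Q <= 4 (1 - x)] turns [Q / 64] into [(1 - x) / 16]. With [rho = 1 - x] the coefficient of
   [|Y l|] becomes [1 - rho + rho / 8] and that of [Nst] becomes [rho + 6 rho / 16], whence 7/8 and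
   11/8. *)
have : (2 * `|Y l| + 6 * Nst) * (c * del + 64^-1 * Q)
    <= (2 * `|Y l| + 6 * Nst) * (c * del + 16^-1 * (1 - x)).
  by apply: ler_wpM2l; [have := Nst0; lra|lra].
lra.
Qed.

(** The bound contains [2 * Nst] so that the contraction pays for the forcing term: as [Nst] is at
    most half of the bound, [11/8 rho Nst] is covered by [7/8 rho] times the bound. All terms in
    [rho] cancel, and with them the control; only the growth in [c * del] survives. *)
Let Y_bnd l : (l <= m)%N ->
  `|Y l| <= (1 + 6 * (c * del)) ^+ l * (`|D t| + 2 * Nst).
Proof.
have d0 : 0 <= `|D t| by exact: normr_ge0.
have cd : 0 <= c * del by rewrite mulr_ge0// ltW.
have := Nst0 => n0.
elim: l => [_|l IH lm].
  have g0 : g 0 = t := grid0 t del.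
  rewrite expr0 mul1r /Y g0 /E A0 mulr0 oppr0 expR0 scale1r /N.
  by rewrite grid_transform0// subr0; lra.
have [rho /andP[r0 r1] h] := Y_step lm.
have {}IH := IH (ltnW lm).
set B := `|D t| + 2 * Nst in IH *.
set G := _ ^+ l * B in IH.
have BG : B <= G.
  rewrite /G ler_peMl//; first by rewrite /B; lra.
  by rewrite exprn_ege1//; lra.
apply: (le_trans h); rewrite exprS -[leRHS]mulrA -/G.
have k : 0 <= 1 - 7 / 8 * rho + 2 * c * del by rewrite -mulrA; lra.
have h1 := ler_wpM2l k IH.
have h2 : (11 / 8 * rho + 6 * c * del) * Nst <= (7 / 8 * rho + 3 * (c * del)) * G.
  have : 2 * Nst <= G by apply: le_trans BG; rewrite /B; lra.
  have k2 : 0 <= 7 / 8 * rho + 3 * (c * del) by lra.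
  move=> /(ler_wpM2l k2); have := mulr_ge0 r0 n0; lra.
have B0 : 0 <= B by rewrite /B; lra.
have := mulr_ge0 cd (le_trans B0 BG).
lra.
Qed.

Lemma pathwise_bound s : t <= s <= g m ->
  E s * `|D s| <= 10 * expR (6 * c * (m%:R * del)) * (`|D t| + Nst).
Proof.
move=> hs.
have d0 : 0 <= `|D t| by exact: normr_ge0.
have cd : 0 <= c * del by rewrite mulr_ge0// ltW.
have := Nst0 => n0.
have [m0|m0] := posnP m.
  move: hs; rewrite m0 {1}/g grid0 => /andP[ts st]; have -> : s = t by apply/le_anti/andP.
  rewrite /E A0 mulr0 oppr0 expR0 mul1r mul0r mulr0 expR0; lra.
have [l lm ls] := grid_cell del0 m0 hs; have /andP[ls1 ls2] := ls.
have h := D_cell lm ls.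
have EE : E s <= E (g l).
  rewrite ler_expR lerN2 ler_wpM2l//; apply: A_nd => //.
  by have /andP[] := hs.
apply: (@le_trans _ _ (E (g l) * `|D s|)); first exact: ler_wpM2r.
apply: (le_trans h).
have hZ : E (g l) * `|D (g l)| <= `|Y l| + Nst.
  have -> : E (g l) * `|D (g l)| = `|Y l + N (g l)|.
    by rewrite /Y subrK normrZ gtr0_norm//; exact: E0.
  apply: le_trans (ler_normD _ _) _; rewrite lerD2l; apply: N_bnd.
  by rewrite tg gm// ltnW.
have hY := Y_bnd (ltnW lm).
have hp : (1 + 6 * (c * del)) ^+ l <= expR (6 * c * (m%:R * del)).
  apply: (@le_trans _ _ ((1 + 6 * (c * del)) ^+ m)).
    by apply: ler_weXn2l; [lra|exact: ltnW].
  have -> : 6 * c * (m%:R * del) = m%:R * (6 * (c * del)) by ring.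
  rewrite mulr_natl expRM_natl; apply: lerXn2r; rewrite ?nnegrE ?expR_ge0//; first lra.
  exact: expR_ge1Dx.
set K := expR _ in hp *.
have K1 : 1 <= K.
  by rewrite /K -expR0 ler_expR !mulr_ge0// ltW.
(* The chain gives [2 |Y| + 6 Nst <= K (2 |D t| + 10 Nst)]; this is the origin of the factor 10. *)
have : `|Y l| <= K * (`|D t| + 2 * Nst).
  by apply: (le_trans hY); apply: ler_wpM2r => //; lra.
nra.
Qed.

End pathwise.

(** * Gaussian moments and independence *)

Section normal_moments.
Context {R : realType}.
Local Notation mu := (@lebesgue_measure R).
Variable s : R.
Hypothesis s0 : 0 < s.

Let mx2 : measurable_fun setT (fun x : R => x ^+ 2).
Proof. exact: measurable_funX. Qed.

(** The Radon-Nikodym derivative of the normal law agrees almost everywhere with the Gaussian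
    density, because both have the same integral over every measurable set. *)
Lemma ge0_integral_normal_prob (f : R -> \bar R) : measurable_fun setT f ->
  (forall x, 0 <= f x)%E ->
  (\int[normal_prob 0 s]_x f x = \int[mu]_x (f x * (normal_pdf 0 s x)%:E))%E.
Proof.
move=> mf f0.
have dom := normal_prob_dominates (0 : R) s.
rewrite -(Radon_Nikodym_SigmaFinite.change_of_variables dom f0 measurableT mf).
have mpdf : measurable_fun setT (fun x : R => (normal_pdf 0 s x)%:E).
  apply/measurable_EFinP. exact: measurable_normal_pdf.
have mg := measurable_int _ (Radon_Nikodym_SigmaFinite.f_integrable dom).
apply: ae_eq_integral => //.
- exact: emeasurable_funM.
- exact: emeasurable_funM.
have : ae_eq mu setT (Radon_Nikodym_SigmaFinite.f (normal_prob 0 s) mu)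
    (fun x : R => (normal_pdf 0 s x)%:E).
  apply: integral_ae_eq => //.
    exact: Radon_Nikodym_SigmaFinite.f_integrable.
  by move=> E _ mE; rewrite -Radon_Nikodym_SigmaFinite.f_integral.
by apply: filterS => x /= h hx; rewrite h.
Qed.

Lemma normal_pdf_scale (x : R) : s * normal_pdf 0 s (s * x) = normal_pdf 0 1 x.
Proof.
rewrite !normal_pdfE ?gt_eqF// /normal_peak /normal_fun !subr0.
rewrite mulrA expr1n mul1r; congr (_ * expR _).
  rewrite -mulrnAr sqrtrM ?sqr_ge0// sqrtr_sqr gtr0_norm// invfM mulrA divff ?mul1r//.
  by rewrite gt_eqF.
rewrite exprMn -[s ^+ 2 *+ 2]mulr_natr !mulNr -mulf_div divff ?mul1r//.
by rewrite expf_neq0// gt_eqF.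
Qed.

(** The substitution [s * x] isolates the dependence on [s]; proportionality of the variance to
    [s ^+ 2] is what the isometry requires. *)
Lemma integral_normal_prob_sqr :
  (\int[normal_prob 0 s]_x (x ^+ 2)%:E
   = (s ^+ 2)%:E * \int[mu]_x (x ^+ 2 * normal_pdf 0 1 x)%:E)%E.
Proof.
have cX : continuous (fun x : R => x ^+ 2 * normal_pdf 0 s x).
  move=> x; apply: cvgM; first exact: exprn_continuous.
  by apply: continuous_normal_pdf; rewrite gt_eqF.
have X0 x : 0 <= x ^+ 2 * normal_pdf 0 s x.
  by rewrite mulr_ge0 ?sqr_ge0 ?normal_pdf_ge0.
rewrite ge0_integral_normal_prob; last 2 first.
- exact/measurable_EFinP.
- by move=> x; rewrite lee_fin sqr_ge0.
under eq_integral do rewrite -EFinM.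
have dF : (fun x : R => s * x)^`()%classic = cst s.
  by apply/funext => x; rewrite derive1E deriveM// derive_id derive_cst scaler0 addr0 /GRing.scale/= mulr1.
rewrite (@increasing_ge0_integration_by_substitutionT R (fun x => s * x))//; last 6 first.
- by move=> x y xy; rewrite ltr_pM2l.
- by rewrite dF => ?; exact: cvg_cst.
- by rewrite dF; exact: is_cvg_cst.
- by rewrite dF; exact: is_cvg_cst.
- by apply: gt0_cvgMrNy => //; exact: cvg_id.
- by apply: gt0_cvgMry => //; exact: cvg_id.
rewrite -ge0_integralZl//; last 3 first.
- apply/measurable_EFinP; apply: measurable_funM => //.
  exact: measurable_normal_pdf.
- by move=> x _; rewrite lee_fin mulr_ge0 ?sqr_ge0 ?normal_pdf_ge0.
- by rewrite lee_fin sqr_ge0.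
apply: eq_integral => x _; rewrite dF /= -EFinM; congr EFin.
have E (u v w : R) : (u * v) ^+ 2 * w * u = u ^+ 2 * (v ^+ 2 * (u * w)) by ring.
by rewrite -(normal_pdf_scale x); exact: E.
Qed.

Lemma integral_normal_prob_sqr_lty : (\int[mu]_x (x ^+ 2 * normal_pdf 0 s x)%:E < +oo)%E.
Proof.
(* With [u = x^2 / (4 s^2)] the integrand is a multiple of [u e^(-u) e^(-u)]. The first two factors
   are at most 1 together, and the last is a Gaussian density of variance [2 s^2] up to
   normalisation. *)
pose r := Num.sqrt 2 * s.
have r0 : 0 < r by rewrite mulr_gt0// sqrtr_gt0.
pose C := 4 * s ^+ 2 * (normal_peak s / normal_peak r).
have C0 : 0 <= C.
  apply: mulr_ge0; first by rewrite mulr_ge0// sqr_ge0.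
  by apply: divr_ge0; exact: normal_peak_ge0.
apply: (@le_lt_trans _ _ (\int[mu]_x (C%:E * (normal_pdf 0 r x)%:E))%E).
  apply: ge0_le_integral => //=.
  - by move=> x _; rewrite lee_fin mulr_ge0 ?sqr_ge0 ?normal_pdf_ge0.
  - apply/measurable_EFinP; apply: measurable_funM => //.
    exact: measurable_normal_pdf.
  - by apply/measurable_EFinP; apply: measurable_funM => //; exact: measurable_normal_pdf.
  move=> x _; rewrite -EFinM lee_fin !normal_pdfE ?gt_eqF// /normal_fun !subr0.
  have pr : normal_peak r != 0 by rewrite gt_eqF// normal_peak_gt0// gt_eqF.
  rewrite /C [leRHS]mulrA -[X in _ <= X * _]mulrA divfK//.
  have r2 : r ^+ 2 = 2 * s ^+ 2 by rewrite /r exprMn sqr_sqrtr.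
  rewrite r2.
  pose u := x ^+ 2 / (4 * s ^+ 2).
  have s2 : s ^+ 2 != 0 by rewrite expf_neq0// gt_eqF.
  have -> : - x ^+ 2 / (s ^+ 2 *+ 2) = - u + - u.
    by rewrite /u -mulr_natr; move: s2; generalize (s ^+ 2) (x ^+ 2 : R) => S X S0; field.
  have -> : - x ^+ 2 / (2 * s ^+ 2 *+ 2) = - u.
    by rewrite /u -mulr_natr; move: s2; generalize (s ^+ 2) (x ^+ 2 : R) => S X S0; field.
  have -> : x ^+ 2 = 4 * s ^+ 2 * u.
    by rewrite /u; move: s2; generalize (s ^+ 2) (x ^+ 2 : R) => S X S0; field.
  rewrite expRD.
  have h : u * expR (- u) <= 1.
    by rewrite expRN ler_pdivrMr ?expR_gt0// mul1r; have := expR_ge1Dx u; lra.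
  have -> : 4 * s ^+ 2 * u * (normal_peak s * (expR (- u) * expR (- u)))
     = (u * expR (- u)) * (4 * s ^+ 2 * normal_peak s * expR (- u)) by ring.
  apply: ler_piMl => //; apply: mulr_ge0; last exact: expR_ge0.
  by apply: mulr_ge0; [rewrite mulr_ge0// sqr_ge0|exact: normal_peak_ge0].
rewrite integralZl//; last exact: integrable_normal_pdf.
by rewrite integral_normal_pdf mule1 ltry.
Qed.

Lemma integrable_normal_prob_sqr :
  (normal_prob 0 s).-integrable setT (fun x : R => (x ^+ 2)%:E).
Proof.
apply/integrableP; split; first by apply/measurable_EFinP; exact: mx2.
under eq_integral do rewrite /= ger0_norm ?sqr_ge0//.
rewrite ge0_integral_normal_prob; last 2 first.
- by apply/measurable_EFinP; exact: mx2.
- by move=> x; rewrite lee_fin sqr_ge0.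
under eq_integral do rewrite -EFinM.
exact: integral_normal_prob_sqr_lty.
Qed.

Lemma integrable_normal_prob_id :
  (normal_prob 0 s).-integrable setT (fun x : R => x%:E).
Proof.
have ig : (normal_prob 0 s).-integrable setT
    (cst 1%:E \+ (fun x : R => (x ^+ 2)%:E))%E.
  apply: integrableD => //; last exact: integrable_normal_prob_sqr.
  exact: finite_measure_integrable_cst.
apply: le_integrable ig => //; first by apply/measurable_EFinP.
move=> x _ /=; rewrite lee_fin [leRHS]ger0_norm ?addr_ge0 ?sqr_ge0//.
by have [x0|x0] := ger0P (x : R); nra.
Qed.

(** By symmetry of the density the positive and the negative part have the same integral; it is
    finite, so the difference is 0. *)
Lemma integral_normal_prob_id : (\int[normal_prob 0 s]_x x%:E = 0)%E.
Proof.
rewrite integralE.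
have mp := measurable_normal_pdf (0 : R) s.
have np x := normal_pdf_ge0 (0 : R) s x.
rewrite !ge0_integral_normal_prob//; last 2 first.
- by apply: measurable_funeneg; exact/measurable_EFinP.
- by apply: measurable_funepos; exact/measurable_EFinP.
have afin : (\int[mu]_x (EFin^\+ x * (normal_pdf 0 s x)%:E))%E \is a fin_num.
  rewrite -ge0_integral_normal_prob//; last first.
    by apply: measurable_funepos; exact/measurable_EFinP.
  rewrite ge0_fin_numE; last exact: integral_ge0.
  exact: integral_funepos_lt_pinfty integrable_normal_prob_id.
set a := (X in (X - _)%E); set b := (X in (_ - X)%E).
have mxp : measurable_fun setT (fun x : R => (x * normal_pdf 0 s x)%:E).
  by apply/measurable_EFinP; exact: measurable_funM.
have aE : a = (\int[mu]_(x in `[0%R, +oo[) (x * normal_pdf 0 s x)%:E)%E.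
  rewrite [RHS]integral_mkcond; apply: eq_integral => x _.
  rewrite /patch mem_setE in_itv/= andbT funeposE.
  have [x0|x0] := leP 0 x; first by rewrite max_l ?lee_fin.
  by rewrite max_r ?mul0e// lee_fin ltW.
(* The endpoint is written [- 0] to fit the reflection formula for integrals used below. *)
have bE : b = (\int[mu]_(x in `]-oo, (- 0)%R]) ((- x) * normal_pdf 0 s x)%:E)%E.
  rewrite [RHS]integral_mkcond; apply: eq_integral => x _.
  rewrite /patch mem_setE in_itv/= oppr0 funenegE.
  have [x0|x0] := leP x 0; first by rewrite -EFinN max_l ?lee_fin ?oppr_ge0.
  by rewrite -EFinN max_r ?mul0e// lee_fin oppr_le0 ltW.
have cX : continuous (fun x : R => - x * normal_pdf 0 s x).
  move=> x; apply: cvgM; first by apply: cvgN; exact: cvg_id.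
  by apply: continuous_normal_pdf; rewrite gt_eqF.
rewrite bE ge0_integration_by_substitutionNy; last 2 first.
- exact: continuous_subspaceT.
- move=> x; rewrite in_itv/= oppr0 => x0.
  by rewrite mulr_ge0// oppr_ge0 ltW.
have aE' : a = (\int[mu]_(x in `[0%R, +oo[)
    (((fun x => - x * normal_pdf 0 s x) \o -%R) x)%:E)%E.
  rewrite aE; apply: eq_integral => x _ /=; rewrite opprK; congr (_ * _)%:E.
  by rewrite !normal_pdfE ?gt_eqF// /normal_fun !subr0 sqrrN.
by rewrite -aE' subee.
Qed.

End normal_moments.

Section independence.
Local Open Scope ereal_scope.
Context d (T : measurableType d) (R : realType) (P : probability T R).
Context d1 (T1 : measurableType d1) d2 (T2 : measurableType d2).
Variables (X : T -> T1) (Z : T -> T2) (N : probability T2 R).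
Hypotheses (mX : measurable_fun setT X) (mZ : measurable_fun setT Z).
Hypothesis law : forall A B, measurable A -> measurable B ->
  P (X @^-1` A `&` Z @^-1` B) = P (X @^-1` A) * N B.

(** The hypothesis [law] says that the joint law of [X] and [Z] agrees on rectangles with a product
    measure, hence equals it, and Fubini applies. In the applications [T1] is [Omega] with the
    sigma-algebra [F s] and [X] is the identity, so that [Y] is an arbitrary [F s]-measurable
    variable. *)
Lemma integral_indep (Y : T1 -> R) (f : T2 -> R) :
  measurable_fun setT Y -> measurable_fun setT f ->
  P.-integrable setT (fun w => (Y (X w))%:E) -> N.-integrable setT (fun z => (f z)%:E) ->
  P.-integrable setT (fun w => (Y (X w) * f (Z w))%:E) /\
  \int[P]_w (Y (X w) * f (Z w))%:E
    = (\int[P]_w (Y (X w))%:E) * (\int[N]_z (f z)%:E).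
Proof.
move=> mY mf iY intf.
pose X' : {mfun T >-> T1} := HB.pack X (isMeasurableFun.Build _ _ _ _ _ mX).
have mXZ : measurable_fun setT (fun w => (X w, Z w)) by exact: measurable_fun_pair.
pose XZ : {mfun T >-> (T1 * T2)%type} :=
  HB.pack (fun w => (X w, Z w)) (isMeasurableFun.Build _ _ _ _ _ mXZ).
pose m1 := distribution P X'; pose m := distribution P XZ.
have mE A : measurable A -> (m1 \x N) A = m A.
  by move=> mA; apply: product_measure_unique.
pose h := fun z : T1 * T2 => (Y z.1 * f z.2)%:E.
have mh : measurable_fun setT h.
  apply/measurable_EFinP; apply: measurable_funM.
    exact: measurableT_comp.
  exact: measurableT_comp.
have iY1 : m1.-integrable setT (fun x => (Y x)%:E).
  by apply: integrable_pushforward => //; exact/measurable_EFinP.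
have fN : \int[N]_z `|(f z)%:E| \is a fin_num.
  by rewrite ge0_fin_numE ?integral_ge0//; have /integrableP[] := intf.
have ih1 : (m1 \x N).-integrable setT h.
  apply/integrable12ltyP => //.
  under eq_integral => x _.
    under eq_integral => y _ do rewrite /h /= normrM EFinM.
    rewrite ge0_integralZl//; last first.
      by apply/measurable_EFinP; exact: measurableT_comp.
    over.
  rewrite /= ge0_integralZr//; last 2 first.
  - by apply/measurable_EFinP; exact: measurableT_comp.
  - exact: integral_ge0.
  apply: lte_mul_pinfty; first exact: integral_ge0.
    by rewrite ge0_fin_numE ?integral_ge0//; have /integrableP[] := iY1.
  by have /integrableP[] := intf.
have ih : m.-integrable setT h.
  apply/integrableP; split => //.
  have /integrableP[_] := ih1.
  by rewrite (eq_measure_integral m)// => A mA _; exact: mE.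
have ihP : P.-integrable setT (h \o XZ).
  apply/integrableP; split; first exact: measurableT_comp.
  have /integrableP[_] := ih.
  by rewrite ge0_integral_distribution//; exact: measurableT_comp.
split => //.
have -> : \int[P]_w (Y (X w) * f (Z w))%:E = \int[m]_z h z.
  by rewrite integral_distribution.
rewrite (eq_measure_integral (m1 \x N)); last by move=> A mA _; exact/esym/mE.
rewrite -integral12_prod_meas1//.
have -> : \int[P]_w (Y (X w))%:E = \int[m1]_x (Y x)%:E.
  by rewrite (integral_distribution (X := X')) //; exact/measurable_EFinP.
rewrite -(fineK (integrable_fin_num _ intf))//.
rewrite -integralZr//; apply: eq_integral => x _ /=.
by rewrite fineK -?integralZl//; exact: integrable_fin_num.
Qed.
End independence.

(** * Square integrable random variables *)

Section square_integrable.
Context d (Omega : measurableType d) (R : realType) (P : probability Omega R).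
Implicit Types f g c : Omega -> R.

Definition sqint f := measurable_fun setT f /\
  P.-integrable setT (fun w => (f w ^+ 2)%:E).

Lemma sqint_mul f g : sqint f -> sqint g ->
  P.-integrable setT (fun w => (f w * g w)%:E).
Proof.
move=> [mf f2] [mg g2].
have h : P.-integrable setT ((fun w => (f w ^+ 2)%:E) \+ (fun w => (g w ^+ 2)%:E))%E.
  exact: integrableD.
apply: le_integrable h => //.
  by apply/measurable_EFinP; exact: measurable_funM.
move=> w _ /=; rewrite lee_fin [leRHS]ger0_norm ?addr_ge0 ?sqr_ge0//.
rewrite ler_norml; apply/andP; split.
  by have := sqr_ge0 (f w + g w); nra.
by have := sqr_ge0 (f w - g w); nra.
Qed.

Lemma sqintZ c f C : measurable_fun setT c -> (forall w, `|c w| <= C) ->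
  sqint f -> sqint (fun w => c w * f w).
Proof.
move=> mc cC [mf f2]; split; first exact: measurable_funM.
have := integrableZl measurableT (C ^+ 2) f2; apply: le_integrable => //.
  by apply/measurable_EFinP/measurable_funX; exact: measurable_funM.
move=> w _ /=; rewrite lee_fin ger0_norm ?sqr_ge0//.
rewrite ger0_norm; last by rewrite mulr_ge0// sqr_ge0.
rewrite exprMn; apply: ler_wpM2r; first exact: sqr_ge0.
rewrite -[c w ^+ 2]real_normK ?num_real//.
by rewrite lerXn2r ?nnegrE// (le_trans (normr_ge0 (c w))).
Qed.

Lemma sqintD f g : sqint f -> sqint g -> sqint (fun w => f w + g w).
Proof.
move=> sf sg; have fg := sqint_mul sf sg.
move: sf sg => [mf f2] [mg g2]; split; first exact: measurable_funD.
have h := integrableD measurableT (integrableD measurableT f2 g2)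
  (integrableZl measurableT 2 fg).
apply: eq_integrable h => // w _ /=.
by rewrite -EFinM -!EFinD; congr EFin; ring.
Qed.

Lemma sqint_cst (r : R) : sqint (fun=> r).
Proof.
split; first exact: measurable_cst.
exact: (finite_measure_integrable_cst _ (r ^+ 2)).
Qed.

Lemma sqint_bounded c C : measurable_fun setT c -> (forall w, `|c w| <= C) ->
  sqint c.
Proof.
move=> mc cC; have := sqintZ mc cC (sqint_cst 1).
by congr sqint; apply/funext => w; rewrite mulr1.
Qed.

Lemma sqintB f g : sqint f -> sqint g -> sqint (fun w => f w - g w).
Proof.
move=> sf sg; apply: sqintD => //.
have : sqint (fun w => -1 * g w).
  by apply: (@sqintZ (fun=> -1) g `|-1|) => //; exact: measurable_cst.
by congr sqint; apply/funext => w; rewrite mulN1r.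
Qed.

Lemma sqint_integrable f : sqint f -> P.-integrable setT (fun w => (f w)%:E).
Proof.
move=> /sqint_mul/(_ (sqint_cst 1)).
by apply: eq_integrable => // w _ /=; rewrite mulr1.
Qed.

End square_integrable.

(** * Measurability with respect to a filtration *)

Section filtration_theory.
Context d (Omega : measurableType d) (R : realType).
Variables (T : R) (F : R -> set (set Omega)).
Hypothesis Ff : filtration T F.

Lemma measurable_wrtP (G : set (set Omega)) (f : Omega -> R) :
  sigma_algebra setT G ->
  measurable_wrt G f <-> (forall A, measurable A -> G (f @^-1` A)).
Proof.
move=> sG; split => [mf A mA|h _ A mA].
  have : <<s G >> (setT `&` f @^-1` A) by exact: mf.
  by rewrite setTI sigma_algebra_id.
by rewrite setTI; apply: sub_sigma_algebra; exact: h.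
Qed.

Lemma measurable_wrt_fun s (f : Omega -> R) : 0 <= s <= T -> measurable_wrt (F s) f ->
  measurable_fun setT f.
Proof.
move=> sT; have [sF Fm] := Ff.1 _ sT.
move=> /(measurable_wrtP _ sF) h _ A mA; rewrite setTI; apply: Fm; exact: h.
Qed.

Lemma measurable_wrtW s k (f : Omega -> R) : 0 <= s -> s <= k -> k <= T ->
  measurable_wrt (F s) f -> measurable_wrt (F k) f.
Proof.
move=> s0 sk kT.
have [|sF _] := Ff.1 s; first by rewrite s0 (le_trans sk).
have [|kF _] := Ff.1 k; first by rewrite kT (le_trans s0).
move=> /(measurable_wrtP _ sF) h; apply/(measurable_wrtP _ kF) => A mA.
exact/(Ff.2 _ _ s0 sk kT)/h.
Qed.

Lemma measurable_wrt_id s : 0 <= s <= T ->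
  measurable_fun setT (id : Omega -> g_sigma_algebraType (F s)).
Proof.
move=> sT; have [sF Fm] := Ff.1 _ sT.
move=> _ A mA; rewrite setTI; apply: Fm.
by have : <<s F s >> A := mA; rewrite sigma_algebra_id.
Qed.

End filtration_theory.

(** * Increments of one Brownian coordinate against the past *)

Section brownian_increments.
Context d (Omega : measurableType d) (R : realType) (P : probability Omega R).
Variables (T : R) (F : R -> set (set Omega)) (n : nat).
Variables (W : R -> Omega -> 'cV[R]_n) (j : 'I_n).
Hypotheses (Ff : filtration T F) (bm : brownian_motion P T F W).
Local Notation B k w := (W k w j 0).

Lemma brownian_measurable_wrt k : 0 <= k <= T -> measurable_wrt (F k) (fun w => B k w).
Proof. by move=> kT; have [_ _ /(_ k kT j)] := bm. Qed.

Lemma brownian_measurable k : 0 <= k <= T -> measurable_fun setT (fun w => B k w).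
Proof. by move=> kT; apply: (measurable_wrt_fun Ff kT); exact: brownian_measurable_wrt. Qed.

(** The boxes used have the whole line as every side except the [j]-th; these sides contribute the
    factor 1 to the product of normal probabilities. *)
Lemma brownian_increment_law s k (A : set Omega) (C : set R) :
  0 <= s -> s < k -> k <= T -> F s A -> measurable C ->
  P (A `&` (fun w => B k w - B s w) @^-1` C)
  = (P A * normal_prob 0 (Num.sqrt (k - s)) C)%E.
Proof.
move=> s0 sk kT FA mC.
pose D (i : 'I_n) : set R := if i == j then C else setT.
have mD i : measurable (D i) by rewrite /D; case: ifP.
have [_ _ _ /(_ _ _ s0 sk kT D mD) h1 /(_ _ _ s0 sk kT A D FA mD)] := bm.
rewrite h1.
have -> : [set w | forall i, D i ((W k w - W s w) i 0)] =
          (fun w => B k w - B s w) @^-1` C.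
  apply/seteqP; split => w /=.
    by move=> /(_ j); rewrite /D eqxx !mxE.
  by move=> h i; rewrite /D; case: eqP => // ->; rewrite !mxE.
move=> ->; congr (_ * _)%E.
rewrite (bigD1 j)//= /D eqxx big1 ?mule1// => i ij.
by rewrite (negbTE ij) probability_setT.
Qed.

(* The variance of the standard normal law; only its finiteness is used, not its value [1]. *)
Definition normal_var : R :=
  fine (\int[lebesgue_measure]_x ((x ^+ 2 * normal_pdf 0 1 x)%R%:E))%E.

Lemma normal_var_ge0 : 0 <= normal_var.
Proof.
apply: fine_ge0; apply: integral_ge0 => x _.
by rewrite lee_fin mulr_ge0 ?sqr_ge0 ?normal_pdf_ge0.
Qed.

Lemma brownian_increment_mean s k (Y : Omega -> R) :
  0 <= s -> s <= k -> k <= T -> measurable_wrt (F s) Y ->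
  P.-integrable setT (fun w => (Y w)%:E) ->
  P.-integrable setT (fun w => (Y w * (B k w - B s w))%:E) /\
  \int[P]_w (Y w * (B k w - B s w)) = 0.
Proof.
(* [brownian_motion] describes increments for [s < k] only; for [s = k] the increment is 0. *)
move=> s0; rewrite le_eqVlt => /predU1P[<- _ _ _|sk kT mY iY].
  split; first by under eq_fun do rewrite subrr mulr0; exact: integrable0.
  by under eq_Rintegral do rewrite subrr mulr0; rewrite Rintegral_cst// mul0r.
have sT : 0 <= s <= T by rewrite s0 (le_trans (ltW sk)).
have kT' : 0 <= k <= T by rewrite kT (le_trans s0 (ltW sk)).
have q0 : 0 < Num.sqrt (k - s) by rewrite sqrtr_gt0 subr_gt0.
have mZ : measurable_fun setT (fun w => B k w - B s w).
  by apply: measurable_funB; exact: brownian_measurable.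
have [sF _] := Ff.1 _ sT.
have [|||||h1 h2] := @integral_indep _ _ _ P _ (g_sigma_algebraType (F s)) _ _ id _
  (normal_prob 0 (Num.sqrt (k - s))) (measurable_wrt_id Ff sT) mZ _ Y idfun.
- move=> A C mA mC; have : <<s F s >> A := mA.
  by rewrite sigma_algebra_id// => FA; exact: brownian_increment_law.
- exact: mY.
- exact: measurable_id.
- exact: iY.
- exact: integrable_normal_prob_id.
split; first exact: h1.
by rewrite /Rintegral h2 integral_normal_prob_id// mule0.
Qed.

Lemma brownian_increment_sqr s k (Y : Omega -> R) :
  0 <= s -> s <= k -> k <= T -> measurable_wrt (F s) Y ->
  P.-integrable setT (fun w => (Y w)%:E) ->
  P.-integrable setT (fun w => (Y w * (B k w - B s w) ^+ 2)%:E) /\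
  \int[P]_w (Y w * (B k w - B s w) ^+ 2)
    = normal_var * (k - s) * \int[P]_w Y w.
Proof.
move=> s0; rewrite le_eqVlt => /predU1P[<- _ _ _|sk kT mY iY].
  split.
    by under eq_fun do rewrite subrr expr0n/= mulr0; exact: integrable0.
  under eq_Rintegral do rewrite subrr expr0n/= mulr0.
  by rewrite Rintegral_cst// subrr mulr0 !mul0r.
have sT : 0 <= s <= T by rewrite s0 (le_trans (ltW sk)).
have kT' : 0 <= k <= T by rewrite kT (le_trans s0 (ltW sk)).
have q0 : 0 < Num.sqrt (k - s) by rewrite sqrtr_gt0 subr_gt0.
have mZ : measurable_fun setT (fun w => B k w - B s w).
  by apply: measurable_funB; exact: brownian_measurable.
have [sF _] := Ff.1 _ sT.
have [|||||h1 h2] := @integral_indep _ _ _ P _ (g_sigma_algebraType (F s)) _ _ id _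
  (normal_prob 0 (Num.sqrt (k - s))) (measurable_wrt_id Ff sT) mZ _ Y (fun x => x ^+ 2).
- move=> A C mA mC; have : <<s F s >> A := mA.
  by rewrite sigma_algebra_id// => FA; exact: brownian_increment_law.
- exact: mY.
- exact: measurable_funX.
- exact: iY.
- exact: integrable_normal_prob_sqr.
split; first exact: h1.
rewrite /Rintegral h2 integral_normal_prob_sqr// sqr_sqrtr ?subr_ge0 ?ltW//.
have vE : (\int[lebesgue_measure]_x ((x ^+ 2 * normal_pdf 0 1 x)%R%:E))%E = normal_var%:E.
  rewrite /normal_var fineK// ge0_fin_numE; last first.
    by apply: integral_ge0 => x _; rewrite lee_fin mulr_ge0 ?sqr_ge0 ?normal_pdf_ge0.
  exact: integral_normal_prob_sqr_lty.
rewrite vE fineM//; first by rewrite mulrC [normal_var * _]mulrC.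
exact: integrable_fin_num.
Qed.

End brownian_increments.

(** * Elementary integrals and their isometry *)

(** For [u <= v] this is the projection of [x] onto [[u, v]]. Restricting a step process to a time
    window amounts to clamping the ends of its intervals. *)
Definition clamp (R : realType) (u v x : R) : R := Num.max u (Num.min v x).

Section clamp.
Context {R : realType}.
Implicit Types u v x : R.

Lemma clamp_ge u v x : u <= clamp u v x.
Proof. by rewrite /clamp le_max lexx. Qed.

Lemma clamp_le u v x : u <= v -> clamp u v x <= v.
Proof. by move=> uv; rewrite /clamp ge_max uv ge_min lexx. Qed.

Lemma clamp_homo u v x y : x <= y -> clamp u v x <= clamp u v y.
Proof.
move=> xy; rewrite /clamp ge_max !le_max lexx/=; apply/orP; right.
by rewrite le_min !ge_min lexx/= xy orbT.
Qed.

(** A clamped interval that is still nonempty does not start before the original one. A coefficient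
    known at the original left end is therefore known at the clamped one. *)
Lemma clamp_ltl u v x y : u <= v -> clamp u v x < clamp u v y -> x < y /\ x <= clamp u v x.
Proof.
move=> uv h; split.
  by rewrite ltNge; apply/negP => /(clamp_homo u v); rewrite leNgt h.
have [vx|xv] := leP v x; last by rewrite /clamp (min_r (ltW xv)) le_max lexx orbT.
by move: h; rewrite {1}/clamp (min_l vx) (max_r uv) ltNge clamp_le.
Qed.

Lemma clamp_sub (V : zmodType) (f : R -> V) u v x : u <= v ->
  f (Num.min v x) - f (Num.min u x) = f (clamp u v x) - f u.
Proof.
rewrite /clamp => uv; have [ux|xu] := leP u x.
  have -> : Num.max u (Num.min v x) = Num.min v x.
    by rewrite max_r// le_min uv.
  by [].
have -> : Num.min v x = x by rewrite min_r//; lra.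
by rewrite max_l ?subrr//; lra.
Qed.

Lemma clamp_min u v k x : Num.min k (clamp u v x) = clamp (Num.min k u) (Num.min k v) x.
Proof. by rewrite /clamp min_maxr minA. Qed.

Lemma indic_clamp u v a b s :
  \1_(`]clamp u v a, clamp u v b]%classic : set R) s
  = \1_(`]u, v]%classic : set R) s * \1_(`]a, b]%classic : set R) s :> R.
Proof.
rewrite !indicE -natrM mulnb; congr (_ %:R); congr nat_of_bool.
rewrite !mem_setE !in_itv/= /clamp gt_max gt_min le_max le_min !leNgt.
by case: (u < s); case: (v < s); case: (a < s); case: (b < s).
Qed.

End clamp.

Section elementary.
Context d (Omega : measurableType d) (R : realType) (P : probability Omega R).
Variables (T : R) (F : R -> set (set Omega)) (n : nat).
Variables (W : R -> Omega -> 'cV[R]_n) (j : 'I_n).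
Hypotheses (Ff : filtration T F) (bm : brownian_motion P T F W).
Variable t : R.
Hypothesis t0 : 0 <= t.
Local Notation B k w := (W k w j 0).
Implicit Types (c : Omega -> R) (I v : R -> Omega -> R).

Definition base_integral a b c (k : R) (w : Omega) : R :=
  c w * (B (Num.min k b) w - B (Num.min k a) w).

Definition base_value (a b : R) c (s : R) (w : Omega) : R :=
  c w * \1_(`]a, b]%classic : set R) s.

(** Adaptedness is demanded only when the interval is nonempty: clamping may move an interval to an
    empty one located before the time at which [c] becomes known. *)
Definition elementary_coef (a b : R) c :=
  [/\ t <= a, a <= b, b <= T,
      exists2 C, measurable_fun setT c & forall w, `|c w| <= C
    & a < b -> measurable_wrt (F a) c].

(* [elementary I v]: [I] is the Wiener integral of a finite sum [v] of terms
   [c 1_(]a, b])]. *)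
Inductive elementary : (R -> Omega -> R) -> (R -> Omega -> R) -> Prop :=
| elementary0 : elementary (fun _ _ => 0) (fun _ _ => 0)
| elementary_cons a b c I v : elementary_coef a b c -> elementary I v ->
    elementary (fun k w => base_integral a b c k w + I k w)
               (fun s w => base_value a b c s w + v s w).

Lemma elementary_base a b c : elementary_coef a b c ->
  elementary (base_integral a b c) (base_value a b c).
Proof.
move=> h; have := elementary_cons h elementary0.
by congr elementary; apply/funext => k; apply/funext => w; rewrite addr0.
Qed.

(** The intervals of the terms may overlap, so a sum is a mere concatenation and no common
    refinement of partitions is formed. *)
Lemma elementaryD I v I' v' : elementary I v -> elementary I' v' ->
  elementary (fun k w => I k w + I' k w) (fun s w => v s w + v' s w).
Proof.
move=> e e'; elim: e => [|a b c {}I {}v h _ IH].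
  by move: e'; congr elementary; apply/funext => k; apply/funext => w; rewrite add0r.
have := elementary_cons h IH.
by congr elementary; apply/funext => k; apply/funext => w; rewrite addrA.
Qed.

Lemma elementary_sum (m : nat) (I v : nat -> R -> Omega -> R) :
  (forall l, (l < m)%N -> elementary (I l) (v l)) ->
  elementary (fun k w => \sum_(l < m) I l k w) (fun s w => \sum_(l < m) v l s w).
Proof.
elim: m => [_|m IH h].
  by have := elementary0; congr elementary; apply/funext => k; apply/funext => w;
     rewrite big_ord0.
have e1 : forall l, (l < m)%N -> elementary (I l) (v l).
  by move=> l lm; apply: h; exact: leqW.
have := elementaryD (IH e1) (h m (ltnSn m)).
by congr elementary; apply/funext => k; apply/funext => w; rewrite big_ord_recr.
Qed.

Lemma elementary_bounded I v : elementary I v ->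
  exists C, forall s w, `|v s w| <= C.
Proof.
elim=> [|a b c {}I {}v [_ _ _ [C _ hC] _] _ [C' hC']]; first by exists 0 => s w; rewrite normr0.
exists (C + C') => s w; apply: le_trans (ler_normD _ _) _; apply: lerD => //.
rewrite /base_value normrM; apply: le_trans (hC w); rewrite ler_piMr//.
by rewrite indicE; case: (_ \in _); rewrite ?normr1 ?normr0.
Qed.

Lemma elementary_measurable I v : elementary I v ->
  measurable_fun setT (fun z : R * Omega => v z.1 z.2).
Proof.
elim=> [|a b c {}I {}v [_ _ _ [C mc _] _] _ IH]; first exact: measurable_cst.
apply: measurable_funD => //; apply: measurable_funM.
  exact: measurableT_comp mc measurable_snd.
exact: measurableT_comp (measurable_indic _) measurable_fst.
Qed.

Lemma base_measurable_wrt a b c k : elementary_coef a b c -> t <= k <= T ->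
  measurable_wrt (F k) (base_integral a b c k).
Proof.
move=> [ta ab bT [C mc cC] mca] /andP[tk kT].
have k0 : 0 <= k by exact: le_trans tk.
have zero : (forall w, base_integral a b c k w = 0) ->
    measurable_wrt (F k) (base_integral a b c k).
  move=> h; have -> : base_integral a b c k = fun=> 0 by apply/funext => w; exact: h.
  exact: measurable_cst.
move: ab mca; rewrite le_eqVlt => /predU1P[ab _|ab /(_ ab) mca].
  by apply: zero => w; rewrite /base_integral ab subrr mulr0.
have [ka|ak] := leP k a.
  apply: zero => w; rewrite /base_integral !min_l ?subrr ?mulr0//.
  by rewrite (le_trans ka)// ltW.
have a0 : 0 <= a by exact: le_trans ta.
have mB x : 0 <= x -> measurable_wrt (F k) (fun w => B (Num.min k x) w).
  move=> x0; apply: (measurable_wrtW Ff (s := Num.min k x)) => //.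
  - by rewrite le_min k0.
  - by rewrite ge_min lexx.
  - by apply: (brownian_measurable_wrt _ bm); rewrite le_min k0 x0 ge_min kT.
apply: measurable_funM.
  by apply: (measurable_wrtW Ff (s := a)) => //; exact: ltW.
by apply: measurable_funB; apply: mB => //; rewrite (le_trans a0)// ltW.
Qed.

Lemma elementary_measurable_wrt I v k : elementary I v -> t <= k <= T ->
  measurable_wrt (F k) (I k).
Proof.
move=> e kT; elim: e => [|a b c {}I {}v h _ IH]; first exact: measurable_cst.
by apply: measurable_funD => //; exact: base_measurable_wrt.
Qed.

Lemma brownian_increment_sqint s k : 0 <= s -> s <= k -> k <= T ->
  sqint P (fun w => B k w - B s w).
Proof.
move=> s0 sk kT.
have sT : 0 <= s <= T by rewrite s0 (le_trans sk).
have kT' : 0 <= k <= T by rewrite kT (le_trans s0).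
split.
  by apply: measurable_funB; exact: (brownian_measurable _ Ff bm).
have [] := @brownian_increment_sqr _ _ _ P T F n W j Ff bm s k (fun=> 1) s0 sk kT.
- exact: measurable_cst.
- exact: (finite_measure_integrable_cst P 1).
by under eq_fun do rewrite mul1r.
Qed.

Lemma base_sqint a b c k : elementary_coef a b c -> t <= k <= T ->
  sqint P (base_integral a b c k).
Proof.
move=> [ta ab bT [C mc cC] mca] /andP[tk kT].
apply: sqintZ mc cC _; apply: brownian_increment_sqint.
- by rewrite le_min (le_trans t0)//= (le_trans t0).
- by rewrite le_min ge_min lexx/= ge_min ab orbT.
- by rewrite ge_min kT.
Qed.

Lemma elementary_sqint I v k : elementary I v -> t <= k <= T -> sqint P (I k).
Proof.
move=> e kT; elim: e => [|a b c {}I {}v h _ IH]; first exact: sqint_cst.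
by apply: sqintD => //; exact: base_sqint.
Qed.

Lemma base_integral_incr a b c k l w : k <= l ->
  base_integral a b c l w - base_integral a b c k w =
  base_integral (clamp k l a) (clamp k l b) c l w.
Proof.
move=> kl; rewrite /base_integral -mulrBr; congr (_ * _).
have h x := clamp_sub (fun s => B s w) x kl.
rewrite !(min_r (clamp_le _ kl)).
have := h a; have := h b; move=> h1 h2; lra.
Qed.

(** The martingale property, tested against square integrable variables known at time [k] instead of
    being stated by conditional expectations. Over [[k, l]] each term is [c] times a Brownian
    increment on the clamped interval, and [Y * c] is known at the left end of that interval. *)
Lemma elementary_orthogonal I v Y k l : elementary I v ->
  t <= k -> k <= l -> l <= T -> measurable_wrt (F k) Y -> sqint P Y ->
  \int[P]_w (Y w * (I l w - I k w)) = 0.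
Proof.
move=> e tk kl lT mY Y2.
have kT : t <= k <= T by rewrite tk (le_trans kl).
have lT' : t <= l <= T by rewrite lT (le_trans tk).
elim: e => [|a b c {}I {}v h eI IH].
  by under eq_Rintegral do rewrite subrr mulr0; rewrite Rintegral_cst// mul0r.
have E w : Y w * (base_integral a b c l w + I l w - (base_integral a b c k w + I k w))
  = (Y w * c w) * (B (clamp k l b) w - B (clamp k l a) w) + Y w * (I l w - I k w).
  have := @base_integral_incr a b c k l w kl.
  rewrite {3}/base_integral !(min_r (clamp_le _ kl)) -mulrA => <-; ring.
under eq_Rintegral do rewrite E.
have [ta ab bT [C mc cC] mca] := h.
have k0 : 0 <= k by exact: le_trans tk.
(* An empty clamped interval contributes nothing; the case is split off because [c] need not be
   known at its left end. *)
have [ab'|ab'] := eqVneq (clamp k l a) (clamp k l b).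
  by under eq_Rintegral do rewrite ab' subrr mulr0 add0r.
have {}ab' : clamp k l a < clamp k l b.
  by rewrite lt_neqAle ab' clamp_homo.
have [alb aa] := clamp_ltl kl ab'.
have ca0 : 0 <= clamp k l a by rewrite (le_trans k0)// clamp_ge.
have [] := @brownian_increment_mean _ _ _ P T F n W j Ff bm (clamp k l a) (clamp k l b)
   (fun w => Y w * c w) ca0 (ltW ab') _ _ _.
- by rewrite (le_trans (clamp_le _ _)).
- have caT : clamp k l a <= T by rewrite (le_trans (clamp_le _ _)).
  apply: measurable_funM.
    by apply: (measurable_wrtW Ff (s := k)) => //; exact: clamp_ge.
  by apply: (measurable_wrtW Ff (s := a)); rewrite ?(le_trans t0)//; exact: mca.
- by apply: sqint_mul => //; apply: (sqint_bounded _ mc cC).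
move=> h1 h2; rewrite RintegralD//; first by rewrite h2 IH addr0.
by apply: sqint_mul => //; apply: sqintB; exact: (elementary_sqint eI).
Qed.

End elementary.

(** * Ito isometry and localisation of elementary integrals *)

Section isometry.
Context d (Omega : measurableType d) (R : realType) (P : probability Omega R).
Variables (T : R) (F : R -> set (set Omega)) (n : nat).
Variables (W : R -> Omega -> 'cV[R]_n) (j : 'I_n).
Hypotheses (Ff : filtration T F) (bm : brownian_motion P T F W).
Variable t : R.
Hypothesis t0 : 0 <= t.
Local Notation B k w := (W k w j 0).
Local Notation elementary := (elementary T F W j t).
Local Notation elementary_coef := (elementary_coef T F t).
Local Notation base_integral := (base_integral W j).
Local Notation mu := (@lebesgue_measure R).
Local Notation kappa := (normal_var R).
Implicit Types (c : Omega -> R) (I v : R -> Omega -> R).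

Lemma elementary_mul_integrable I v I' v' w : elementary I v -> elementary I' v' ->
  mu.-integrable `[t, T] (fun s => (v s w * v' s w)%:E).
Proof.
move=> e e'; have [C hC] := elementary_bounded e; have [C' hC'] := elementary_bounded e'.
apply: measurable_bounded_integrable => //.
- by apply: compact_finite_measure; exact: segment_compact.
- apply: measurable_funTS; apply: measurable_funM.
    exact: (measurableT_comp (elementary_measurable e) (pair2_measurable w)).
  exact: (measurableT_comp (elementary_measurable e') (pair2_measurable w)).
- exists (C * C'); split; first exact: num_real.
  move=> x Cx s _ /=; apply: (le_trans _ (ltW Cx)).
  by rewrite normrM ler_pM.
Qed.

Lemma base_mul_sqint a b c a' b' c' : elementary_coef a b c -> elementary_coef a' b' c' ->
  sqint P (fun w => c w * c' w).
Proof.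
move=> [_ _ _ [C mc cC] _] [_ _ _ [C' mc' cC'] _].
by apply: (sqintZ mc cC); exact: sqint_bounded mc' cC'.
Qed.

Let overlap a b a' b' : R :=
  \int[mu]_(s in `[t, T]) (\1_(`]a, b]%classic : set R) s * \1_(`]a', b']%classic : set R) s).

Let overlapE a b a' b' : t <= a -> a <= a' -> b <= T -> b' <= T ->
  overlap a b a' b' = Num.max 0 (Num.min b b' - a').
Proof.
move=> ta aa' bT b'T; rewrite /overlap /Rintegral.
have -> : (\int[mu]_(s in `[t, T])
    (\1_(`]a, b]%classic : set R) s * \1_(`]a', b']%classic : set R) s)%:E)%E =
    (\int[mu]_(s in `[t, T]) (\1_(`]a', Num.min b b']%classic : set R) s)%:E)%E.
  apply: eq_integral => s _; congr EFin; rewrite !indicE -natrM mulnb.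
  congr (_ %:R); congr nat_of_bool; rewrite !mem_setE !in_itv/= le_min.
  apply/andP/and3P => [[/andP[_ h1] /andP[h2 h3]]|[h1 h2 h3]]; first by split.
  by split; [rewrite h2 (le_lt_trans aa')|rewrite h1 h3].
rewrite integral_indic//.
have -> : `]a', Num.min b b'] `&` `[t, T] = `]a', Num.min b b']%classic :> set R.
  apply/seteqP; split => s /=; first by move=> [].
  rewrite !in_itv/= le_min => /and3P[h1 h2 h3]; split; first by rewrite h1 h2.
  by rewrite (le_trans h2 bT) andbT (le_trans (le_trans ta aa'))// ltW.
transitivity (fine (lebesgue_measure [set` `]a', Num.min b b']])); first by [].
rewrite lebesgue_measure_itv/= lte_fin.
have [h|h] := ltP a' (Num.min b b'); last by rewrite max_l// subr_le0.
by rewrite -EFinB/= max_r// subr_ge0 ltW.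
Qed.

Lemma base_isometry a b c a' b' c' : elementary_coef a b c -> elementary_coef a' b' c' ->
  \int[P]_w (base_integral a b c T w * base_integral a' b' c' T w)
  = kappa * overlap a b a' b' * \int[P]_w (c w * c' w).
Proof.
wlog aa' : a b c a' b' c' / a <= a'.
  move=> h h1 h2; have [aa'|aa'] := leP a a'; first exact: h.
  under eq_Rintegral do rewrite mulrC; rewrite h ?(ltW aa')//.
  congr (_ * _ * _); last by apply: eq_Rintegral => w _; rewrite mulrC.
  by rewrite /overlap; apply: eq_Rintegral => w _; rewrite mulrC.
move=> h h'; have [ta ab bT [C mc cC] mca] := h.
have [ta' ab' b'T [C' mc' cC'] mca'] := h'.
rewrite overlapE//.
have tT : t <= T by rewrite (le_trans ta)// (le_trans ab).
have a0 : 0 <= a by exact: le_trans ta.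
have a'0 : 0 <= a' by exact: le_trans ta'.
rewrite /base_integral !(min_r bT) !(min_r b'T) (min_r (le_trans ab bT)).
rewrite (min_r (le_trans ab' b'T)).
move: ab; rewrite le_eqVlt => /predU1P[ab|ab].
  under eq_Rintegral do rewrite ab subrr mulr0 mul0r.
  rewrite Rintegral_cst// mul0r max_l ?mulr0 ?mul0r//.
  by rewrite subr_le0 ge_min -ab aa'.
move: ab'; rewrite le_eqVlt => /predU1P[ab'|ab'].
  under eq_Rintegral do rewrite ab' subrr mulr0 mulr0.
  rewrite Rintegral_cst// mul0r max_l ?mulr0 ?mul0r//.
  by rewrite subr_le0 ge_min ab' lexx orbT.
have {}mca := mca ab; have {}mca' := mca' ab'.
have a'T : a' <= T by rewrite (le_trans _ b'T)// ltW.
have mcc' : measurable_wrt (F a') (fun w => c w * c' w).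
  by apply: measurable_funM => //; exact: (measurable_wrtW Ff (s := a)).
have mean s k Y := @brownian_increment_mean _ _ _ P T F n W j Ff bm s k Y.
have inc s k := @brownian_increment_sqint _ _ _ P T F n W j Ff bm s k.
have bcc' f : sqint P f -> sqint P (fun w => c w * c' w * f w).
  move=> sf; have : sqint P (fun w => c w * (c' w * f w)).
    by apply: (sqintZ mc cC); exact: (sqintZ mc' cC').
  by congr sqint; apply/funext => w; rewrite mulrA.
(* If the first interval ends before the second begins, the whole product except the last increment
   is known at [a'], and the mean vanishes, as does the overlap. *)
have [ba'|a'b] := leP b a'.
  rewrite max_l; last by rewrite subr_le0 ge_min ba'.
  have [||_] := mean a' b' (fun w => c w * c' w * (B b w - B a w)) a'0 (ltW ab') b'T.
  - apply: measurable_funM => //.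
    apply: measurable_funB.
      apply: (measurable_wrtW Ff (s := b)) => //; first by rewrite (le_trans a0)// ltW.
      by apply: (brownian_measurable_wrt _ bm); rewrite bT (le_trans a0)// ltW.
    apply: (measurable_wrtW Ff (s := a)) => //.
    by apply: (brownian_measurable_wrt _ bm); rewrite a0 (le_trans _ bT)// ltW.
  - by apply: sqint_integrable; apply: bcc'; apply: inc => //; exact: ltW.
  move=> h0; rewrite mulr0 mul0r -[RHS]h0; apply: eq_Rintegral => w _; ring.
set e := Num.min b b'; set g := Num.max b b'.
have a'e : a' <= e by rewrite le_min !ltW.
have eg : e <= g by rewrite ge_min le_max lexx.
have eT : e <= T by rewrite ge_min bT.
have gT : g <= T by rewrite ge_max bT.
have e0 : 0 <= e by exact: le_trans a'e.
rewrite max_r ?subr_ge0//.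
have [||i1 z1] := mean a' b' (fun w => c w * c' w * (B a' w - B a w)) a'0 (ltW ab') b'T.
- apply: measurable_funM => //.
  apply: measurable_funB; first by apply: (brownian_measurable_wrt _ bm); rewrite a'0.
  apply: (measurable_wrtW Ff (s := a)) => //.
  by apply: (brownian_measurable_wrt _ bm); rewrite a0 (le_trans _ bT)// ltW.
- by apply: sqint_integrable; apply: bcc'; exact: inc.
have [||i2 z2] := mean e g (fun w => c w * c' w * (B e w - B a' w)) e0 eg gT.
- apply: measurable_funM; first exact: (measurable_wrtW Ff (s := a')).
  apply: measurable_funB; first by apply: (brownian_measurable_wrt _ bm); rewrite e0.
  apply: (measurable_wrtW Ff (s := a')) => //.
  by apply: (brownian_measurable_wrt _ bm); rewrite a'0.
- by apply: sqint_integrable; apply: bcc'; exact: inc.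
have [|i3 z3] := @brownian_increment_sqr _ _ _ P T F n W j Ff bm a' e
  (fun w => c w * c' w) a'0 a'e eT mcc'.
- by apply: sqint_integrable; exact: base_mul_sqint h h'.
(* The two intervals are cut at [a'] and at [e]. In the first two products the last increment is
   multiplied by something known at its start, so they have mean zero; the square over the common
   part, from [a'] to [e], gives the overlap. *)
have E w : c w * (B b w - B a w) * (c' w * (B b' w - B a' w)) =
    c w * c' w * (B a' w - B a w) * (B b' w - B a' w)
    + (c w * c' w * (B e w - B a' w) * (B g w - B e w)
       + c w * c' w * (B e w - B a' w) ^+ 2).
  by rewrite /e /g; case: (leP b b') => _; ring.
under eq_Rintegral do rewrite E.
rewrite RintegralD//; last exact: (integrableD measurableT i2 i3).
rewrite RintegralD// z1 z2 z3 !add0r//.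
Qed.

Lemma base_mulE a b c a' b' c' w :
  \int[mu]_(s in `[t, T]) (base_value a b c s w * base_value a' b' c' s w)
  = overlap a b a' b' * (c w * c' w).
Proof.
rewrite /overlap -RintegralZr//; last first.
  apply: measurable_bounded_integrable => //.
  - by apply: compact_finite_measure; exact: segment_compact.
  - by apply: measurable_funTS; apply: measurable_funM; exact: measurable_indic.
  - exists 1; split; first exact: num_real.
    move=> x x1 s _ /=; apply: le_trans (ltW x1).
    by rewrite !indicE -natrM mulnb; case: (_ && _); rewrite ?normr1 ?normr0.
by apply: eq_Rintegral => s _; rewrite /base_value; ring.
Qed.

Let isometry_spec I v I' v' :=
  P.-integrable setT (fun w => (\int[mu]_(s in `[t, T]) (v s w * v' s w))%:E) /\
  \int[P]_w (I T w * I' T w) =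
    kappa * \int[P]_w \int[mu]_(s in `[t, T]) (v s w * v' s w).

(** Stated for a pair of integrals because the bilinear form is additive in each argument: two
    nested inductions reduce it to [base_isometry], whereas the identity for a single square is not
    inductive. *)
Lemma elementary_isometry I v I' v' : t <= T -> elementary I v -> elementary I' v' ->
  isometry_spec I v I' v'.
Proof.
move=> tT e e'.
have TT : t <= T <= T by rewrite tT lexx.
elim: e => [|a b c {}I {}v h eI IH].
  rewrite /isometry_spec; split.
    under eq_fun do (under eq_Rintegral do rewrite mul0r);
    under eq_fun do rewrite Rintegral_cst// mul0r; exact: integrable0.
  under eq_Rintegral do rewrite mul0r; rewrite Rintegral_cst// mul0r.
  under eq_Rintegral do (under eq_Rintegral do rewrite mul0r).
  under eq_Rintegral do rewrite Rintegral_cst// mul0r.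
  by rewrite Rintegral_cst// mul0r mulr0.
have [IH1 IH2] := IH.
have sI := elementary_sqint Ff bm t0 eI TT.
have sI' := elementary_sqint Ff bm t0 e' TT.
have sb := base_sqint j Ff bm t0 h TT.
have eb := elementary_base W j h.
have [] : isometry_spec (base_integral a b c) (base_value a b c) I' v'.
  elim: e' {IH IH1 IH2 sI'} => [|a' b' c' {}I' {}v' h' eI' [IH1 IH2]].
    rewrite /isometry_spec; split.
      under eq_fun do (under eq_Rintegral do rewrite mulr0);
      under eq_fun do rewrite Rintegral_cst// mul0r; exact: integrable0.
    under eq_Rintegral do rewrite mulr0; rewrite Rintegral_cst// mul0r.
    under eq_Rintegral do (under eq_Rintegral do rewrite mulr0).
    under eq_Rintegral do rewrite Rintegral_cst// mul0r.
    by rewrite Rintegral_cst// mul0r mulr0.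
  have sI' := elementary_sqint Ff bm t0 eI' TT.
  have sb' := base_sqint j Ff bm t0 h' TT.
  have eb' := elementary_base W j h'.
  have E w : \int[mu]_(s in `[t, T])
      (base_value a b c s w * (base_value a' b' c' s w + v' s w))
      = \int[mu]_(s in `[t, T]) (base_value a b c s w * base_value a' b' c' s w)
      + \int[mu]_(s in `[t, T]) (base_value a b c s w * v' s w).
    under eq_Rintegral do rewrite mulrDr.
    by rewrite RintegralD//; [exact: elementary_mul_integrable eb eb'|
      exact: elementary_mul_integrable eb eI'].
  have ib : P.-integrable setT (fun w => (\int[mu]_(s in `[t, T])
      (base_value a b c s w * base_value a' b' c' s w))%:E).
    under eq_fun do rewrite base_mulE EFinM.
    apply: integrableZl => //; apply: sqint_integrable; exact: base_mul_sqint h h'.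
  split.
    by under eq_fun do rewrite E; exact: (integrableD measurableT ib IH1).
  under [in RHS]eq_Rintegral do rewrite E.
  rewrite [in RHS]RintegralD// mulrDr -IH2.
  under [in LHS]eq_Rintegral do rewrite mulrDr.
  rewrite [in LHS]RintegralD//; [|exact: sqint_mul|exact: sqint_mul].
  congr (_ + _); rewrite base_isometry//.
  under [in RHS]eq_Rintegral do rewrite base_mulE.
  rewrite RintegralZl ?mulrA//; apply: sqint_integrable; exact: base_mul_sqint h h'.
move=> b1 b2.
have E w : \int[mu]_(s in `[t, T]) ((base_value a b c s w + v s w) * v' s w)
      = \int[mu]_(s in `[t, T]) (base_value a b c s w * v' s w)
      + \int[mu]_(s in `[t, T]) (v s w * v' s w).
  under eq_Rintegral do rewrite mulrDl.
  by rewrite RintegralD//; [exact: elementary_mul_integrable eb e'|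
    exact: elementary_mul_integrable eI e'].
split; first by under eq_fun do rewrite E; exact: (integrableD measurableT b1 IH1).
under [in RHS]eq_Rintegral do rewrite E.
rewrite [in RHS]RintegralD// mulrDr -IH2 -b2.
under [in LHS]eq_Rintegral do rewrite mulrDl.
by rewrite [in LHS]RintegralD//; exact: sqint_mul.
Qed.

Lemma elementary_isometry_ereal I v : t <= T -> elementary I v ->
  (\int[P]_w (I T w ^+ 2)%:E =
   kappa%:E * \int[P]_w \int[mu]_(s in `[t, T]) (v s w ^+ 2)%:E)%E.
Proof.
move=> tT e; have [h1 h2] := elementary_isometry tT e e.
have TT : t <= T <= T by rewrite tT lexx.
have [_ sI] := elementary_sqint Ff bm t0 e TT.
have -> : (\int[P]_w (I T w ^+ 2)%:E = (\int[P]_w (I T w * I T w))%:E)%E.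
  by rewrite /Rintegral fineK//; exact: integrable_fin_num.
rewrite h2 EFinM; congr (_ * _)%E.
have -> : (\int[P]_w \int[mu]_(s in `[t, T]) (v s w ^+ 2)%:E =
    \int[P]_w (\int[mu]_(s in `[t, T]) (v s w * v s w))%:E)%E.
  apply: eq_integral => w _; rewrite /Rintegral fineK//.
  exact/integrable_fin_num/(elementary_mul_integrable w e e).
by rewrite /Rintegral fineK//; exact: integrable_fin_num.
Qed.

(** Every term has its interval clamped to []u, u']] and its coefficient multiplied by [g]. If the
    clamped interval is nonempty, its left end lies after both [u] and the original left end, so the
    new coefficient is known there. This makes the transform of an elementary integral
    elementary. *)
Lemma elementary_cut g u u' I v : t <= u -> u <= u' -> u' <= T ->
  measurable_wrt (F u) g -> (exists C, forall w, `|g w| <= C) ->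
  elementary I v ->
  elementary (fun k w => g w * (I (Num.min k u') w - I (Num.min k u) w))
    (fun s w => g w * \1_(`]u, u']%classic : set R) s * v s w).
Proof.
move=> tu uu' u'T mg [C gC]; have u0 : 0 <= u by exact: le_trans tu.
have uT : 0 <= u <= T by rewrite u0 (le_trans uu').
have mg' := measurable_wrt_fun Ff uT mg.
elim=> [|a b c {}I {}v h eI IH].
  have := elementary0 T F W j t; congr elementary; apply/funext => k; apply/funext => w.
    by rewrite subrr mulr0.
  by rewrite mulr0.
have [ta ab bT [C' mc cC'] mca] := h.
have coef : elementary_coef (clamp u u' a) (clamp u u' b) (fun w => g w * c w).
  split.
  - by rewrite (le_trans tu)// clamp_ge.
  - exact: clamp_homo.
  - by rewrite (le_trans (clamp_le _ _)).
  - exists (C * C'); first exact: measurable_funM.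
    by move=> w; rewrite normrM ler_pM.
  - move=> /(clamp_ltl uu')[alb aa].
    have caT : clamp u u' a <= T by rewrite (le_trans (clamp_le _ _)).
    apply: measurable_funM.
      by apply: (measurable_wrtW Ff (s := u)) => //; exact: clamp_ge.
    by apply: (measurable_wrtW Ff (s := a)); rewrite ?(le_trans t0)//; exact: mca.
have := elementary_cons coef IH.
congr elementary; apply/funext => k; apply/funext => w; last first.
  rewrite mulrDr; congr (_ + _); rewrite /base_value indic_clamp; ring.
have kuu : Num.min k u <= Num.min k u' by rewrite le_min !ge_min lexx/= uu' orbT.
rewrite [in RHS]opprD [in RHS]addrACA [in RHS]mulrDr; congr (_ + _); rewrite base_integral_incr//.
by rewrite /base_integral !(min_r (clamp_le _ kuu)) !clamp_min mulrA.
Qed.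

End isometry.

Fixpoint runmax (R : realType) (x : nat -> R) (m : nat) : R :=
  if m is k.+1 then Num.max (runmax x k) (x k.+1) else x 0%N.

(** * Doob's inequality *)

Section runmax.
Context {R : realType}.
Implicit Types (x : nat -> R).

Lemma le_runmax x i m : (i <= m)%N -> x i <= runmax x m.
Proof.
elim: m => [|m IH]; first by rewrite leqn0 => /eqP ->.
rewrite leq_eqVlt ltnS => /predU1P[->|/IH h] /=; first by rewrite le_max lexx orbT.
by rewrite le_max h.
Qed.

Lemma runmax_le x m r : (forall i, (i <= m)%N -> x i <= r) -> runmax x m <= r.
Proof.
elim: m => [h|m IH h] /=; first exact: h.
by rewrite ge_max h// IH// => i im; apply: h; exact: leqW.
Qed.

(* The pathwise form of Doob's L2 inequality: the sum is a martingale transform. *)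
Lemma doob_pathwise x m : x 0%N = 0 ->
  runmax x m ^+ 2 <= 4 * x m ^+ 2 - 4 * \sum_(i < m) runmax x i * (x i.+1 - x i).
Proof.
move=> x0; set S := fun m => \sum_(i < m) runmax x i * (x i.+1 - x i).
(* Abel summation in the form of an inequality. It implies the claim because [4 x^2 - 4 z x + 2 z^2
   = (2 x - z)^2 + z^2], with [z] the running maximum. In the induction only a new maximum needs an
   argument, and there the gap is half of a square. *)
suff h : 2^-1 * runmax x m ^+ 2 + S m <= runmax x m * x m.
  have : 0 <= (2^-1 * runmax x m - x m) ^+ 2 by exact: sqr_ge0.
  by rewrite -/(S m); move: (runmax x m) (x m) (S m) h => r y s; nra.
elim: m => [|m IH]; first by rewrite /S big_ord0 /= x0; lra.
rewrite /S big_ord_recr/= -/(S m).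
have [h|h] := leP (runmax x m) (x m.+1); last by lra.
have : 0 <= (x m.+1 - runmax x m) ^+ 2 by exact: sqr_ge0.
move: (runmax x m) (x m) (S m) (x m.+1) IH h => r y s z IH h; nra.
Qed.

Lemma sqr_le_runmax x i m : x 0%N = 0 -> (i <= m)%N ->
  x i ^+ 2 <= runmax x m ^+ 2 + runmax (fun i => - x i) m ^+ 2.
Proof.
move=> x0 im; have [h|h] := leP 0 (x i).
  have := le_runmax x im; have := sqr_ge0 (runmax (fun i => - x i) m).
  by move: (runmax x m) => r r2 xr; nra.
have := le_runmax (fun i => - x i) im; have := sqr_ge0 (runmax x m).
by move: (runmax (fun i => - x i) m) => r r2 xr; nra.
Qed.

End runmax.

(** * Suprema of continuous paths: measurability and expectation *)

Section path_sup.
Context d (Omega : measurableType d) (R : realType) (P : probability Omega R).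
Variables (a b : R) (U : R -> Omega -> R).
Hypothesis ab : a <= b.
Hypothesis cU : forall w, {within `[a, b], continuous (fun k => U k w)}.
Hypothesis mU : forall k, a <= k <= b -> measurable_fun setT (U k).

(** A real-valued [sup]; continuity of the paths on [[a, b]] makes it a maximum, so the default
    value of [sup] never occurs. *)
Definition path_sup (w : Omega) : R := sup [set U k w | k in `[a, b]].

Lemma path_sup_attained w : exists2 c, a <= c <= b &
  path_sup w = U c w /\ forall k, a <= k <= b -> U k w <= U c w.
Proof.
have [c cab h] := EVT_max ab (@cU w).
have {}h k : a <= k <= b -> U k w <= U c w by move=> kab; apply: h; rewrite in_itv.
exists c; first by rewrite in_itv in cab.
split => //; apply/eqP; rewrite eq_le; apply/andP; split.
  apply: sup_le_ub; first by exists (U c w), c.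
  by move=> _ [k /= + <-]; rewrite in_itv/= => /h.
apply: sup_upper_bound; last by exists c.
split; first by exists (U c w), c.
by exists (U c w) => _ [k /= + <-]; rewrite in_itv/= => /h.
Qed.

Lemma le_path_sup w k : a <= k <= b -> U k w <= path_sup w.
Proof. by move=> kab; have [c _ [-> h]] := path_sup_attained w; exact: h. Qed.

Lemma path_sup_le w r : (forall k, a <= k <= b -> U k w <= r) -> path_sup w <= r.
Proof. by move=> h; have [c cab [-> _]] := path_sup_attained w; exact: h. Qed.

Let node K := grid a ((b - a) / K.+1%:R).

Lemma node_itv K i : (i <= K.+1)%N -> a <= node K i <= b.
Proof.
move=> iK; have d0 : 0 <= (b - a) / K.+1%:R by rewrite divr_ge0 ?subr_ge0.
have -> : b = node K K.+1.
  by rewrite /node /grid mulrC divfK// addrC subrK.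
by rewrite -{1}(grid0 a ((b - a) / K.+1%:R)) !le_grid.
Qed.

Let approx K w := runmax (fun i => U (node K i) w) K.+1.

Let approx_cvg w : approx ^~ w @ \oo --> path_sup w.
Proof.
have [c cab [-> h]] := path_sup_attained w; have /andP[ac cb] := cab.
apply/cvgrPdist_lt => e e0.
have /subspace_continuousP/(_ c) := @cU w; rewrite /= in_itv/= cab => /(_ isT).
move=> /cvgrPdist_lt/(_ e e0); rewrite /within/= => /nbhs_ballP[del /= del0 hdel].
near=> K.
have [l lK /andP[lc cl]] : exists2 l, (l < K.+1)%N & node K l <= c <= node K l.+1.
  (* For [a = b] the mesh is 0 and [grid_cell] does not apply, but all nodes coincide with [a]. *)
  have [ab'|ab'] := eqVneq a b.
    have d0 : (b - a) / K.+1%:R = 0 by rewrite ab' subrr mul0r.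
    by exists 0%N => //; rewrite /node d0 /grid !mulr0 !addr0 ac/= ab'.
  apply: grid_cell => //.
    by rewrite divr_gt0// subr_gt0 lt_neqAle ab'.
  by rewrite ac /grid mulrC divfK// addrC subrK.
have lK1 : (l <= K.+1)%N by exact: ltnW.
have hl : `|U c w - U (node K l) w| < e.
  apply: (hdel (node K l)); last by rewrite in_itv/=; exact: node_itv.
  rewrite /ball/= ger0_norm ?subr_ge0//.
  have : c - node K l <= (b - a) / K.+1%:R.
    by rewrite lerBlDl; apply: le_trans cl _; rewrite /node gridS.
  move=> /le_lt_trans; apply.
  rewrite ltr_pdivrMr// mulrC -ltr_pdivrMr//.
  apply: (@lt_trans _ _ K%:R); last by rewrite ltr_nat.
  by near: K; exact: nbhs_infty_gtr.
have h1 : U (node K l) w <= approx K w by exact: (le_runmax (fun i => U (node K i) w) lK1).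
have h2 : approx K w <= U c w by apply: runmax_le => i iK; apply: h; exact: node_itv.
move: hl; rewrite !ger0_norm ?subr_ge0//; last first.
  by apply: h; exact: node_itv.
by apply: le_lt_trans; rewrite lerD2l lerN2.
Unshelve. all: by end_near. Qed.

Let measurable_approx K : measurable_fun setT (approx K).
Proof.
suff h m : (m <= K.+1)%N -> measurable_fun setT (fun w => runmax (fun i => U (node K i) w) m).
  exact: h.
elim: m => [mK|m IH mK] /=; first by apply: mU; exact: node_itv.
by apply: measurable_maxr; [apply: IH; exact: ltnW|apply: mU; exact: node_itv].
Qed.

Lemma measurable_path_sup : measurable_fun setT path_sup.
Proof.
apply: (measurable_fun_cvg measurable_approx) => w _; exact: approx_cvg.
Qed.

(** The maxima over the uniform grids converge to the supremum, but the grids are not nested.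
    Fatou's lemma, rather than monotone convergence, therefore carries a bound that is uniform in
    the grid to the limit. *)
Lemma integral_path_sup_le (K0 : \bar R) : (forall k w, a <= k <= b -> 0 <= U k w) ->
  (forall K, exists G : Omega -> R, [/\ measurable_fun setT G,
     forall i w, (i <= K.+1)%N -> U (grid a ((b - a) / K.+1%:R) i) w <= G w
   & (\int[P]_w (G w)%:E <= K0)%E]) ->
  (\int[P]_w (path_sup w)%:E <= K0)%E.
Proof.
move=> U0 hG.
have a0 K w : 0 <= approx K w.
  have h : a <= node K 0%N <= b by exact: node_itv.
  apply: (le_trans (U0 _ w h)).
  exact: (le_runmax (fun i => U (node K i) w) (leq0n _)).
have -> : (\int[P]_w (path_sup w)%:E)%E
    = (\int[P]_w limn_einf (fun K => (approx K w)%:E))%E.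
  apply: eq_integral => w _.
  have : ((approx K w)%:E @[K --> \oo] --> (path_sup w)%:E)%E.
    by apply: cvg_EFin; [exact: nearW|exact: approx_cvg].
  by move=> /cvg_limn_einf_sup[-> _].
apply: le_trans (fatou _ _ _ _) _ => //.
- by move=> K; apply/measurable_EFinP; exact: measurable_approx.
- by move=> K w _; rewrite lee_fin.
rewrite limn_einf_lim; apply: lime_le.
  exact: is_cvg_einfs.
apply: nearW => K; apply: (@le_trans _ _ (\int[P]_w (approx K w)%:E)%E).
  by apply: ereal_inf_lbound; exists K => //=.
have [G [mG UG /(le_trans _)]] := hG K; apply.
apply: ge0_le_integral => //.
- by move=> w _; rewrite lee_fin.
- by apply/measurable_EFinP; exact: measurable_approx.
- exact/measurable_EFinP.
- by move=> w _; rewrite lee_fin; apply: runmax_le => i iK; exact: UG.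
Qed.

End path_sup.

(** * The L2 maximal inequality in discrete time *)

Section doob.
Context d (Omega : measurableType d) (R : realType) (P : probability Omega R).

Lemma sqint_max (f g : Omega -> R) : sqint P f -> sqint P g ->
  sqint P (fun w => Num.max (f w) (g w)).
Proof.
move=> [mf f2] [mg g2]; split; first exact: measurable_maxr.
have h := integrableD measurableT f2 g2.
apply: le_integrable h => //.
  by apply/measurable_EFinP/measurable_funX; exact: measurable_maxr.
move=> w _ /=; rewrite lee_fin !ger0_norm ?addr_ge0 ?sqr_ge0//.
by case: (leP (f w) (g w)) => _; rewrite ?lerDl ?lerDr sqr_ge0.
Qed.

Variables (G : nat -> set (set Omega)) (X : nat -> Omega -> R) (m : nat).
Hypothesis G_mono : forall i (f : Omega -> R), (i < m)%N ->
  measurable_wrt (G i) f -> measurable_wrt (G i.+1) f.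
Hypothesis X_meas : forall i, (i <= m)%N -> measurable_wrt (G i) (X i).
Hypothesis X_sqint : forall i, (i <= m)%N -> sqint P (X i).
Hypothesis X_0 : forall w, X 0%N w = 0.
Hypothesis X_mart : forall i Y, (i < m)%N -> measurable_wrt (G i) Y -> sqint P Y ->
  \int[P]_w (Y w * (X i.+1 w - X i w)) = 0.

Let Z i w := runmax (X ^~ w) i.

Let Z_meas i : (i <= m)%N -> measurable_wrt (G i) (Z i).
Proof.
elim: i => [|i IH] im; first exact: X_meas.
by apply: measurable_maxr; [apply: G_mono => //; apply: IH; exact: ltnW|exact: X_meas].
Qed.

Lemma runmax_sqint i : (i <= m)%N -> sqint P (Z i).
Proof.
elim: i => [|i IH] im; first exact: X_sqint.
by apply: sqint_max; [apply: IH; exact: ltnW|exact: X_sqint].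
Qed.

(** Expectation of [doob_pathwise]: each summand has mean zero by [X_mart], applied to the running
    maximum [Z i], which is known at step [i] and square integrable. *)
Lemma doob_L2 : \int[P]_w (Z m w ^+ 2) <= 4 * \int[P]_w (X m w ^+ 2).
Proof.
have [_ iZ] := runmax_sqint (leqnn m).
have [_ iX] := X_sqint (leqnn m).
have ii i : (i < m)%N -> P.-integrable setT (fun w => (Z i w * (X i.+1 w - X i w))%:E).
  move=> im; apply: sqint_mul; first by apply: runmax_sqint; exact: ltnW.
  by apply: sqintB; apply: X_sqint => //; exact: ltnW.
have [iS zS] : P.-integrable setT
      (fun w => (\sum_(i < m) Z i w * (X i.+1 w - X i w))%:E) /\
    \int[P]_w (\sum_(i < m) Z i w * (X i.+1 w - X i w)) = 0.
  have h k : (k <= m)%N -> P.-integrable setT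
      (fun w => (\sum_(i < k) Z i w * (X i.+1 w - X i w))%:E) /\
      \int[P]_w (\sum_(i < k) Z i w * (X i.+1 w - X i w)) = 0.
    elim: k => [_|k IH km].
      split; first by under eq_fun do rewrite big_ord0; exact: integrable0.
      by under eq_Rintegral do rewrite big_ord0; rewrite Rintegral_cst// mul0r.
    have [h1 h2] := IH (ltnW km).
    have h3 := ii _ km.
    split.
      under eq_fun do rewrite big_ord_recr/=.
      exact: (integrableD measurableT h1 h3).
    under eq_Rintegral do rewrite big_ord_recr/=.
    rewrite RintegralD// h2 add0r X_mart//.
      by apply: Z_meas; exact: ltnW.
    by apply: runmax_sqint; exact: ltnW.
  exact: h.
have i4X : P.-integrable setT (fun w => (4 * X m w ^+ 2)%:E).
  exact: (integrableZl measurableT 4 iX).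
have i4S : P.-integrable setT (fun w => (4 * \sum_(i < m) Z i w * (X i.+1 w - X i w))%:E).
  exact: (integrableZl measurableT 4 iS).
apply: (@le_trans _ _ (\int[P]_w (4 * X m w ^+ 2
    - 4 * \sum_(i < m) Z i w * (X i.+1 w - X i w)))).
  apply: le_Rintegral => //.
    exact: (integrableB measurableT i4X i4S).
  by move=> w _; apply: doob_pathwise; exact: X_0.
by rewrite RintegralB// !RintegralZl// zS mulr0 subr0.
Qed.

End doob.

Section doob_elementary.
Context d (Omega : measurableType d) (R : realType) (P : probability Omega R).
Variables (T : R) (F : R -> set (set Omega)) (n : nat).
Variables (W : R -> Omega -> 'cV[R]_n) (j : 'I_n).
Hypotheses (Ff : filtration T F) (bm : brownian_motion P T F W).
Variable t : R.
Hypothesis t0 : 0 <= t.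
Variables I v : R -> Omega -> R.
Hypothesis e : elementary T F W j t I v.
Variables (r : nat -> R) (m : nat).
Hypothesis r0 : r 0%N = t.
Hypothesis rS : forall i, (i < m)%N -> r i <= r i.+1.
Hypothesis r_itv : forall i, (i <= m)%N -> t <= r i <= T.

Lemma elementary_start w : I t w = 0.
Proof.
elim: e => [//|a b c I' v' [ta ab bT _ _] _ IH].
by rewrite IH addr0 /base_integral !min_l ?subrr ?mulr0// (le_trans ta).
Qed.

(** Doob's inequality is used for [I] and for [- I], to control both signs; hence the constant 8. A
    single dominating function [Gd] is produced because this is the input of
    [integral_path_sup_le]. *)
Lemma doob_elementary : exists Gd : Omega -> R, [/\ measurable_fun setT Gd,
    forall i w, (i <= m)%N -> I (r i) w ^+ 2 <= Gd w
  & (\int[P]_w (Gd w)%:E <= 8%:E * \int[P]_w (I (r m) w ^+ 2)%:E)%E].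
Proof.
have r_mono i (f : Omega -> R) : (i < m)%N ->
    measurable_wrt (F (r i)) f -> measurable_wrt (F (r i.+1)) f.
  move=> im; have /andP[tr rT] := r_itv im; have /andP[tr' _] := r_itv (ltnW im).
  by apply: (measurable_wrtW Ff) => //; [exact: le_trans tr'|exact: rS].
have mart i Y : (i < m)%N -> measurable_wrt (F (r i)) Y -> sqint P Y ->
    \int[P]_w (Y w * (I (r i.+1) w - I (r i) w)) = 0.
  move=> im mY sY; have /andP[tr rT] := r_itv im; have /andP[tr' _] := r_itv (ltnW im).
  by apply: (elementary_orthogonal Ff bm t0 e) => //; exact: rS.
have sI i : (i <= m)%N -> sqint P (I (r i)).
  by move=> im; apply: (elementary_sqint Ff bm t0 e); exact: r_itv.
have mI i : (i <= m)%N -> measurable_wrt (F (r i)) (I (r i)).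
  by move=> im; apply: (elementary_measurable_wrt Ff bm t0 e); exact: r_itv.
have I0 w : I (r 0%N) w = 0 by rewrite r0 elementary_start.
pose X i w := I (r i) w; pose X' i w := - I (r i) w.
have sN f : sqint P f -> sqint P (fun w => - f w).
  move=> sf; have := sqintB (sqint_cst P 0) sf.
  by congr sqint; apply/funext => w; rewrite sub0r.
have dX := doob_L2 r_mono mI sI I0 mart.
have dX' : \int[P]_w (runmax (X' ^~ w) m ^+ 2) <= 4 * \int[P]_w (I (r m) w ^+ 2).
  have -> : \int[P]_w (I (r m) w ^+ 2) = \int[P]_w (X' m w ^+ 2).
    by apply: eq_Rintegral => w _; rewrite sqrrN.
  apply: (doob_L2 (G := fun i => F (r i))) => //.
  - by move=> i im; apply: measurable_funN; exact: mI.
  - by move=> i im; apply: sN; exact: sI.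
  - by move=> w; rewrite /X' I0 oppr0.
  - move=> i Y im mY sY; have /eqP := mart i Y im mY sY; rewrite -oppr_eq0 => /eqP <-.
    rewrite -mulN1r -RintegralZl//; last by apply: sqint_mul => //; apply: sqintB; apply: sI => //; exact: ltnW.
    by apply: eq_Rintegral => w _; rewrite /X'; ring.
have [mz iz] : sqint P (fun w => runmax (X ^~ w) m).
  by apply: (runmax_sqint sI).
have [mz' iz'] : sqint P (fun w => runmax (X' ^~ w) m).
  by apply: (@runmax_sqint _ _ _ P X' m) => // i im; apply: sN; exact: sI.
exists (fun w => runmax (X ^~ w) m ^+ 2 + runmax (X' ^~ w) m ^+ 2); split.
- by apply: measurable_funD; exact: measurable_funX.
- by move=> i w im; apply: (sqr_le_runmax (x := X ^~ w)) => //; exact: I0.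
have [_ iI] := sI m (leqnn m).
have fE f : P.-integrable setT (fun w => (f w)%:E) ->
    (\int[P]_w (f w)%:E)%E = (\int[P]_w f w)%:E.
  by move=> fi; rewrite /Rintegral fineK//; exact: integrable_fin_num.
rewrite fE; last exact: (integrableD measurableT iz iz').
by rewrite fE// RintegralD// -EFinM lee_fin; lra.
Qed.

End doob_elementary.

(** * Transforms of Ito integrals *)

Section joint_measurability.
Context d (Omega : measurableType d) (R : realType) (P : probability Omega R).
Variables (t T : R).
Local Notation mu := (@lebesgue_measure R).
Implicit Types f g : R -> Omega -> R.

Definition joint f : Prop :=
  measurable_fun (`[t, T]%classic `*` [set: Omega]) (fun z : R * Omega => f z.1 z.2).

Let mD : measurable (`[t, T]%classic `*` [set: Omega] : set (R * Omega)).
Proof. exact: measurableX. Qed.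

Lemma progressive_joint (F : R -> set (set Omega)) (a : R) f : filtration T F ->
  0 <= a -> a <= t -> t <= T -> progressive F a T f -> joint f.
Proof.
move=> Ff a0 at' tT pf.
have aT : a <= T <= T by rewrite lexx (le_trans at').
have TT : 0 <= T <= T by rewrite lexx (le_trans a0)// (le_trans at').
have h := pf T aT.
have mphi : measurable_fun setT
    (fun z : R * Omega => (z.1, z.2) : R * g_sigma_algebraType (F T)).
  apply: measurable_fun_pair; first exact: measurable_fst.
  exact: measurableT_comp (measurable_wrt_id Ff TT) measurable_snd.
have mA : measurable (`[a, T]%classic `*` [set: g_sigma_algebraType (F T)]).
  exact: measurableX.
apply: (measurable_comp mA _ h (measurable_funTS mphi)).
move=> _ [z [/= + _] <-] /=; rewrite in_itv/= => /andP[tz zT].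
by split => //=; rewrite in_itv/= zT (le_trans at').
Qed.

Lemma joint_section f w : joint f -> measurable_fun `[t, T] (f ^~ w).
Proof.
move=> jf; apply: (measurable_comp mD _ jf (measurable_funTS (pair2_measurable w))).
by move=> _ [s /= st <-].
Qed.

Lemma joint_integral f : joint f -> (forall s w, 0 <= f s w) ->
  measurable_fun setT (fun w => \int[mu]_(s in `[t, T]) (f s w)%:E)%E.
Proof.
move=> jf f0.
pose g := (EFin \o (fun z : R * Omega => f z.1 z.2)) \_ (`[t, T]%classic `*` setT).
have mg : measurable_fun setT g.
  by apply/(measurable_restrictT _ mD)/measurable_EFinP.
have g0 z : (0 <= g z)%E by rewrite /g /patch; case: ifP => // _; rewrite lee_fin.
have := @measurable_fun_fubini_tonelli_G _ _ _ Omega R mu g mg g0.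
congr (measurable_fun setT); apply/funext => w.
rewrite /fubini_G [RHS]integral_mkcond; apply: eq_integral => s _.
have E : ((s, w) \in (`[t, T]%classic `*` [set: Omega])) = (s \in `[t, T]%classic).
  by apply/idP/idP => /set_mem h; apply/mem_set; [case: h|].
by rewrite /g /patch E.
Qed.

Definition jint f : \bar R := (\int[P]_w \int[mu]_(s in `[t, T]) (f s w)%:E)%E.

Lemma jint_ge0 f : (forall s w, 0 <= f s w) -> (0 <= jint f)%E.
Proof.
by move=> f0; do 2! (apply: integral_ge0 => ? _); rewrite lee_fin.
Qed.

Lemma jintD f g : joint f -> joint g -> (forall s w, 0 <= f s w) ->
  (forall s w, 0 <= g s w) ->
  jint (fun s w => f s w + g s w) = (jint f + jint g)%E.
Proof.
move=> jf jg f0 g0; rewrite /jint -ge0_integralD//; last 4 first.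
- by move=> w _; apply: integral_ge0 => s _; rewrite lee_fin.
- exact: joint_integral.
- by move=> w _; apply: integral_ge0 => s _; rewrite lee_fin.
- exact: joint_integral.
apply: eq_integral => w _.
under eq_integral do rewrite EFinD.
rewrite ge0_integralD//.
- by move=> s _; rewrite lee_fin.
- by apply/measurable_EFinP; exact: joint_section.
- by move=> s _; rewrite lee_fin.
- by apply/measurable_EFinP; exact: joint_section.
Qed.

Lemma jintZ (r : R) f : 0 <= r -> joint f -> (forall s w, 0 <= f s w) ->
  jint (fun s w => r * f s w) = (r%:E * jint f)%E.
Proof.
move=> r0 jf f0; rewrite /jint -ge0_integralZl//; last 2 first.
- exact: joint_integral.
- by move=> w _; apply: integral_ge0 => s _; rewrite lee_fin.
apply: eq_integral => w _.
under eq_integral do rewrite EFinM.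
rewrite ge0_integralZl//.
- by apply/measurable_EFinP; exact: joint_section.
- by move=> s _; rewrite lee_fin.
Qed.

Lemma jint_le f g : joint f -> joint g -> (forall s w, 0 <= f s w) ->
  (forall s w, t <= s <= T -> f s w <= g s w) -> (forall s w, 0 <= g s w) ->
  (jint f <= jint g)%E.
Proof.
move=> jf jg f0 fg g0; apply: ge0_le_integral => //.
- by move=> w _; apply: integral_ge0 => s _; rewrite lee_fin.
- exact: joint_integral.
- exact: joint_integral.
move=> w _; apply: ge0_le_integral => //.
- by move=> s _; rewrite lee_fin.
- by apply/measurable_EFinP; exact: joint_section.
- by apply/measurable_EFinP; exact: joint_section.
- by move=> s /=; rewrite in_itv/= => st; rewrite lee_fin fg.
Qed.

Lemma jointD f g : joint f -> joint g -> joint (fun s w => f s w + g s w).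
Proof. by move=> jf jg; exact: measurable_funD. Qed.

Lemma jointB f g : joint f -> joint g -> joint (fun s w => f s w - g s w).
Proof. by move=> jf jg; exact: measurable_funB. Qed.

Lemma jointM f g : joint f -> joint g -> joint (fun s w => f s w * g s w).
Proof. by move=> jf jg; exact: measurable_funM. Qed.

Lemma jointX f k : joint f -> joint (fun s w => f s w ^+ k).
Proof. by move=> jf; exact: measurable_funX. Qed.

Lemma joint_cst r : joint (fun _ _ => r).
Proof. exact: measurable_cst. Qed.

End joint_measurability.

Section joint_sums.
Context d (Omega : measurableType d) (R : realType) (P : probability Omega R).
Variables (t T : R).
Local Notation mu := (@lebesgue_measure R).

Lemma joint_sum k (f : nat -> R -> Omega -> R) : (forall l, (l < k)%N -> joint t T (f l)) ->
  joint t T (fun s w => \sum_(l < k) f l s w).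
Proof.
elim: k => [_|k IH jf].
  by rewrite (_ : (fun _ _ => _) = (fun _ _ => 0)); [exact: joint_cst|
    apply/funext => s; apply/funext => w; rewrite big_ord0].
rewrite (_ : (fun _ _ => _) = (fun s w => \sum_(l < k) f l s w + f k s w)); last first.
  by apply/funext => s; apply/funext => w; rewrite big_ord_recr.
by apply: jointD; [apply: IH => l lk; apply: jf; exact: ltnW|exact: jf].
Qed.

Lemma jint_sum k (f : nat -> R -> Omega -> R) : (forall l, (l < k)%N -> joint t T (f l)) ->
  (forall l s w, (l < k)%N -> 0 <= f l s w) ->
  jint P t T (fun s w => \sum_(l < k) f l s w) = (\sum_(l < k) jint P t T (f l))%E.
Proof.
elim: k => [_ _|k IH jf f0].
  rewrite big_ord0 /jint; apply: integral0_eq => w _; apply: integral0_eq => s _.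
  by rewrite big_ord0.
rewrite (_ : (fun _ _ => _) = (fun s w => \sum_(l < k) f l s w + f k s w)); last first.
  by apply/funext => s; apply/funext => w; rewrite big_ord_recr.
have jf' l : (l < k)%N -> joint t T (f l) by move=> lk; apply: jf; exact: ltnW.
have f0' l s w : (l < k)%N -> 0 <= f l s w by move=> lk; apply: f0; exact: ltnW.
rewrite jintD ?IH//; [by rewrite big_ord_recr|exact: joint_sum|exact: jf| |].
  by move=> s w; apply: sumr_ge0 => l _; exact: f0'.
by move=> s w; exact: f0.
Qed.

Lemma joint_cell (a b : R) (Z : Omega -> R) : measurable_fun setT Z ->
  joint t T (fun s w => \1_(`]a, b]%classic : set R) s * Z w).
Proof.
move=> mZ; apply: jointM; apply: measurable_funTS.
  exact: (measurableT_comp (measurable_indic _) measurable_fst).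
exact: (measurableT_comp mZ measurable_snd).
Qed.

Lemma jint_cell (a b : R) (Z : Omega -> R) : measurable_fun setT Z ->
  (forall w, 0 <= Z w) -> t <= a -> a <= b -> b <= T ->
  jint P t T (fun s w => \1_(`]a, b]%classic : set R) s * Z w)
  = ((b - a)%:E * \int[P]_w (Z w)%:E)%E.
Proof.
move=> mZ Z0 ta ab bT; rewrite /jint -ge0_integralZl//; last 3 first.
- exact/measurable_EFinP.
- by move=> w _; rewrite lee_fin.
- by rewrite lee_fin subr_ge0.
apply: eq_integral => w _; under eq_integral do rewrite EFinM.
rewrite ge0_integralZr//; last 2 first.
- by apply/measurable_EFinP; apply: measurable_funTS; exact: measurable_indic.
- by rewrite lee_fin.
rewrite integral_indic// setIidl; last first.
  by move=> s /=; rewrite !in_itv/= => /andP[/ltW h1 h2]; rewrite (le_trans ta)// (le_trans h2).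
congr (_ * _)%E; transitivity (mu `]a, b]%classic); first by [].
rewrite lebesgue_measure_itv/= lte_fin; case: ltgtP ab => // -> _.
by rewrite subrr.
Qed.

End joint_sums.

(** The factor [2 ^+ m] is cruder than that of the Cauchy-Schwarz inequality but comes from a plain
    induction. It is applied to errors that tend to zero and to sums over the [n] Brownian
    coordinates, so the mesh does not enter any final constant through it. *)
Lemma sqr_sum_le (R : realType) (m : nat) (y : 'I_m -> R) :
  (\sum_l y l) ^+ 2 <= 2 ^+ m * \sum_l y l ^+ 2.
Proof.
elim: m y => [|m IH] y; first by rewrite !big_ord0 expr0n/= mulr0.
rewrite !big_ord_recr/= [2 ^+ m.+1]exprS.
have := IH (fun l => y (widen_ord (leqnSn m) l)).
set S := \sum_l _; set Q := \sum_l _ ^+ 2.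
have : 0 <= (S - y ord_max) ^+ 2 by exact: sqr_ge0.
have : 1 <= 2 ^+ m :> R by rewrite exprn_ege1// ler1n.
have : 0 <= y ord_max ^+ 2 by exact: sqr_ge0.
move: (2 ^+ m) (y ord_max) => c z z2 c1 h2 h.
have : 0 <= (c - 1) * z ^+ 2 by rewrite mulr_ge0// subr_ge0.
lra.
Qed.

(** * Maximal inequality for transforms of Ito integrals *)

Section ito_bound.
Context d (Omega : measurableType d) (R : realType) (P : probability Omega R).
Variables (T : R) (F : R -> set (set Omega)) (n : nat).
Variables (W : R -> Omega -> 'cV[R]_n) (j : 'I_n).
Hypotheses (Ff : filtration T F) (bm : brownian_motion P T F W).
Variable t : R.
Hypotheses (t0 : 0 <= t) (tT : t <= T).
Local Notation elementary := (elementary T F W j t).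
Local Notation mu := (@lebesgue_measure R).
Local Notation kappa := (normal_var R).
Local Notation jint := (jint P t T).
Local Notation joint := (@joint _ Omega R t T).

Lemma step_elementary (phi : step_process Omega R) : is_step_process F t T phi ->
  elementary (step_integral phi (fun k w => W k w j 0)) (step_value phi).
Proof.
move=> [st sT sm mc [C hC]].
have mono l k : (l <= k)%N -> (k <= step_size phi)%N -> step_time phi l <= step_time phi k.
  elim: k => [|k IH]; first by rewrite leqn0 => /eqP ->.
  rewrite leq_eqVlt ltnS => /predU1P[->//|lk] ks.
  by apply: le_trans (sm _ ks); apply: IH => //; exact: ltnW.
apply: (elementary_sum (I := fun l => base_integral W j (step_time phi l)
   (step_time phi l.+1) (step_coef phi l))
  (v := fun l => base_value (step_time phi l) (step_time phi l.+1) (step_coef phi l))).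
move=> l ls; apply: elementary_base.
have tl : t <= step_time phi l by rewrite -st mono// ltnW.
have lT : step_time phi l.+1 <= T by rewrite -sT mono.
split => //; first exact: sm.
- exists C => [|w]; last exact: hC.
  apply: (measurable_wrt_fun Ff (s := step_time phi l)); last exact: mc.
  by rewrite (le_trans t0)// (le_trans (sm _ ls)).
- by move=> _; exact: mc.
Qed.

Variables (del : R) (m : nat) (E : nat -> Omega -> R).
Hypotheses (del0 : 0 < del) (gT : grid t del m <= T).
Local Notation g := (grid t del).
Hypothesis mE : forall l, (l < m)%N -> measurable_wrt (F (g l)) (E l).
Hypothesis E01 : forall l w, 0 <= E l w <= 1.

(** The step process frozen at the left ends of the cells. Its integral against a process [D] is
    [transform D], a finite sum defined path by path, which makes sense for Ito integrals as well as
    for elementary ones. *)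
Definition weight (s : R) (w : Omega) : R :=
  \sum_(l < m) E l w * \1_(`]g l, g l.+1]%classic : set R) s.

Definition transform (D : R -> Omega -> R) (k : R) (w : Omega) : R :=
  \sum_(l < m) E l w * (D (Num.min k (g l.+1)) w - D (Num.min k (g l)) w).

Let tg l : t <= g l.
Proof. by rewrite -{1}(grid0 t del); apply: le_grid => //; exact: ltW. Qed.

Let gS l : g l <= g l.+1.
Proof. by apply: le_grid => //; exact: ltW. Qed.

Let glT l : (l <= m)%N -> g l <= T.
Proof. by move=> lm; apply: le_trans gT; apply: le_grid => //; exact: ltW. Qed.

Let mE' l : (l < m)%N -> measurable_fun setT (E l).
Proof.
move=> lm; apply: (measurable_wrt_fun Ff (s := g l)); last exact: mE.
by rewrite (le_trans t0)//= glT// ltnW.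
Qed.

Lemma transform_elementary I v I' v' : elementary I v -> elementary I' v' ->
  elementary (transform (fun k w => I k w - I' k w))
             (fun s w => weight s w * (v s w - v' s w)).
Proof.
move=> e e'.
have h l : (l < m)%N -> elementary
    (fun k w => E l w * (I (Num.min k (g l.+1)) w - I (Num.min k (g l)) w)
      + - E l w * (I' (Num.min k (g l.+1)) w - I' (Num.min k (g l)) w))
    (fun s w => E l w * \1_(`]g l, g l.+1]%classic : set R) s * v s w
      + - E l w * \1_(`]g l, g l.+1]%classic : set R) s * v' s w).
  move=> lm; apply: elementaryD.
    apply: (elementary_cut Ff t0) => //; [exact: glT|exact: mE|].
    by exists 1 => w; rewrite ger0_norm; have /andP[] := E01 l w.
  apply: (elementary_cut Ff t0) => //; [exact: glT|apply: measurable_funN; exact: mE|].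
  by exists 1 => w; rewrite normrN ger0_norm; have /andP[] := E01 l w.
have := elementary_sum h.
congr elementary; apply/funext => k; apply/funext => w.
  by apply: eq_bigr => l _; ring.
by rewrite /weight mulr_suml; apply: eq_bigr => l _; ring.
Qed.

Lemma joint_weight : joint weight.
Proof.
rewrite /weight.
have h k : (k <= m)%N ->
    joint (fun s w => \sum_(l < k) E l w * \1_(`]g l, g l.+1]%classic : set R) s).
  elim: k => [_|k IH km].
    by rewrite (_ : (fun _ _ => _) = (fun _ _ => 0)); [exact: joint_cst|
      apply/funext => s; apply/funext => w; rewrite big_ord0].
  rewrite (_ : (fun _ _ => _) = (fun s w =>
    \sum_(l < k) E l w * \1_(`]g l, g l.+1]%classic : set R) s
    + E k w * \1_(`]g k, g k.+1]%classic : set R) s)); last first.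
    by apply/funext => s; apply/funext => w; rewrite big_ord_recr.
  apply: jointD; first by apply: IH; exact: ltnW.
  apply: jointM; apply: measurable_funTS.
    exact: (measurableT_comp (mE' km) measurable_snd).
  exact: (measurableT_comp (measurable_indic _) measurable_fst).
exact: h.
Qed.

(** A crude bound by the number of cells. It stands only in front of approximation errors that tend
    to zero and in a finiteness argument, so its dependence on the mesh is harmless. *)
Lemma weight_le s w : weight s w ^+ 2 <= m%:R ^+ 2.
Proof.
have h : 0 <= weight s w <= m%:R.
  apply/andP; split.
    by apply: sumr_ge0 => l _; rewrite mulr_ge0//; have /andP[] := E01 l w.
  apply: (@le_trans _ _ (\sum_(l < m) 1)); last by rewrite sumr_const card_ord.
  apply: ler_sum => l _; have /andP[e0 e1] := E01 l w.
  by rewrite indicE; case: (_ \in _); rewrite ?mulr1 ?mulr0.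
by have /andP[h1 h2] := h; rewrite lerXn2r// nnegrE// (le_trans h1).
Qed.

Variables (h M h' M' : R -> Omega -> R).
Hypothesis hM : ito_integral P F (fun k w => W k w j 0) t T h M.
Hypothesis hM' : ito_integral P F (fun k w => W k w j 0) t T h' M'.

Let jh : joint h.
Proof. by have [p _ _ _ _] := hM; exact: progressive_joint Ff t0 _ tT p. Qed.

Let jh' : joint h'.
Proof. by have [p _ _ _ _] := hM'; exact: progressive_joint Ff t0 _ tT p. Qed.

Let mM k : t <= k <= T -> measurable_fun setT (M k).
Proof. by move=> kT; have [_ _ _ mMk _] := hM; exact: mMk. Qed.

Let mM' k : t <= k <= T -> measurable_fun setT (M' k).
Proof. by move=> kT; have [_ _ _ mMk _] := hM'; exact: mMk. Qed.

Let L0 := jint (fun s w => (weight s w * (h s w - h' s w)) ^+ 2).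

Section approximation.
Variables (I v I' v' : R -> Omega -> R).
Hypotheses (e : elementary I v) (e' : elementary I' v').

Let err k := (\int[P]_w ((I k w - M k w) ^+ 2)%:E +
              \int[P]_w ((I' k w - M' k w) ^+ 2)%:E)%E.

Let joint_v : joint v.
Proof. by apply: measurable_funTS; exact: elementary_measurable e. Qed.

Let joint_v' : joint v'.
Proof. by apply: measurable_funTS; exact: elementary_measurable e'. Qed.

(** Write [v - v' = (h - h') + (v - h) - (v' - h')]; the square of a sum of three terms is at most 3
    times the sum of the squares. *)
Lemma jint_weight_le :
  (jint (fun s w => ((weight s w * (v s w - v' s w)) ^+ 2)%R) <=
   3%:E * L0 + (3 * m%:R ^+ 2)%R%:E * (jint (fun s w => ((v s w - h s w) ^+ 2)%R)
     + jint (fun s w => ((v' s w - h' s w) ^+ 2)%R)))%E.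
Proof.
have jw := joint_weight.
rewrite -jintD; [|by apply: jointX; exact: jointB|by apply: jointX; exact: jointB
  |by move=> *; exact: sqr_ge0|by move=> *; exact: sqr_ge0].
rewrite -jintZ//; [|by apply: jointX; apply: jointM => //; exact: jointB|by move=> s w; exact: sqr_ge0].
rewrite -jintZ; [|by rewrite mulr_ge0// sqr_ge0
  |by apply: jointD; apply: jointX; exact: jointB|by move=> s w; rewrite addr_ge0 ?sqr_ge0].
rewrite -jintD; last 4 first.
- by apply: jointM; [exact: joint_cst|apply: jointX; apply: jointM => //; exact: jointB].
- by apply: jointM; [exact: joint_cst|by apply: jointD; apply: jointX; exact: jointB].
- by move=> s w; rewrite mulr_ge0// sqr_ge0.
- by move=> s w; rewrite !mulr_ge0 ?addr_ge0 ?sqr_ge0.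
apply: jint_le.
- by apply: jointX; apply: jointM => //; exact: jointB.
- apply: jointD; apply: jointM; try exact: joint_cst.
    by apply: jointX; apply: jointM => //; exact: jointB.
  by apply: jointD; apply: jointX; exact: jointB.
- by move=> s w; exact: sqr_ge0.
- move=> s w _; have := weight_le s w.
  move: (weight s w) (m%:R ^+ 2) (v s w) (v' s w) (h s w) (h' s w) => p q a a' b b' pq.
  have : p ^+ 2 * ((a - b) ^+ 2 + (a' - b') ^+ 2) <= q * ((a - b) ^+ 2 + (a' - b') ^+ 2).
    by rewrite ler_wpM2r// addr_ge0 ?sqr_ge0.
  have p2 : 0 <= p ^+ 2 by exact: sqr_ge0.
  have : 0 <= p ^+ 2 * (((a - b) - (b - b')) ^+ 2 + ((a - b) + (a' - b')) ^+ 2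
    + ((b - b') + (a' - b')) ^+ 2).
    by rewrite mulr_ge0// !addr_ge0 ?sqr_ge0.
  rewrite !exprMn; lra.
- move=> s w; apply: addr_ge0; first by rewrite mulr_ge0// sqr_ge0.
  by apply: mulr_ge0; [rewrite mulr_ge0// sqr_ge0|rewrite addr_ge0// sqr_ge0].
Qed.

(** The transform of [M - M'] is compared with that of the elementary [I - I']. The constant is
    [48 = 2 * 8 * 3]: separating the error, Doob's inequality for both signs, and [jint_weight_le].
    All terms besides [L0] vanish as the step processes converge. *)
Lemma transform_le (r : nat -> R) (K : nat) : r 0%N = t ->
  (forall i, (i < K)%N -> r i <= r i.+1) ->
  (forall i, (i <= K)%N -> t <= r i <= T) -> r K = T ->
  exists G : Omega -> R, [/\ measurable_fun setT G,
    forall i w, (i <= K)%N -> transform (fun k w => M k w - M' k w) (r i) w ^+ 2 <= G w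
  & (\int[P]_w (G w)%:E <= (48 * kappa)%R%:E * L0
       + ((48 * kappa * m%:R ^+ 2)%R%:E * (jint (fun s w => ((v s w - h s w) ^+ 2)%R)
            + jint (fun s w => ((v' s w - h' s w) ^+ 2)%R))
       + (2 ^+ m.+3)%R%:E * \sum_(i < K.+1) \sum_(l < m)
            (err (Num.min (r i) (g l.+1)) + err (Num.min (r i) (g l)))))%E].
Proof.
move=> r0 rS r_itv rK.
have eN := transform_elementary e e'.
set N := transform (fun k w => I k w - I' k w) in eN.
have [G [mG NG iG]] := doob_elementary Ff bm t0 eN r0 rS r_itv.
pose D k w := (I k w - M k w) ^+ 2 + (I' k w - M' k w) ^+ 2.
(* Summing the errors over all times of the grid dominates each of them at once; the number of times
   stays fixed while the step processes converge. *)
pose Er w := \sum_(i < K.+1) \sum_(l < m)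
  (D (Num.min (r i) (g l.+1)) w + D (Num.min (r i) (g l)) w).
exists (fun w => 2 * G w + 2 ^+ m.+3 * Er w).
have mD k : t <= k <= T -> measurable_fun setT (D k).
  move=> kT; have [mI _] := elementary_sqint Ff bm t0 e kT.
  have [mI' _] := elementary_sqint Ff bm t0 e' kT.
  by apply: measurable_funD; apply: measurable_funX; apply: measurable_funB => //;
    [exact: mM|exact: mM'].
have D0 k w : 0 <= D k w by rewrite addr_ge0// sqr_ge0.
have iD k : t <= k <= T -> (\int[P]_w (D k w)%:E = err k)%E.
  move=> kT; have [mI _] := elementary_sqint Ff bm t0 e kT.
  have [mI' _] := elementary_sqint Ff bm t0 e' kT.
  rewrite /err -ge0_integralD//.
  - by move=> w _; rewrite lee_fin sqr_ge0.
  - by apply/measurable_EFinP/measurable_funX; apply: measurable_funB => //; exact: mM.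
  - by move=> w _; rewrite lee_fin sqr_ge0.
  - by apply/measurable_EFinP/measurable_funX; apply: measurable_funB => //; exact: mM'.
have rg (i : 'I_K.+1) l : t <= Num.min (r i) (g l) <= T.
  have /andP[ri1 ri2] := r_itv i (ltn_ord i).
  by rewrite le_min ri1 tg ge_min ri2.
have mEr : measurable_fun setT Er.
  by do 2! (apply: measurable_sum => ?); apply: measurable_funD; exact: mD.
have Er0 w : 0 <= Er w.
  by do 2! (apply: sumr_ge0 => ? _); rewrite addr_ge0.
have iEr : (\int[P]_w (Er w)%:E = \sum_(i < K.+1) \sum_(l < m)
            (err (Num.min (r i) (g l.+1)) + err (Num.min (r i) (g l))))%E.
  under eq_integral do rewrite /Er -sumEFin.
  rewrite ge0_integral_sum//; last 2 first.
  - move=> i; apply/measurable_EFinP; apply: measurable_sum => l.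
    by apply: measurable_funD; exact: mD.
  - by move=> i w _; rewrite lee_fin; apply: sumr_ge0 => l _; rewrite addr_ge0.
  apply: eq_bigr => i _.
  under eq_integral do rewrite -sumEFin.
  rewrite ge0_integral_sum//; last 2 first.
  - by move=> l; apply/measurable_EFinP; apply: measurable_funD; exact: mD.
  - by move=> l w _; rewrite lee_fin addr_ge0.
  apply: eq_bigr => l _.
  under eq_integral do rewrite EFinD.
  rewrite ge0_integralD ?iD//.
  - by move=> w _; rewrite lee_fin.
  - by apply/measurable_EFinP; exact: mD.
  - by move=> w _; rewrite lee_fin.
  - by apply/measurable_EFinP; exact: mD.
have G0 w : 0 <= G w by apply: le_trans (NG 0%N w (leq0n _)); exact: sqr_ge0.
split.
- by apply: measurable_funD; apply: measurable_funM => //; exact: measurable_cst.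
- move=> i w iK; have := NG i w iK.
  set y := fun l => E l w * ((M (Num.min (r i) (g l.+1)) w - M' (Num.min (r i) (g l.+1)) w
     - (I (Num.min (r i) (g l.+1)) w - I' (Num.min (r i) (g l.+1)) w))
     - (M (Num.min (r i) (g l)) w - M' (Num.min (r i) (g l)) w
     - (I (Num.min (r i) (g l)) w - I' (Num.min (r i) (g l)) w))).
  have -> : transform (fun k w => M k w - M' k w) (r i) w = N (r i) w + \sum_(l < m) y l.
    by rewrite /N /transform -big_split/=; apply: eq_bigr => l _; rewrite /y; ring.
  (* A factor [2 ^+ m] comes from the sum over the cells, and a factor 4 from the four differences
     contained in each [y l]. *)
  have hy : (\sum_(l < m) y l) ^+ 2 <= 2 ^+ m.+2 * Er w.
    apply: le_trans (sqr_sum_le (fun l : 'I_m => y l)) _.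
    rewrite exprSr exprSr -!mulrA ler_pM2l ?exprn_gt0//.
    apply: (@le_trans _ _ (2 * (2 * \sum_(l < m)
      (D (Num.min (r i) (g l.+1)) w + D (Num.min (r i) (g l)) w)))).
      rewrite !mulr_sumr; apply: ler_sum => l _.
      rewrite /y /D exprMn.
      move: (E01 l w) (M _ w) (M' _ w) (I _ w) (I' _ w) (M _ w) (M' _ w) (I _ w) (I' _ w).
      move=> /andP[ee0 ee1] a1 a2 a3 a4 b1 b2 b3 b4.
      set X := _ - _ - (_ - _) - (_ - _ - (_ - _)).
      have : E l w ^+ 2 * X ^+ 2 <= X ^+ 2.
        by rewrite ler_piMl ?sqr_ge0// expr_le1.
      have := sqr_ge0 ((a1 - a3) + (a2 - a4)).
      have := sqr_ge0 ((a1 - a3) + (b1 - b3)).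
      have := sqr_ge0 ((a1 - a3) - (b2 - b4)).
      have := sqr_ge0 ((a2 - a4) - (b1 - b3)).
      have := sqr_ge0 ((a2 - a4) + (b2 - b4)).
      have := sqr_ge0 ((b1 - b3) + (b2 - b4)).
      rewrite /X; lra.
    have iK1 : (i < K.+1)%N by [].
    rewrite !ler_pM2l//; rewrite /Er (bigD1 (Ordinal iK1))//= lerDl.
    by do 2! (apply: sumr_ge0 => ? _); rewrite addr_ge0.
  have := sqr_ge0 (N (r i) w - \sum_(l < m) y l).
  move: hy; rewrite [2 ^+ m.+3]exprS -[2 * _ * Er w]mulrA.
  move: (N (r i) w) (\sum_(l < m) y l) (G w) (2 ^+ m.+2 * Er w) => q z G1 c; lra.
have -> : (\int[P]_w (2 * G w + 2 ^+ m.+3 * Er w)%:E =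
    \int[P]_w (2%:E * (G w)%:E + (2 ^+ m.+3)%R%:E * (Er w)%:E))%E by [].
have : 0 <= 2 ^+ m.+3 :> R by exact: exprn_ge0.
move: (2 ^+ m.+3) => c c0.
rewrite ge0_integralD//; last 4 first.
- by move=> w _; rewrite -EFinM lee_fin mulr_ge0.
- by apply/measurable_EFinP; apply: measurable_funM => //; exact: measurable_cst.
- by move=> w _; rewrite -EFinM lee_fin mulr_ge0.
- by apply/measurable_EFinP; apply: measurable_funM => //; exact: measurable_cst.
rewrite !ge0_integralZl//; try (by rewrite lee_fin ?exprn_ge0); try exact/measurable_EFinP; last 2 first.
- by move=> w _; rewrite lee_fin.
- by move=> w _; rewrite lee_fin.
rewrite iEr addeA; apply: leeD => //.
apply: (@le_trans _ _ (2%:E * (8%:E * \int[P]_w (N (r K) w ^+ 2)%:E))%E).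
  by apply: lee_wpmul2l.
rewrite rK (elementary_isometry_ereal Ff bm t0 tT eN).
have := jint_weight_le; rewrite /jint.
set A := (\int[P]_w _)%E => hA.
have k0 : (0 <= (16 * kappa)%R%:E)%E by rewrite lee_fin mulr_ge0// normal_var_ge0.
apply: (@le_trans _ _ ((16 * kappa)%R%:E * A)%E).
  by rewrite !muleA -!EFinM (_ : 2 * 8 * kappa = 16 * kappa)%R//; ring.
apply: le_trans (lee_wpmul2l k0 hA) _.
rewrite ge0_muleDr; last 2 first.
- by rewrite mule_ge0//; apply: jint_ge0 => s w; exact: sqr_ge0.
- apply: mule_ge0; first by rewrite lee_fin mulr_ge0// sqr_ge0.
  by apply: adde_ge0; apply: jint_ge0 => s w; exact: sqr_ge0.
rewrite !muleA -!EFinM.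
by rewrite (_ : 16 * kappa * 3 = 48 * kappa)%R; [rewrite (_ : 16 * kappa * (3 * m%:R ^+ 2) = 48 * kappa * m%:R ^+ 2)%R//; ring|ring].
Qed.

End approximation.
End ito_bound.

Section within_continuity.
Context {R : realType} {V : pseudoMetricNormedZmodType R}.
Variables a b : R.
Implicit Types f : R -> V.

Lemma within_continuousP f : {within `[a, b], continuous f} <->
  (forall x, a <= x <= b -> forall e, 0 < e -> exists2 del, 0 < del &
     forall y, a <= y <= b -> `|x - y| < del -> `|f x - f y| < e).
Proof.
split=> [/subspace_continuousP h x xab e e0|h].
  have /cvgrPdist_lt/(_ e e0) : f @ within `[a, b] (nbhs x) --> f x.
    by apply: h; rewrite /= in_itv.
  rewrite /within/= => /nbhs_ballP[del /= del0 hdel].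
  exists del => // y yab xy.
  by have := hdel y xy; rewrite in_itv/=; apply.
apply/subspace_continuousP => x /=; rewrite in_itv/= => xab.
apply/cvgrPdist_lt => e e0; have [del del0 hdel] := h x xab e e0.
rewrite /within/=; apply/nbhs_ballP; exists del => //= y xy; rewrite in_itv/= => yab.
exact: hdel.
Qed.

Lemma within_continuous_min f c : {within `[a, b], continuous f} -> a <= c <= b ->
  {within `[a, b], continuous (fun k => f (Num.min k c))}.
Proof.
move=> /within_continuousP h /andP[ac cb]; apply/within_continuousP => x /andP[ax xb] e e0.
have [|del del0 hdel] := h (Num.min x c) _ e e0; first by rewrite le_min ax ac ge_min xb.
exists del => // y /andP[ay yb] xy; apply: hdel; first by rewrite le_min ay ac ge_min yb.
by apply: le_lt_trans xy; case: (leP x c) => xc; case: (leP y c) => yc; rewrite ler_norml;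
  apply/andP; split; have := ler_norm (x - y); have := ler_norm (- (x - y)); rewrite normrN; lra.
Qed.

End within_continuity.

Lemma cvge_sum0 (R : realType) (m : nat) (f : nat -> nat -> \bar R) :
  (forall l, (l < m)%N -> f l @ \oo --> 0%E) ->
  (fun p => \sum_(l < m) f l p)%E @ \oo --> 0%E.
Proof.
elim: m => [_|m IH h].
  have -> : (fun p => \sum_(l < 0) f l p)%E = fun=> 0%E.
    by apply/funext => p; rewrite big_ord0.
  exact: cvg_cst.
have -> : (fun p => \sum_(l < m.+1) f l p)%E = (fun p => \sum_(l < m) f l p + f m p)%E.
  by apply/funext => p; rewrite big_ord_recr.
rewrite -[X in _ --> X]adde0; apply: cvgeD; [by []|apply: IH|exact: h].
by move=> l lm; apply: h; exact: leqW.
Qed.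

Section ito_sup.
Context d (Omega : measurableType d) (R : realType) (P : probability Omega R).
Variables (T : R) (F : R -> set (set Omega)) (n : nat).
Variables (W : R -> Omega -> 'cV[R]_n) (j : 'I_n).
Hypotheses (Ff : filtration T F) (bm : brownian_motion P T F W).
Variable t : R.
Hypotheses (t0 : 0 <= t) (tT : t <= T).
Local Notation mu := (@lebesgue_measure R).
Local Notation kappa := (normal_var R).
Variables (del : R) (m : nat) (E : nat -> Omega -> R).
Hypotheses (del0 : 0 < del) (gT : grid t del m <= T).
Local Notation g := (grid t del).
Hypothesis mE : forall l, (l < m)%N -> measurable_wrt (F (g l)) (E l).
Hypothesis E01 : forall l w, 0 <= E l w <= 1.
Variables (h M h' M' : R -> Omega -> R).
Hypothesis hM : ito_integral P F (fun k w => W k w j 0) t T h M.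
Hypothesis hM' : ito_integral P F (fun k w => W k w j 0) t T h' M'.

Definition ito_transform k w := transform t del m E (fun k w => M k w - M' k w) k w.

Let tg l : t <= g l.
Proof. by rewrite -{1}(grid0 t del); apply: le_grid => //; exact: ltW. Qed.

Let glT l : (l <= m)%N -> t <= g l <= T.
Proof. by move=> lm; rewrite tg; apply: le_trans gT; apply: le_grid => //; exact: ltW. Qed.

Lemma ito_transform_continuous w :
  {within `[t, T], continuous (fun k => ito_transform k w ^+ 2)}.
Proof.
have [_ _ cM _ _] := hM; have [_ _ cM' _ _] := hM'.
have cU : {within `[t, T], continuous (fun k => ito_transform k w)}.
  rewrite /ito_transform /transform.
  have H i (f : R -> R) : (i <= m)%N -> (forall k, f k = \sum_(l < i)
     E l w * (M (Num.min k (g l.+1)) w - M' (Num.min k (g l.+1)) w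
       - (M (Num.min k (g l)) w - M' (Num.min k (g l)) w))) ->
     {within `[t, T], continuous f}.
    elim: i f => [|i IH] f im hf.
      have -> : f = fun=> 0 by apply/funext => k; rewrite hf big_ord0.
      by move=> x; exact: cvg_cst.
    have -> : f = (fun k => \sum_(l < i)
       E l w * (M (Num.min k (g l.+1)) w - M' (Num.min k (g l.+1)) w
         - (M (Num.min k (g l)) w - M' (Num.min k (g l)) w))
       + E i w * (M (Num.min k (g i.+1)) w - M' (Num.min k (g i.+1)) w
         - (M (Num.min k (g i)) w - M' (Num.min k (g i)) w))).
      by apply/funext => k; rewrite hf big_ord_recr.
    move=> x; apply: cvgD; first exact: (IH _ (ltnW im) (fun=> erefl) x).
    apply: cvgM; first exact: cvg_cst.
    apply: cvgB; apply: cvgB.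
    - apply: (within_continuous_min (cM w) (glT im)).
    - apply: (within_continuous_min (cM' w) (glT im)).
    - apply: (within_continuous_min (cM w) (glT (ltnW im))).
    - apply: (within_continuous_min (cM' w) (glT (ltnW im))).
  exact: (H m _ (leqnn m) (fun=> erefl)).
move=> x; apply: (@cvgM R _ _ _ _ _ _ _ (cU x) (cU x)).
Qed.

Lemma ito_transform_measurable k : t <= k <= T -> measurable_fun setT (ito_transform k).
Proof.
move=> /andP[tk kT].
have [_ _ _ mM _] := hM; have [_ _ _ mM' _] := hM'.
have ic l : (l <= m)%N -> t <= Num.min k (g l) <= T.
  by move=> lm; rewrite le_min tk tg ge_min kT.
have mEl l : (l < m)%N -> measurable_fun setT (E l).
  move=> lm; apply: (measurable_wrt_fun Ff (s := g l)); last exact: mE.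
  by have /andP[h1 h2] := glT (ltnW lm); rewrite h2 (le_trans t0).
have H i : (i <= m)%N -> measurable_fun setT (fun w => \sum_(l < i)
     E l w * (M (Num.min k (g l.+1)) w - M' (Num.min k (g l.+1)) w
       - (M (Num.min k (g l)) w - M' (Num.min k (g l)) w))).
  elim: i => [_|i IH im].
    by under eq_fun do rewrite big_ord0; exact: measurable_cst.
  under eq_fun do rewrite big_ord_recr/=.
  apply: measurable_funD; first by apply: IH; exact: ltnW.
  apply: measurable_funM; first exact: mEl.
  by apply: measurable_funB; apply: measurable_funB; do ?[apply: mM|apply: mM'];
    apply: ic => //; exact: ltnW.
exact: H.
Qed.

(** The order of limits matters. For a fixed grid of times the step approximation is chosen so fine
    that the remainder of [transform_le] is below [eps]; as that bound no longer depends on the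
    grid, [integral_path_sup_le] then refines the grid. *)
Lemma integral_ito_transform_sup_le :
  (\int[P]_w (path_sup t T (fun k w => ito_transform k w ^+ 2) w)%:E <=
   (48 * kappa)%R%:E *
   jint P t T (fun s w => ((weight t del m E s w * (h s w - h' s w)) ^+ 2)%R))%E.
Proof.
apply/lee_addgt0Pr => eps eps0.
have [_ _ _ _ [phi [sphi vphi iphi]]] := hM.
have [_ _ _ _ [phi' [sphi' vphi' iphi']]] := hM'.
apply: integral_path_sup_le => //.
- exact: ito_transform_continuous.
- by move=> k kT; apply: measurable_funX; exact: ito_transform_measurable.
- by move=> k w _; exact: sqr_ge0.
move=> K.
pose r := grid t ((T - t) / K.+1%:R).
have d0 : 0 <= (T - t) / K.+1%:R by rewrite divr_ge0// subr_ge0.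
have rK : r K.+1 = T by rewrite /r /grid mulrC divfK// addrC subrK.
have r0 : r 0%N = t by exact: grid0.
have rT i : (i <= K.+1)%N -> t <= r i <= T.
  by move=> iK; rewrite -{1}r0 -rK; apply/andP; split; exact: le_grid.
have rS i : (i < K.+1)%N -> r i <= r i.+1 by move=> _; exact: le_grid.
pose B k w := W k w j 0.
pose err p k := (\int[P]_w ((step_integral (phi p) B k w - M k w) ^+ 2)%:E +
              \int[P]_w ((step_integral (phi' p) B k w - M' k w) ^+ 2)%:E)%E.
pose rest p := ((48 * kappa * m%:R ^+ 2)%R%:E *
   (jint P t T (fun s w => ((step_value (phi p) s w - h s w) ^+ 2)%R)
    + jint P t T (fun s w => ((step_value (phi' p) s w - h' s w) ^+ 2)%R))
   + (2 ^+ m.+3)%R%:E * \sum_(i < K.+2) \sum_(l < m)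
            (err p (Num.min (r i) (g l.+1)) + err p (Num.min (r i) (g l))))%E.
have errc k : t <= k <= T -> (err ^~ k @ \oo --> 0)%E.
  move=> kT; rewrite -[X in _ --> X]adde0; apply: cvgeD => //; [exact: iphi|exact: iphi'].
have err0 p k : (0 <= err p k)%E.
  by apply: adde_ge0; apply: integral_ge0 => w _; rewrite lee_fin sqr_ge0.
have restc : (rest @ \oo --> 0)%E.
  rewrite -[X in _ --> X]adde0; apply: cvgeD => //.
    rewrite -[X in _ --> X](mule0 (48 * kappa * m%:R ^+ 2)%R%:E); apply: cvgeZl => //.
    rewrite -[X in _ --> X]adde0; apply: cvgeD; [by []|exact: vphi|exact: vphi'].
  rewrite -[X in _ --> X](mule0 (2 ^+ m.+3)%R%:E); apply: cvgeZl => //.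
  apply: (cvge_sum0 (f := fun i p => \sum_(l < m) (err p (Num.min (r i) (g l.+1))
    + err p (Num.min (r i) (g l))))%E) => i iK.
  apply: (cvge_sum0 (f := fun l p => (err p (Num.min (r i) (g l.+1))
    + err p (Num.min (r i) (g l))))%E) => l lm.
  have rg k : (k <= m)%N -> t <= Num.min (r i) (g k) <= T.
    move=> km; have /andP[h1 h2] := rT i iK.
    by rewrite le_min h1 tg ge_min h2.
  rewrite -[X in _ --> X]adde0; apply: cvgeD; first by [].
    by apply: errc; exact: rg.
  by apply: errc; apply: rg; exact: ltnW.
have [p hp] : exists p, (rest p <= eps%:E)%E.
  have := restc; move=> /fine_cvgP[+ /cvgrPdist_le/(_ _ eps0)].
  move=> [N1 _ h1] [N2 _ h2]; exists (maxn N1 N2).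
  have := h1 (maxn N1 N2) (leq_maxl _ _); have := h2 (maxn N1 N2) (leq_maxr _ _).
  rewrite /= sub0r normrN => h3 h4; rewrite -(fineK h4) lee_fin.
  exact: le_trans (ler_norm _) h3.
have [G [mG UG iG]] := transform_le Ff bm t0 tT del0 gT mE E01 hM hM'
  (step_elementary W j Ff t0 (sphi p)) (step_elementary W j Ff t0 (sphi' p)) r0 rS rT rK.
exists G; split; [exact: mG|by move=> i w iK; exact: UG|].
by apply: (le_trans iG); apply: leeD.
Qed.

End ito_sup.

(** * The difference of two solutions *)

Section euclidean_norm.
Context {R : realType}.
Implicit Types (m n : nat).

Lemma enorm_ge0 m n (A : 'M[R]_(m, n)) : 0 <= enorm A.
Proof. exact: sqrtr_ge0. Qed.

Lemma entry_le_enorm m n (A : 'M[R]_(m, n)) i j : `|A i j| <= enorm A.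
Proof.
rewrite /enorm -sqrtr_sqr ler_wsqrtr//.
rewrite (bigD1 i)//= (bigD1 j)//= -addrA lerDl addr_ge0//.
  by apply: sumr_ge0 => k _; exact: sqr_ge0.
by apply: sumr_ge0 => k _; apply: sumr_ge0 => l _; exact: sqr_ge0.
Qed.

Definition sqnorm n (v : 'cV[R]_n) : R := \sum_i v i 0 ^+ 2.

Lemma sqnorm_ge0 n (v : 'cV[R]_n) : 0 <= sqnorm v.
Proof. by apply: sumr_ge0 => i _; exact: sqr_ge0. Qed.

Lemma enormE n (v : 'cV[R]_n) : enorm v = Num.sqrt (sqnorm v).
Proof. by congr Num.sqrt; apply: eq_bigr => i _; rewrite big_ord1. Qed.

Lemma enorm_sqr n (v : 'cV[R]_n) : enorm v ^+ 2 = sqnorm v.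
Proof. by rewrite enormE sqr_sqrtr// sqnorm_ge0. Qed.

Lemma entry_le_norm n (v : 'cV[R]_n) i : `|v i 0| <= `|v|.
Proof.
have -> : `|v| = \big[Num.max/0]_ij `|v ij.1 ij.2| := mx_normrE v.
exact: (le_bigmax _ (fun ij => `|v ij.1 ij.2|) (i, 0)).
Qed.

Lemma norm_le n (v : 'cV[R]_n) r : 0 <= r -> (forall i, `|v i 0| <= r) -> `|v| <= r.
Proof.
move=> r0 h; have -> : `|v| = \big[Num.max/0]_ij `|v ij.1 ij.2| := mx_normrE v.
by apply: bigmax_le => // -[i j] _ /=; rewrite (ord1 j).
Qed.

(** The pathwise estimate runs in the max-norm, which is the norm of the normed module of column
    vectors, while the coefficients and the conclusion use the Euclidean norm. Passing between the
    two costs factors of the dimension only. *)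
Lemma norm_le_enorm n (v : 'cV[R]_n) : `|v| <= enorm v.
Proof. by apply: norm_le => [|i]; [exact: enorm_ge0|exact: entry_le_enorm]. Qed.

Lemma sqnorm_le n (v : 'cV[R]_n) : sqnorm v <= n%:R * `|v| ^+ 2.
Proof.
apply: (@le_trans _ _ (\sum_(i < n) `|v| ^+ 2)); last first.
  by rewrite sumr_const card_ord mulr_natl.
apply: ler_sum => i _.
by rewrite -[leLHS]real_normK ?num_real// lerXn2r ?nnegrE// entry_le_norm.
Qed.

Lemma enorm_le n (v : 'cV[R]_n) : enorm v <= n%:R * `|v|.
Proof.
rewrite -(@ler_pXn2r _ 2)// ?nnegrE ?enorm_ge0 ?mulr_ge0// enorm_sqr.
apply: le_trans (sqnorm_le v) _; rewrite exprMn ler_wpM2r ?sqr_ge0//.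
by rewrite -natrX ler_nat; case: n v => // n v; rewrite expnS leq_pmulr.
Qed.

End euclidean_norm.

Section lipschitz_composition.
Context {R : realType}.

Lemma within_continuous_lip (V V' : pseudoMetricNormedZmodType R) (a b C : R)
    (f : R -> V) (phi : V -> V') :
  (forall x y, `|phi x - phi y| <= C * `|x - y|) ->
  {within `[a, b], continuous f} -> {within `[a, b], continuous (fun s => phi (f s))}.
Proof.
move=> hC /within_continuousP cf; apply/within_continuousP => x xab e e0.
have C0 : 0 < `|C| + 1 by rewrite ltr_wpDl.
have [del del0 hdel] := cf x xab (e / (`|C| + 1)) (divr_gt0 e0 C0).
exists del => // y yab xy; apply: le_lt_trans (hC _ _) _.
have := hdel y yab xy; rewrite ltr_pdivlMr// => h.
apply: le_lt_trans h; rewrite mulrC; apply: ler_wpM2l => //.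
by rewrite (le_trans (ler_norm _))// lerDl.
Qed.

Lemma within_continuous_integrable (a b : R) (f : R -> R) :
  {within `[a, b], continuous f} ->
  (@lebesgue_measure R).-integrable `[a, b] (fun s => (f s)%:E).
Proof. by move=> cf; apply: continuous_compact_integrable => //; exact: segment_compact. Qed.

Lemma within_continuous_measurable (a b : R) (f : R -> R) :
  {within `[a, b], continuous f} -> measurable_fun `[a, b] f.
Proof.
by move=> /within_continuous_integrable/measurable_int/measurable_EFinP.
Qed.

Lemma bounded_integrable (a b C : R) (f : R -> R) : measurable_fun `[a, b] f ->
  (forall s, a <= s <= b -> `|f s| <= C) ->
  (@lebesgue_measure R).-integrable `[a, b] (fun s => (f s)%:E).
Proof.
move=> mf fC; apply: measurable_bounded_integrable => //.
  by apply: compact_finite_measure; exact: segment_compact.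
exists C; split; first exact: num_real.
by move=> x Cx s /=; rewrite in_itv/= => /fC /le_trans; apply; exact: ltW.
Qed.

Lemma continuous_coord (a b : R) n (f : R -> 'cV[R]_n) i :
  {within `[a, b], continuous f} -> {within `[a, b], continuous (fun s => f s i 0)}.
Proof.
apply: (@within_continuous_lip _ _ a b 1 f (fun v : 'cV[R]_n => v i 0)) => x y.
by rewrite mul1r; have := entry_le_norm (x - y) i; rewrite !mxE.
Qed.

End lipschitz_composition.

Section lebesgue_interval.
Context {R : realType}.
Local Notation mu := (@lebesgue_measure R).
Variables (t T : R) (f : R -> R).
Hypothesis fi : mu.-integrable `[t, T] (fun s => (f s)%:E).

Lemma integrable_subitv u v : t <= u -> v <= T ->
  mu.-integrable `[u, v] (fun s => (f s)%:E).
Proof.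
move=> tu vT; apply: integrableS fi => //.
by apply: subset_itvScc; rewrite bnd_simp.
Qed.

Lemma integrable_subitvoc u v : t <= u -> v <= T ->
  mu.-integrable `]u, v] (fun s => (f s)%:E).
Proof.
move=> tu vT; apply: integrableS (integrable_subitv tu vT) => //.
exact: subset_itv_oc_cc.
Qed.

Lemma Rintegral_itv_sub u v : t <= u -> u <= v -> v <= T ->
  \int[mu]_(s in `[t, v]) f s - \int[mu]_(s in `[t, u]) f s = \int[mu]_(s in `]u, v]) f s.
Proof.
move=> tu uv vT; apply: Rintegral_itvB; rewrite ?bnd_simp//.
exact: integrable_subitv.
Qed.

End lebesgue_interval.

Lemma sumr_const_ord (R : realType) (n : nat) (x : R) : \sum_(j < n) x = n%:R * x.
Proof. by rewrite sumr_const card_ord mulr_natl. Qed.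

(** * Energy of the control and comparison of two drifts *)

Section drift.
Context {R : realType} (n : nat).
Local Notation mu := (@lebesgue_measure R).
Variables (V : 'cV[R]_n -> 'M[R]_n) (b : 'cV[R]_n -> 'cV[R]_n) (Kb KV CV : R).
Hypotheses (Kb0 : 0 <= Kb) (KV0 : 0 <= KV).
Hypothesis b_lip : forall x y, enorm (b x - b y) <= Kb * enorm (x - y).
Hypothesis V_lip : forall x y, enorm (V x - V y) <= KV * enorm (x - y).
Hypothesis V_bnd : forall x, enorm (V x) <= CV.
Variables (t T rad : R) (q : R -> 'cV[R]_n).
Hypothesis mq : forall i, measurable_fun `[t, T] (fun s => q s i 0).
Hypothesis q_rad : forall s, t <= s <= T -> enorm (q s) <= rad.

Definition energy (k : R) : R := \int[mu]_(s in `[t, k]) (enorm (q s) ^+ 2).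

Lemma energy_integrable : mu.-integrable `[t, T] (fun s => (enorm (q s) ^+ 2)%:E).
Proof.
apply: (bounded_integrable (C := rad ^+ 2)).
  have -> : (fun s => enorm (q s) ^+ 2) = (fun s => \sum_i q s i 0 ^+ 2).
    by apply/funext => s; exact: enorm_sqr.
  by apply: measurable_sum => i; apply: measurable_funX; exact: mq.
move=> s sT; rewrite ger0_norm ?sqr_ge0// lerXn2r ?nnegrE ?enorm_ge0 ?q_rad//.
by rewrite (le_trans (enorm_ge0 _) (q_rad sT)).
Qed.

Let iq := energy_integrable.

Lemma energy_sub u v : t <= u -> u <= v -> v <= T ->
  energy v - energy u = \int[mu]_(s in `]u, v]) (enorm (q s) ^+ 2).
Proof. exact: Rintegral_itv_sub. Qed.

Lemma energy0 : energy t = 0.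
Proof. by rewrite /energy set_itv1 Rintegral_set1. Qed.

Lemma energy_nd u v : t <= u -> u <= v -> v <= T -> energy u <= energy v.
Proof.
move=> tu uv vT; rewrite -subr_ge0 energy_sub//.
by apply: Rintegral_ge0 => s _; exact: sqr_ge0.
Qed.

Let Rint_cst (c u v : R) : u <= v -> \int[mu]_(_ in `]u, v]) c = c * (v - u).
Proof.
move=> uv; rewrite Rintegral_cst//; congr (_ * _).
transitivity (fine (mu [set` `]u, v]])); first by [].
rewrite lebesgue_measure_itv/= lte_fin.
by move: uv; rewrite le_eqVlt => /predU1P[->|->]; rewrite ?ltxx ?subrr.
Qed.

Let icst (c u v : R) : mu.-integrable `]u, v] (fun=> c%:E).
Proof.
have : mu.-integrable `[u, v] (fun=> c%:E).
  by apply: (bounded_integrable (C := `|c|)) => //; exact: measurable_cst.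
by apply: integrableS => //; exact: subset_itv_oc_cc.
Qed.

Lemma energy_lip u v : t <= u -> u <= v -> v <= T ->
  energy v - energy u <= rad ^+ 2 * (v - u).
Proof.
move=> tu uv vT; rewrite energy_sub// -Rint_cst//; apply: le_Rintegral => //.
- exact: (integrable_subitvoc iq).
- exact: icst.
move=> s /=; rewrite in_itv/= => /andP[us sv].
have sT : t <= s <= T by rewrite (le_trans tu (ltW us)) (le_trans sv).
rewrite lerXn2r ?nnegrE ?enorm_ge0 ?q_rad//.
by rewrite (le_trans (enorm_ge0 _) (q_rad sT)).
Qed.

Definition drift (X : R -> 'cV[R]_n) i s : R := (b (X s) - V (X s) *m q s) i 0.

(** The [b] part is continuous along the path. The [V] part is a measurable bounded function, since
    [V] and, at a fixed radius, [q] are bounded; this bound enters no estimate. *)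
Lemma drift_integrable X i : {within `[t, T], continuous X} ->
  mu.-integrable `[t, T] (fun s => (drift X i s)%:E).
Proof.
move=> cX.
have ib : mu.-integrable `[t, T] (fun s => (b (X s) i 0)%:E).
  apply: within_continuous_integrable.
  apply: (@within_continuous_lip _ _ _ t T (Kb * n%:R) X (fun v => b v i 0)) cX => x y.
  have := entry_le_enorm (b x - b y) i 0; rewrite !mxE => /le_trans; apply.
  apply: (le_trans (b_lip _ _)); rewrite -mulrA ler_wpM2l//; exact: enorm_le.
have iV : mu.-integrable `[t, T] (fun s => ((V (X s) *m q s) i 0)%:E).
  apply: (bounded_integrable (C := n%:R * (CV * rad))).
    have -> : (fun s => (V (X s) *m q s) i 0) = (fun s => \sum_j V (X s) i j * q s j 0).
      by apply/funext => s; rewrite mxE.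
    apply: measurable_sum => j; apply: measurable_funM; last exact: mq.
    apply: within_continuous_measurable.
    apply: (@within_continuous_lip _ _ _ t T (KV * n%:R) X (fun v => V v i j)) cX => x y.
    have := entry_le_enorm (V x - V y) i j; rewrite !mxE => /le_trans; apply.
    apply: (le_trans (V_lip _ _)); rewrite -mulrA ler_wpM2l//; exact: enorm_le.
  move=> s sT; rewrite mxE; apply: le_trans (ler_norm_sum _ _ _) _.
  rewrite -sumr_const_ord; apply: ler_sum => j _.
  rewrite normrM ler_pM//; first exact: le_trans (entry_le_enorm _ _ _) (V_bnd _).
  exact: le_trans (entry_le_enorm _ _ _) (q_rad sT).
apply: eq_integrable (integrableB _ ib iV) => // s _.
by rewrite /drift !mxE.
Qed.

(** The second term is what remains of [n^2 KV |q|] once [|q|^2 / 64] has been split off: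
    [x y <= 16 x^2 + y^2 / 64]. The powers of [n] come from [enorm_le] and from the matrix product.
    The radius is absent. *)
Definition drift_cst : R := Kb * n%:R + 16 * (n%:R ^+ 2 * KV) ^+ 2.

Lemma drift_cst_ge0 : 0 <= drift_cst.
Proof. by rewrite addr_ge0 ?mulr_ge0 ?sqr_ge0. Qed.

Lemma drift_sub_le X Y i s d : `|X s - Y s| <= d ->
  `|drift X i s - drift Y i s| <= d * (drift_cst + 64^-1 * enorm (q s) ^+ 2).
Proof.
move=> hd; have d0 : 0 <= d by exact: le_trans hd.
have e0 := enorm_ge0 (q s).
have hD : enorm (X s - Y s) <= n%:R * d.
  by apply: le_trans (enorm_le _) _; exact: ler_wpM2l.
have hb : `|b (X s) i 0 - b (Y s) i 0| <= Kb * (n%:R * d).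
  have := entry_le_enorm (b (X s) - b (Y s)) i 0; rewrite !mxE => /le_trans; apply.
  by apply: (le_trans (b_lip _ _)); exact: ler_wpM2l.
have hV : `|((V (X s) - V (Y s)) *m q s) i 0| <= n%:R * (KV * (n%:R * d) * enorm (q s)).
  rewrite mxE; apply: le_trans (ler_norm_sum _ _ _) _.
  rewrite -sumr_const_ord; apply: ler_sum => j _.
  rewrite normrM ler_pM//; last exact: entry_le_enorm.
  apply: le_trans (entry_le_enorm _ _ _) _; apply: (le_trans (V_lip _ _)).
  exact: ler_wpM2l.
have -> : drift X i s - drift Y i s =
    b (X s) i 0 - b (Y s) i 0 - ((V (X s) - V (Y s)) *m q s) i 0.
  rewrite /drift mulmxBl !mxE; ring.
apply: le_trans (ler_normB _ _) _; rewrite /drift_cst.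
(* AM-GM; a weight below 1/8 is what [E] can absorb in [pathwise_bound] *)
have h : n%:R ^+ 2 * KV * enorm (q s)
    <= 16 * (n%:R ^+ 2 * KV) ^+ 2 + 64^-1 * enorm (q s) ^+ 2.
  have := sqr_ge0 (4 * (n%:R ^+ 2 * KV) - 8^-1 * enorm (q s)).
  by move: (n%:R ^+ 2 * KV) (enorm (q s)) => x y; lra.
have := ler_wpM2l d0 h; move: hb hV.
move: (`|_ - b (Y s) i 0|) (`|(_ *m _) i 0|) (enorm (q s)) (n%:R : R) => x y e N; lra.
Qed.

Lemma drift_bound X Y i u v d :
  {within `[t, T], continuous X} -> {within `[t, T], continuous Y} ->
  t <= u -> u <= v -> v <= T -> (forall s, u <= s <= v -> `|X s - Y s| <= d) ->
  `|\int[mu]_(s in `[t, v]) drift X i s - \int[mu]_(s in `[t, u]) drift X i s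
    - (\int[mu]_(s in `[t, v]) drift Y i s - \int[mu]_(s in `[t, u]) drift Y i s)|
  <= d * (drift_cst * (v - u) + 64^-1 * (energy v - energy u)).
Proof.
move=> cX cY tu uv vT hd.
have iX := drift_integrable i cX; have iY := drift_integrable i cY.
rewrite (Rintegral_itv_sub iX tu uv vT) (Rintegral_itv_sub iY tu uv vT).
have iX' := integrable_subitvoc iX tu vT; have iY' := integrable_subitvoc iY tu vT.
have iq' := integrable_subitvoc iq tu vT.
have iXY : mu.-integrable `]u, v] (fun s => (drift X i s - drift Y i s)%:E).
  by apply: (integrableB _ iX' iY').
have i64 : mu.-integrable `]u, v] (fun s => (64^-1 * enorm (q s) ^+ 2)%:E).
  by apply: (integrableZl _ 64^-1 iq').
have icq : mu.-integrable `]u, v] (fun s => (drift_cst + 64^-1 * enorm (q s) ^+ 2)%:E).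
  by apply: (integrableD _ (icst drift_cst u v) i64).
have ibnd : mu.-integrable `]u, v]
    (fun s => (d * (drift_cst + 64^-1 * enorm (q s) ^+ 2))%:E).
  by apply: (integrableZl _ d icq).
rewrite -RintegralB//; apply: le_trans (le_normr_Rintegral _ iXY) _ => //.
apply: (@le_trans _ _ (\int[mu]_(s in `]u, v]) (d * (drift_cst + 64^-1 * enorm (q s) ^+ 2)))).
  apply: le_Rintegral => //; first exact: integrable_norm iXY.
  move=> s /=; rewrite in_itv/= => /andP[us sv].
  by apply: drift_sub_le; apply: hd; rewrite ltW.
rewrite (RintegralZl _ _ icq)//.
rewrite (RintegralD _ (icst drift_cst u v) i64)//.
rewrite (RintegralZl _ _ iq')//.
by rewrite Rint_cst// energy_sub.
Qed.

End drift.

Lemma within_continuous_sum (R : realType) (a b : R) (n : nat) (f : 'I_n -> R -> R) :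
  (forall i, {within `[a, b], continuous (f i)}) ->
  {within `[a, b], continuous (fun s => \sum_i f i s)}.
Proof.
move=> h x; apply: (@cvg_big _ _ +%R) => //; last by move=> i _; exact: (h i x).
exact: add_continuous.
Qed.

(** The recursion is implicit: the sum bounding [u l] contains [u l] itself. The condition
    [p <= 1/2] allows solving for it. *)
Lemma gronwall_discrete (R : realType) (a p : R) (u : nat -> R) (m : nat) :
  0 <= a -> 0 <= p <= 2^-1 -> (forall l, (l <= m)%N -> 0 <= u l) ->
  (forall l, (l <= m)%N -> u l <= a + p * \sum_(i < l) u i.+1) ->
  forall l, (l <= m)%N -> u l <= (1 + 2 * p) ^+ l * a.
Proof.
move=> a0 /andP[p0 p1] u0 hu.
pose v l := a + p * \sum_(i < l) u i.+1.
suff h l : (l <= m)%N -> v l <= (1 + 2 * p) ^+ l * a.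
  by move=> l lm; apply: le_trans (hu l lm) (h l lm).
elim: l => [_|l IH lm]; first by rewrite /v big_ord0 mulr0 addr0 expr0 mul1r.
have {}IH := IH (ltnW lm).
have hv : v l.+1 = v l + p * u l.+1 by rewrite /v big_ord_recr/= mulrDr addrA.
have h1 : u l.+1 <= v l.+1 := hu _ lm.
have h2 : v l.+1 <= (1 + 2 * p) * v l.
  have v0 : 0 <= v l.+1 by apply: addr_ge0 => //; apply: mulr_ge0 => //;
    apply: sumr_ge0 => i _; apply: u0; exact: leq_trans lm.
  have : p * u l.+1 <= p * v l.+1 by exact: ler_wpM2l.
  (* One has [(1 - p) v (l+1) <= v l] and [(1 - p) (1 + 2 p) = 1 + p (1 - 2 p) >= 1]. *)
  have : 0 <= p * (1 - 2 * p) * v l.+1.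
    by rewrite !mulr_ge0// subr_ge0; lra.
  move: hv; move: (v l.+1) (v l) (p * u l.+1) v0 => y x z y0 -> h4 h5.
  have : 0 <= (1 + 2 * p) * (x - (1 - p) * (x + z)) by apply: mulr_ge0; lra.
  lra.
rewrite exprS -mulrA; apply: le_trans h2 _; apply: ler_wpM2l => //; lra.
Qed.

Section energy_adapted.
Context d (Omega : measurableType d) (R : realType).
Variables (T : R) (F : R -> set (set Omega)) (n : nat).
Hypothesis Ff : filtration T F.
Variables (rad : R) (q : R -> Omega -> 'cV[R]_n).
Hypothesis hq : control F T rad q.

Lemma energy_measurable_wrt t k : 0 <= t -> t <= k -> k <= T ->
  measurable_wrt (F k) (fun w => energy t (fun s => q s w) k).
Proof.
move=> t0 tk kT.
have k0T : 0 <= k <= T by rewrite kT (le_trans t0).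
have jq : @joint _ (g_sigma_algebraType (F k)) R t k (fun s w => enorm (q s w) ^+ 2).
  have -> : (fun s w => enorm (q s w) ^+ 2) = (fun s w => \sum_i q s w i 0 ^+ 2).
    by apply/funext => s; apply/funext => w; exact: enorm_sqr.
  apply: measurable_sum => i; apply: measurable_funX.
  have := (hq.1 i) k k0T; apply: measurable_funS.
    exact: measurableX.
  move=> z [/= + _]; rewrite in_itv/= => /andP[tz zk]; split => //=.
  by rewrite in_itv/= zk (le_trans t0).
have := joint_integral jq; move=> /(_ (fun s w => sqr_ge0 _)).
by move=> /(measurableT_comp (fine_measurable measurableT)).
Qed.

Lemma control_measurable t w i : 0 <= t -> t <= T ->
  measurable_fun `[t, T] (fun s => q s w i 0).
Proof.
move=> t0 tT; apply: (joint_section w (f := fun s w => q s w i 0)).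
exact: (progressive_joint Ff (lexx 0) t0 tT (hq.1 i)).
Qed.

Lemma control_bounded t w s : 0 <= t -> t <= s <= T -> enorm (q s w) <= rad.
Proof. by move=> t0 /andP[ts sT]; apply: hq.2; rewrite sT (le_trans t0). Qed.

End energy_adapted.

Section ito_start.
Context d (Omega : measurableType d) (R : realType) (P : probability Omega R).
Variables (T : R) (F : R -> set (set Omega)) (n : nat).
Variables (W : R -> Omega -> 'cV[R]_n) (j : 'I_n).
Hypotheses (Ff : filtration T F) (bm : brownian_motion P T F W).
Variable t : R.
Hypotheses (t0 : 0 <= t) (tT : t <= T).

(** [ito_integral] does not prescribe the value at the initial time. All step integrals vanish
    there, and hence so does their L2-limit, almost surely. *)
Lemma ito_start h M : ito_integral P F (fun k w => W k w j 0) t T h M ->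
  {ae P, forall w, M t w = 0}.
Proof.
move=> [_ _ _ mM [phi [sphi _ iphi]]].
have tt : t <= t <= T by rewrite lexx.
have iM0 : (\int[P]_w (M t w ^+ 2)%:E = 0)%E.
  have := iphi t tt.
  have -> : (fun p => \int[P]_w ((step_integral (phi p) (fun k w => W k w j 0) t w
      - M t w) ^+ 2)%:E)%E = fun=> (\int[P]_w (M t w ^+ 2)%:E)%E.
    apply/funext => p; apply: eq_integral => w _; congr EFin.
    by rewrite (elementary_start (step_elementary W j Ff t0 (sphi p))) sub0r sqrrN.
  by move=> /(cvg_lim (@ereal_hausdorff R)) <-; rewrite lim_cst.
have mM2 : measurable_fun setT (fun w => (M t w ^+ 2)%:E).
  by apply/measurable_EFinP; apply: measurable_funX; exact: mM.
have : ae_eq P setT (fun w => (M t w ^+ 2)%:E) (cst 0%E).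
  apply/ae_eq_integral_abs => //.
  rewrite -[RHS]iM0; apply: eq_integral => w _ /=.
  by rewrite ger0_norm// sqr_ge0.
apply: filterS => w /= /(_ I)[] /eqP; rewrite sqrf_eq0 => /eqP //.
Qed.

End ito_start.

(** The pathwise constant [10 exp(6 c T)] is squared; the factor 2 comes from the square of a sum of
    two terms, and [n] from passing to the Euclidean norm. *)
Definition sup_cst (R : realType) (n : nat) (Kb KV T : R) : R :=
  2 * n%:R * (10 * expR (6 * drift_cst n Kb KV * T)) ^+ 2.

(** The Gronwall rate: [2 ^+ n] from summing over the Brownian coordinates, [n ^+ 2] pairs of
    indices, each costing [48 * normal_var R] by the maximal inequality, and [2 * Ks ^+ 2] from
    [phi_le]. *)
Definition growth_cst (R : realType) (n : nat) (Kb KV Ks T : R) : R :=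
  sup_cst n Kb KV T * 2 ^+ n * (n%:R ^+ 2 * (48 * normal_var R)) * (2 * Ks ^+ 2).

(** * Second moment recursion for the weighted difference of two solutions *)

Section difference_estimate.
Context d (Omega : measurableType d) (R : realType) (P : probability Omega R).
Variables (T : R) (F : R -> set (set Omega)) (n : nat).
Variable W : R -> Omega -> 'cV[R]_n.
Hypotheses (Ff : filtration T F) (bm : brownian_motion P T F W).
Variables (V sigma : 'cV[R]_n -> 'M[R]_n) (b : 'cV[R]_n -> 'cV[R]_n) (Kb KV CV Ks : R).
Hypotheses (Kb0 : 0 <= Kb) (KV0 : 0 <= KV).
Hypothesis b_lip : forall x y, enorm (b x - b y) <= Kb * enorm (x - y).
Hypothesis V_lip : forall x y, enorm (V x - V y) <= KV * enorm (x - y).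
Hypothesis V_bnd : forall x, enorm (V x) <= CV.
Hypothesis s_lip : forall x y, enorm (sigma x - sigma y) <= Ks * enorm (x - y).
Variables (rad : R) (q : R -> Omega -> 'cV[R]_n).
Hypothesis hq : control F T rad q.
Variables (x xb : 'cV[R]_n) (t : R).
Hypotheses (t0 : 0 <= t) (tT : t <= T).
Variables (X Xb : R -> Omega -> 'cV[R]_n) (M Mb : 'I_n -> 'I_n -> R -> Omega -> R).
Hypotheses (cX : continuous_paths t T X) (cXb : continuous_paths t T Xb).
Hypotheses (aX : adapted F t T X) (aXb : adapted F t T Xb).
Local Notation mu := (@lebesgue_measure R).
Local Notation kappa := (normal_var R).
Hypothesis hM : forall i j, ito_integral P F (fun k w => W k w j 0) t T
  (fun s w => sigma (X s w) i j) (M i j).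
Hypothesis hMb : forall i j, ito_integral P F (fun k w => W k w j 0) t T
  (fun s w => sigma (Xb s w) i j) (Mb i j).
Hypothesis X_eq : {ae P, forall w, forall k, t <= k <= T -> forall i,
  X k w i 0 = x i 0
    + \int[mu]_(s in `[t, k]) (b (X s w) - V (X s w) *m q s w) i 0
    + \sum_j M i j k w}.
Hypothesis Xb_eq : {ae P, forall w, forall k, t <= k <= T -> forall i,
  Xb k w i 0 = xb i 0
    + \int[mu]_(s in `[t, k]) (b (Xb s w) - V (Xb s w) *m q s w) i 0
    + \sum_j Mb i j k w}.

Let c := drift_cst n Kb KV.
Let A (k : R) (w : Omega) : R := energy t (fun s => q s w) k.
Let E (k : R) (w : Omega) : R := expR (- (2^-1 * A k w)).
Let D (k : R) (w : Omega) : 'cV[R]_n := X k w - Xb k w.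
Let U (k : R) (w : Omega) : R := E k w ^+ 2 * sqnorm (D k w).

Variables (del : R) (m : nat).
Hypotheses (del0 : 0 < del) (gT : grid t del m = T).
Hypothesis small : drift_cst n Kb KV * del + rad ^+ 2 * del <= 2^-1.
Local Notation g := (grid t del).

Let mq w i : measurable_fun `[t, T] (fun s => q s w i 0).
Proof. exact: (control_measurable Ff hq). Qed.

Let q_rad w s : t <= s <= T -> enorm (q s w) <= rad.
Proof. exact: (control_bounded hq). Qed.

Let tg l : t <= g l.
Proof. by rewrite -{1}(grid0 t del); apply: le_grid => //; exact: ltW. Qed.

Let glT l : (l <= m)%N -> g l <= T.
Proof. by move=> lm; rewrite -gT; apply: le_grid => //; exact: ltW. Qed.

Let E_gt0 k w : 0 < E k w. Proof. exact: expR_gt0. Qed.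

Let A_ge0 k w : 0 <= A k w.
Proof. by apply: Rintegral_ge0 => s _; exact: sqr_ge0. Qed.

Let E_01 k w : 0 <= E k w <= 1.
Proof.
rewrite ltW//= /E -[leRHS]expR0 ler_expR oppr_le0 mulr_ge0//; exact: A_ge0.
Qed.

Let E_meas k : t <= k <= T -> measurable_wrt (F k) (E k).
Proof.
move=> /andP[tk kT]; have mA := energy_measurable_wrt hq t0 tk kT.
apply: (measurableT_comp (f := expR)) => //.
by apply: measurable_funN; apply: measurable_funM => //; exact: measurable_cst.
Qed.

Let U_ge0 k w : 0 <= U k w.
Proof. by rewrite mulr_ge0 ?sqr_ge0 ?sqnorm_ge0. Qed.

Let U_meas k : t <= k <= T -> measurable_fun setT (U k).
Proof.
move=> kT; have k0T : 0 <= k <= T by have /andP[h ->] := kT; rewrite (le_trans t0).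
apply: measurable_funM.
  by apply: measurable_funX; apply: (measurable_wrt_fun Ff k0T); exact: E_meas.
apply: measurable_sum => i; apply: measurable_funX.
rewrite (_ : (fun w => D k w i 0) = (fun w => X k w i 0 - Xb k w i 0)); last first.
  by apply/funext => w; rewrite !mxE.
by apply: measurable_funB; apply: (measurable_wrt_fun Ff k0T); [exact: aX|exact: aXb].
Qed.

Let U_cont w : {within `[t, T], continuous (fun k => U k w)}.
Proof.
have cA : {within `[t, T], continuous (fun k => A k w)}.
  apply: parameterized_integral_continuous => //.
  exact: (energy_integrable (mq w) (q_rad w)).
have cD i : {within `[t, T], continuous (fun k => D k w i 0)}.
  rewrite (_ : (fun k => D k w i 0) = (fun k => X k w i 0 - Xb k w i 0)); last first.
    by apply/funext => k; rewrite !mxE.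
  have cXi := @continuous_coord R t T n (X^~ w) i (@cX w).
  have cXbi := @continuous_coord R t T n (Xb^~ w) i (@cXb w).
  move=> k; apply: cvgB; first by apply: cXi.
  by apply: cXbi.
have cA2 : {within `[t, T], continuous (fun k => - (2^-1 * A k w))}.
  apply: (@within_continuous_lip R _ _ t T 1 (A ^~ w) (fun a => - (2^-1 * a))) cA => y z.
  rewrite -opprD normrN -mulrBr normrM ler_wpM2r// ger0_norm//; lra.
have cE : {within `[t, T], continuous (fun k => E k w)}.
  move=> k; apply: (cvg_comp (fun k => - (2^-1 * A k w)) expR); first by apply: cA2.
  exact: continuous_expR.
have cN : {within `[t, T], continuous (fun k => sqnorm (D k w))}.
  apply: within_continuous_sum => i k.
  exact: (@cvgM R _ _ _ _ _ _ _ (cD i k) (cD i k)).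
move=> k; apply: cvgM; last exact: (cN k).
exact: (@cvgM R _ _ _ _ _ _ _ (cE k) (cE k)).
Qed.

Let U_cont_sub l w : (l <= m)%N -> {within `[t, g l], continuous (fun k => U k w)}.
Proof.
move=> lm; apply: continuous_subspaceW (@U_cont w).
by apply: subset_itvScc; rewrite bnd_simp// glT.
Qed.

Let S l w := path_sup t (g l) U w.

Let S_meas l : (l <= m)%N -> measurable_fun setT (S l).
Proof.
move=> lm; apply: measurable_path_sup => //.
  by move=> w; exact: U_cont_sub.
by move=> k /andP[tk kl]; apply: U_meas; rewrite tk (le_trans kl)// glT.
Qed.

Let U_le_S l w k : (l <= m)%N -> t <= k <= g l -> U k w <= S l w.
Proof. by move=> lm kl; apply: le_path_sup => // w'; exact: U_cont_sub. Qed.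

Let S_ge0 l w : (l <= m)%N -> 0 <= S l w.
Proof. by move=> lm; apply: le_trans (U_le_S w lm (k := t) _); rewrite ?lexx ?tg. Qed.

(** With only [l] cells the transform stops at time [g l], so its supremum over all of [[t, T]]
    involves the integrands up to [g l] alone. This gives the moment recursion its causal form. *)
Let Y l i j k w := ito_transform t del l (fun l' w => E (g l') w) (M i j) (Mb i j) k w.
Let G l i j w := path_sup t T (fun k w => Y l i j k w ^+ 2) w.

Let mE l l' : (l <= m)%N -> (l' < l)%N -> measurable_wrt (F (g l')) (E (g l')).
Proof.
by move=> lm ll; apply: E_meas; rewrite tg glT// (leq_trans (ltnW ll)).
Qed.

Let Y_cont l i j w : (l <= m)%N -> {within `[t, T], continuous (fun k => Y l i j k w ^+ 2)}.
Proof.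
move=> lm; exact: (@ito_transform_continuous _ _ _ _ _ _ _ _ _ _ _ l (fun l' w => E (g l') w) del0 (glT lm) _ _ _ _ (hM i j) (hMb i j) w).
Qed.

Let G_meas l i j : (l <= m)%N -> measurable_fun setT (G l i j).
Proof.
move=> lm; apply: measurable_path_sup => //; first by move=> w; exact: Y_cont.
move=> k kT; apply: measurable_funX.
exact: (ito_transform_measurable Ff t0 del0 (glT lm) (fun l' => mE lm (l' := l')) (hM i j) (hMb i j)).
Qed.

Let Y_le_G l i j w k : (l <= m)%N -> t <= k <= T -> Y l i j k w ^+ 2 <= G l i j w.
Proof.
move=> lm kT; apply: (le_path_sup (U := fun k w => Y l i j k w ^+ 2)) => //.
by move=> w'; exact: Y_cont.
Qed.

Let G_ge0 l i j w : (l <= m)%N -> 0 <= G l i j w.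
Proof.
by move=> lm; apply: le_trans (Y_le_G i j w (k := t) lm _); rewrite ?sqr_ge0 ?lexx.
Qed.

Let C := 10 * expR (6 * c * T).
Let a0 := sup_cst n Kb KV T.
Let b0 := a0 * 2 ^+ n.

(** Almost every path satisfies both equations and starts its martingale parts at 0, and for it
    [pathwise_bound] applies with [l] cells. The bound on [N] is the root of a sum of the maximal
    functions [G]; squaring gives a linear inequality ready for expectation. *)
Let ae_bound l : (l <= m)%N ->
  {ae P, forall w, S l w <= a0 * enorm (x - xb) ^+ 2 + b0 * \sum_i \sum_j G l i j w}.
Proof.
move=> lm.
have M0 : {ae P, forall w, forall i j, M i j t w = 0}.
  by apply: filter_forall => i; apply: filter_forall => j; exact: (ito_start Ff t0 tT (hM i j)).
have Mb0 : {ae P, forall w, forall i j, Mb i j t w = 0}.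
  by apply: filter_forall => i; apply: filter_forall => j; exact: (ito_start Ff t0 tT (hMb i j)).
have {M0 Mb0} MM0 : {ae P, forall w, forall i j, M i j t w = 0 /\ Mb i j t w = 0}.
  by move: M0 Mb0; apply: filterS2 => w h h' i j.
move: MM0 X_eq Xb_eq; apply: filterS3 => w MM0 Xeq Xbeq.
set Q := \sum_i _.
have Q0 : 0 <= Q by do 2! (apply: sumr_ge0 => ? _); exact: G_ge0.
apply: path_sup_le => //; first by move=> w'; exact: U_cont_sub.
pose Mv k : 'cV[R]_n := \col_i \sum_j (M i j k w - Mb i j k w).
have tt : t <= t <= T by rewrite lexx.
have hD k : t <= k <= T -> forall i, D k w i 0 = (x - xb) i 0
    + (\int[mu]_(s in `[t, k]) drift V b (fun s => q s w) (X ^~ w) i s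
     - \int[mu]_(s in `[t, k]) drift V b (fun s => q s w) (Xb ^~ w) i s)
    + Mv k i 0.
  have alg (a a' I I' s s' : R) : a + I + s - (a' + I' + s') = a - a' + (I - I') + (s - s').
    by ring.
  move=> kT i; have -> : D k w i 0 = X k w i 0 - Xb k w i 0 by rewrite !mxE.
  rewrite (Xeq k kT i) (Xbeq k kT i) alg [(x - xb) i 0]mxE [(- xb) i 0]mxE.
  by rewrite [Mv k i 0]mxE sumrB.
(* The initial values are read off the equations at time [t], where the time integrals and, by
   [ito_start], the martingale parts vanish. *)
have Dt : D t w = x - xb.
  apply/colP => i; rewrite hD// set_itv1 !Rintegral_set1 subrr addr0.
  by rewrite !mxE big1 ?addr0// => j _; have [-> ->] := MM0 i j; rewrite subrr.
have hA0 : A t w = 0 by exact: energy0.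
have hnd u v : t <= u -> u <= v -> v <= g l -> A u w <= A v w.
  by move=> tu uv vl; apply: (energy_nd (mq w) (@q_rad w)) => //; exact: le_trans (glT lm).
have hlip u v : t <= u -> u <= v -> v <= g l -> A v w - A u w <= rad ^+ 2 * (v - u).
  by move=> tu uv vl; apply: (energy_lip (mq w) (@q_rad w)) => //; exact: le_trans (glT lm).
have cD : {within `[t, T], continuous (fun s => D s w)}.
  by move=> s; apply: cvgB; [apply: cX|apply: cXb].
have hDb : exists d0, forall s, t <= s <= g l -> `|D s w| <= d0.
  have cnD : {within `[t, T], continuous (fun s => `|D s w|)}.
    apply: (@within_continuous_lip R _ _ t T 1 (D ^~ w) (fun v => `|v|)) cD => y z.
    by rewrite mul1r; exact: ler_dist_dist.
  have [r _ hr] := EVT_max tT cnD; exists `|D r w| => s /andP[ts sl].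
  by apply: hr; rewrite in_itv/= ts (le_trans sl)// glT.
have hDe u v d' : t <= u -> u <= v -> v <= g l ->
    (forall s, u <= s <= v -> `|D s w| <= d') ->
    `|D v w - D u w - (Mv v - Mv u)| <= d' * (c * (v - u) + 64^-1 * (A v w - A u w)).
  move=> tu uv vl hd; have vT : v <= T by exact: le_trans (glT lm).
  have uT : t <= u <= T by rewrite tu (le_trans uv).
  have vT' : t <= v <= T by rewrite vT (le_trans tu).
  have bound i := @drift_bound R n V b Kb KV CV Kb0 KV0 b_lip V_lip V_bnd t T rad
    (fun s => q s w) (mq w) (@q_rad w) (X ^~ w) (Xb ^~ w) i u v d' (@cX w) (@cXb w)
    tu uv vT hd.
  apply: norm_le.
    apply: mulr_ge0.
      have huu : u <= u <= v by rewrite lexx.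
      exact: le_trans (normr_ge0 _) (hd u huu).
    apply: addr_ge0; first by apply: mulr_ge0; [exact: drift_cst_ge0|rewrite subr_ge0].
    by apply: mulr_ge0 => //; rewrite subr_ge0; exact: hnd.
  move=> i1; apply: le_trans (bound i1).
  have := hD v vT' i1; have := hD u uT i1.
  rewrite [(D v w - D u w - (Mv v - Mv u)) i1 0]mxE [(D v w - D u w) i1 0]mxE.
  rewrite [(- (Mv v - Mv u)) i1 0]mxE [(Mv v - Mv u) i1 0]mxE.
  rewrite [(- D u w) i1 0]mxE [(- Mv u) i1 0]mxE.
  have alg (a p1 p2 p1' p2' s s' : R) : a + (p1 - p2) + s - (a + (p1' - p2') + s') - (s - s')
      = p1 - p1' - (p2 - p2') by ring.
  by move=> -> ->; rewrite alg; exact: lexx.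
(* Coordinate [i2] of the vector transform is the sum over [j] of the scalar transforms [Y l i2 j].
   Its square is bounded by [sqr_sum_le], and one row of the [G] by the whole sum. *)
have hN s : t <= s <= g l ->
    `|grid_transform t del l (fun l' => E (g l') w) Mv s| <= Num.sqrt (2 ^+ n * Q).
  move=> /andP[ts sl]; have sT : t <= s <= T by rewrite ts (le_trans sl)// glT.
  apply: norm_le => [|i2]; first exact: sqrtr_ge0.
  have -> : grid_transform t del l (fun l' => E (g l') w) Mv s i2 0 = \sum_j Y l i2 j s w.
    rewrite /grid_transform summxE /Y /ito_transform /transform exchange_big/=.
    apply: eq_bigr => l' _; rewrite -mulr_sumr !mxE; congr (_ * _).
    by rewrite -sumrB.
  rewrite -sqrtr_sqr; apply: ler_wsqrtr; apply: le_trans (sqr_sum_le _) _.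
  apply: ler_wpM2l; first exact: exprn_ge0.
  apply: (@le_trans _ _ (\sum_j G l i2 j w)).
    by apply: ler_sum => j1 _; exact: Y_le_G.
  rewrite /Q [leRHS](bigD1 i2)//= lerDl; do 2! (apply: sumr_ge0 => ? _).
  exact: G_ge0.
have c0 : 0 <= c by exact: drift_cst_ge0.
move=> k kl.
have := @pathwise_bound R 'cV[R]_n t del c rad l (fun k => A k w) (fun k => D k w) Mv
  (Num.sqrt (2 ^+ n * Q)) del0 c0 small hA0 hnd hlip hDb hDe hN k kl.
rewrite Dt -/(E k w); set z := `|x - xb|; set e := E k w => hE.
have e0 : 0 <= e * `|D k w| by rewrite mulr_ge0// ltW// /e E_gt0.
have CC : 10 * expR (6 * c * (l%:R * del)) <= C.
  rewrite /C ler_pM2l// ler_expR ler_wpM2l//; first by rewrite mulr_ge0.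
  have := glT lm; rewrite /grid; have := t0; lra.
have r0 := sqrtr_ge0 (2 ^+ n * Q).
have z0 : 0 <= z by exact: normr_ge0.
have {CC} hE2 : e * `|D k w| <= C * (z + Num.sqrt (2 ^+ n * Q)).
  by apply: (le_trans hE); apply: ler_wpM2r => //; exact: addr_ge0.
have hsq : (e * `|D k w|) ^+ 2 <= 2 * C ^+ 2 * (z ^+ 2 + 2 ^+ n * Q).
  apply: (@le_trans _ _ ((C * (z + Num.sqrt (2 ^+ n * Q))) ^+ 2)).
    by rewrite lerXn2r// nnegrE//; exact: le_trans hE2.
  have : Num.sqrt (2 ^+ n * Q) ^+ 2 = 2 ^+ n * Q.
    by rewrite sqr_sqrtr// mulr_ge0// exprn_ge0.
  move: (Num.sqrt _) => r <-.
  rewrite exprMn [2 * C ^+ 2]mulrC -(mulrA (C ^+ 2)) ler_wpM2l ?sqr_ge0//.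
  have := sqr_ge0 (z - r); lra.
have zx : z ^+ 2 <= enorm (x - xb) ^+ 2.
  by rewrite lerXn2r ?nnegrE ?enorm_ge0//; exact: norm_le_enorm.
have hU : U k w <= n%:R * (e * `|D k w|) ^+ 2.
  rewrite /U -/e exprMn mulrCA; apply: ler_wpM2l; [exact: sqr_ge0|exact: sqnorm_le].
apply: (le_trans hU); rewrite /b0 /a0 /sup_cst -/C.
have n0 : 0 <= n%:R :> R by [].
have C2 : 0 <= C ^+ 2 by exact: sqr_ge0.
apply: (@le_trans _ _ (n%:R * (2 * C ^+ 2 * (enorm (x - xb) ^+ 2 + 2 ^+ n * Q)))).
  apply: ler_wpM2l => //; apply: (le_trans hsq); apply: ler_wpM2l; first by rewrite mulr_ge0.
  by rewrite lerD2r.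
rewrite le_eqVlt; apply/orP; left; apply/eqP; ring.
Qed.

Let phi l i j s w :=
  (weight t del l (fun l' w => E (g l') w) s w * (sigma (X s w) i j - sigma (Xb s w) i j)) ^+ 2.

Let h_joint i j : joint t T (fun s w => sigma (X s w) i j).
Proof. by have [p _ _ _ _] := hM i j; exact: progressive_joint Ff t0 _ tT p. Qed.

Let hb_joint i j : joint t T (fun s w => sigma (Xb s w) i j).
Proof. by have [p _ _ _ _] := hMb i j; exact: progressive_joint Ff t0 _ tT p. Qed.

Let weight_joint l : (l <= m)%N -> joint t T (weight t del l (fun l' w => E (g l') w)).
Proof. by move=> lm; apply: (joint_weight Ff t0 del0 (glT lm)) => l' ll; exact: mE ll. Qed.

Let phi_joint l i j : (l <= m)%N -> joint t T (phi l i j).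
Proof.
by move=> lm; apply: jointX; apply: jointM; [exact: weight_joint|exact: jointB].
Qed.

Let phi_ge0 l i j s w : 0 <= phi l i j s w. Proof. exact: sqr_ge0. Qed.

(** Finiteness comes from the square integrability contained in [ito_integral]; the bound depends on
    the grid and serves only to make the moments in the recursion finite. *)
Let phi_fin l i j : (l <= m)%N -> (jint P t T (phi l i j) < +oo)%E.
Proof.
move=> lm.
have [_ fh _ _ _] := hM i j; have [_ fhb _ _ _] := hMb i j.
pose hh s w := sigma (X s w) i j ^+ 2; pose hhb s w := sigma (Xb s w) i j ^+ 2.
have jhh : joint t T hh by exact: jointX.
have jhhb : joint t T hhb by exact: jointX.
have m2 : 0 <= 2 * l%:R ^+ 2 :> R by rewrite mulr_ge0// sqr_ge0.
apply: (@le_lt_trans _ _ (jint P t T (fun s w => 2 * l%:R ^+ 2 * (hh s w + hhb s w)))).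
  apply: jint_le => //.
  - exact: phi_joint.
  - by apply: jointM; [exact: joint_cst|exact: jointD].
  - move=> s w _; have hw := weight_le t del l (fun l' w => E_01 (g l') w) s w.
    rewrite /phi exprMn /hh /hhb; move: hw (sigma (X s w) i j) (sigma (Xb s w) i j).
    move: (weight _ _ _ _ _ _) (l%:R : R) => p r pr a a'.
    apply: (@le_trans _ _ (r ^+ 2 * (a - a') ^+ 2)); first by rewrite ler_wpM2r// sqr_ge0.
    rewrite [2 * r ^+ 2]mulrC -(mulrA (r ^+ 2)); apply: ler_wpM2l; first exact: sqr_ge0.
    have := sqr_ge0 (a + a'); lra.
  - by move=> s w; rewrite mulr_ge0// addr_ge0// sqr_ge0.
rewrite jintZ//; [|exact: jointD|by move=> s w; rewrite addr_ge0// sqr_ge0].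
rewrite jintD//; [|by move=> s w; exact: sqr_ge0|by move=> s w; exact: sqr_ge0].
apply: lte_mul_pinfty; [rewrite lee_fin; exact: m2|exact: isT|exact: (lte_add_pinfty fh fhb)].
Qed.

Let cell l : set R := `]g l, g l.+1]%classic.

Let cell_other l0 l1 s : l0 != l1 -> g l0 < s <= g l0.+1 -> \1_(cell l1) s = 0 :> R.
Proof.
move=> l01 /andP[s1 s2]; rewrite indicE memNset// /cell/= in_itv/= => /andP[s3 s4].
move: l01; rewrite neq_ltn => /orP[] ll.
  have := @le_grid R t del l0.+1 l1 (ltW del0) ll; lra.
have := @le_grid R t del l1.+1 l0 (ltW del0) ll; lra.
Qed.

Let phi_le l i j s w : (l <= m)%N -> t <= s <= T ->
  phi l i j s w <= \sum_(l' < l) \1_(cell l') s * (2 * Ks ^+ 2 * S l'.+1 w).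
Proof.
move=> lm /andP[ts sT].
have Z0 l' : (l' < l)%N -> 0 <= \1_(cell l') s * (2 * Ks ^+ 2 * S l'.+1 w).
  move=> ll; rewrite mulr_ge0// mulr_ge0//; first by rewrite mulr_ge0// sqr_ge0.
  by apply: S_ge0; exact: leq_trans lm.
(* Cells are open on the left, so [s = t], like any time after [g l], lies in none of them; the
   weight is then 0. *)
have [[l0 l0l sl0]|no] := pselect (exists2 l0, (l0 < l)%N & g l0 < s <= g l0.+1); last first.
  have -> : phi l i j s w = 0.
    rewrite /phi /weight big1 ?mul0r ?expr0n// => l' _; rewrite indicE memNset ?mulr0//=.
    by rewrite in_itv/= => sl; apply: no; exists l'.
  by apply: sumr_ge0 => l' _; exact: Z0.
have one : \1_(cell l0) s = 1 :> R by rewrite indicE mem_set// /cell/= in_itv.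
have wE : weight t del l (fun l' w => E (g l') w) s w = E (g l0) w.
  rewrite /weight (bigD1 (Ordinal l0l))//= -/(cell l0) one mulr1 big1 ?addr0// => l1 l10.
  by rewrite -/(cell l1) (@cell_other l0 l1)// ?mulr0// eq_sym.
have [/ltW g0s sg1] := andP sl0.
apply: (@le_trans _ _ (2 * Ks ^+ 2 * S l0.+1 w)); last first.
  rewrite (bigD1 (Ordinal l0l))//= one mul1r lerDl; apply: sumr_ge0 => l' _; exact: Z0.
rewrite /phi wE.
have EA k : E k w ^+ 2 = expR (- A k w).
  by rewrite expr2 -expRD; congr expR; lra.
(* The ratio of the two squares is the exponential of the energy spent between [g l0] and [s], at
   most 1/2 by the choice of the mesh. The radius again disappears into the mesh. *)
have E2 : E (g l0) w ^+ 2 <= 2 * E s w ^+ 2.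
  rewrite !EA.
  have -> : expR (- A (g l0) w) = expR (A s w - A (g l0) w) * expR (- A s w).
    by rewrite -expRD; congr expR; lra.
  rewrite ler_wpM2r// ?expR_ge0//; apply: expR_le2.
  apply: le_trans (energy_lip (mq w) (@q_rad w) (tg l0) g0s sT) _.
  apply: le_trans small; rewrite -[leLHS]add0r lerD//.
    by apply: mulr_ge0; [exact: drift_cst_ge0|exact: ltW].
  rewrite ler_wpM2l ?sqr_ge0//; have := sg1; rewrite gridS; lra.
have H2 : (sigma (X s w) i j - sigma (Xb s w) i j) ^+ 2 <= Ks ^+ 2 * sqnorm (D s w).
  rewrite -enorm_sqr -exprMn -[leLHS]real_normK ?num_real// lerXn2r ?nnegrE//.
    by apply: le_trans (s_lip _ _); exact: enorm_ge0.
  apply: le_trans (s_lip _ _); apply: le_trans (entry_le_enorm _ i j).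
  by rewrite !mxE.
have US : U s w <= S l0.+1 w by apply: U_le_S; rewrite ?ts// (leq_trans l0l).
rewrite exprMn; apply: (@le_trans _ _ (2 * Ks ^+ 2 * U s w)); last first.
  by rewrite ler_wpM2l// mulr_ge0// sqr_ge0.
apply: (@le_trans _ _ (2 * E s w ^+ 2 * (Ks ^+ 2 * sqnorm (D s w)))).
  by apply: ler_pM => //; exact: sqr_ge0.
by rewrite /U; move: (E s w ^+ 2) (sqnorm _) (Ks ^+ 2) => *; lra.
Qed.

Let IS l := (\int[P]_w (S l w)%:E)%E.

Let IS_ge0 l : (l <= m)%N -> (0 <= IS l)%E.
Proof. by move=> lm; apply: integral_ge0 => w _; rewrite lee_fin S_ge0. Qed.

Let Ks2 : 0 <= 2 * Ks ^+ 2. Proof. by rewrite mulr_ge0// sqr_ge0. Qed.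

(** The supremum reaches to the right end of each cell, whence the index [l'.+1] and a recursion
    that is implicit in its last term. *)
Let jint_phi_le l i j : (l <= m)%N ->
  (jint P t T (phi l i j) <= \sum_(l' < l) (del * (2 * Ks ^+ 2))%R%:E * IS l'.+1)%E.
Proof.
move=> lm.
have ml l' : (l' < l)%N -> (l'.+1 <= m)%N by move=> ll; exact: leq_trans lm.
have mZ l' : (l' < l)%N -> measurable_fun setT (fun w => 2 * Ks ^+ 2 * S l'.+1 w).
  by move=> ll; apply: measurable_funM; [exact: measurable_cst|exact/S_meas/ml].
have Z0 l' w : (l' < l)%N -> 0 <= 2 * Ks ^+ 2 * S l'.+1 w.
  by move=> ll; rewrite mulr_ge0//; exact/S_ge0/ml.
pose f l' s w := \1_(cell l') s * (2 * Ks ^+ 2 * S l'.+1 w).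
have jf l' : (l' < l)%N -> joint t T (f l') by move=> ll; apply: joint_cell; exact: mZ.
have f0 l' s w : (l' < l)%N -> 0 <= f l' s w by move=> ll; rewrite mulr_ge0//; exact: Z0.
apply: (@le_trans _ _ (jint P t T (fun s w => \sum_(l' < l) f l' s w))).
  apply: jint_le; [exact: phi_joint|exact: joint_sum|by move=> s w; exact: phi_ge0
    |by move=> s w; exact: phi_le|by move=> s w; apply: sumr_ge0 => l' _; exact: f0].
rewrite jint_sum//; apply: lee_sum => l' _.
have ll : (l' < l)%N by [].
rewrite jint_cell//; last 4 first.
- exact: mZ.
- by move=> w; exact: Z0.
- by apply: le_grid => //; exact: ltW.
- by apply: glT; exact: ml.
have -> : g l'.+1 - g l' = del by rewrite gridS; lra.
rewrite EFinM -muleA; apply: lee_wpmul2l; first by rewrite lee_fin ltW.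
under eq_integral do rewrite EFinM.
rewrite ge0_integralZl// ?lee_fin//.
- by apply/measurable_EFinP; exact/S_meas/ml.
- by move=> w _; rewrite lee_fin; exact/S_ge0/ml.
Qed.

Let kappa48 : 0 <= 48 * kappa.
Proof. by rewrite mulr_ge0//; exact: normal_var_ge0. Qed.

Let integral_G l i j : (l <= m)%N ->
  (\int[P]_w (G l i j w)%:E <= (48 * kappa)%R%:E * jint P t T (phi l i j))%E.
Proof.
move=> lm.
exact: (integral_ito_transform_sup_le Ff bm t0 tT del0 (glT lm) (fun l' => mE lm (l' := l'))
  (fun l' w => E_01 (g l') w) (hM i j) (hMb i j)).
Qed.

Let C_ge0 : 0 <= C. Proof. by rewrite mulr_ge0// expR_ge0. Qed.

Let a0_ge0 : 0 <= a0. Proof. by rewrite /a0 /sup_cst mulr_ge0 ?sqr_ge0// mulr_ge0. Qed.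

Let b0_ge0 : 0 <= b0. Proof. by rewrite mulr_ge0// exprn_ge0. Qed.

Let sumG_meas l : (l <= m)%N -> measurable_fun setT (fun w => \sum_i \sum_j G l i j w).
Proof.
by move=> lm; apply: measurable_sum => i; apply: measurable_sum => j; exact: G_meas.
Qed.

Let integral_sumG l : (l <= m)%N ->
  (\int[P]_w (\sum_i \sum_j G l i j w)%:E
   <= \sum_i \sum_j (48 * kappa)%R%:E * jint P t T (phi l i j))%E.
Proof.
move=> lm.
have mGE i j : measurable_fun setT (EFin \o G l i j) by exact/measurable_EFinP/G_meas.
have -> : (\int[P]_w (\sum_i \sum_j G l i j w)%:E
    = \sum_i \sum_j \int[P]_w (G l i j w)%:E)%E.
  under eq_integral do rewrite -sumEFin.
  rewrite ge0_integral_sum//; last 2 first.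
  - move=> i; apply/measurable_EFinP; apply: measurable_sum => j; exact: G_meas.
  - by move=> i w _; rewrite lee_fin; apply: sumr_ge0 => j _; exact: G_ge0.
  apply: eq_bigr => i _.
  rewrite (_ : (fun w => _) = (fun w => (\sum_j (G l i j w)%:E)%E)); last first.
    by apply/funext => w; rewrite sumEFin.
  rewrite ge0_integral_sum// => j; first exact: mGE.
  by move=> w _; rewrite lee_fin; exact: G_ge0.
by apply: lee_sum => i1 _; apply: lee_sum => i2 _; exact: integral_G.
Qed.

Let a := a0 * enorm (x - xb) ^+ 2.

Let a_ge0 : 0 <= a. Proof. by rewrite mulr_ge0// sqr_ge0. Qed.

Let IS_le l : (l <= m)%N ->
  (IS l <= a%:E + b0%:E * \sum_i \sum_j (48 * kappa)%R%:E * jint P t T (phi l i j))%E.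
Proof.
move=> lm.
have sG0 w : 0 <= \sum_i \sum_j G l i j w.
  by do 2! (apply: sumr_ge0 => ? _); exact: G_ge0.
have mSE : measurable_fun setT (fun w => (S l w)%:E) by exact/measurable_EFinP/S_meas.
have mGE : measurable_fun setT (fun w => (\sum_i \sum_j G l i j w)%:E).
  exact/measurable_EFinP/sumG_meas.
apply: (@le_trans _ _ (\int[P]_w (a%:E + b0%:E * (\sum_i \sum_j G l i j w)%:E))%E).
  apply: ae_ge0_le_integral => //.
  - by move=> w _; rewrite lee_fin S_ge0.
  - by move=> w _; rewrite -EFinM -EFinD lee_fin addr_ge0// mulr_ge0.
  - by apply: emeasurable_funD => //; exact: measurable_funeM.
  - by move: (ae_bound lm); apply: filterS => w h _; rewrite -EFinM -EFinD lee_fin.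
rewrite ge0_integralD//; last 2 first.
- by move=> w _; rewrite -EFinM lee_fin mulr_ge0.
- exact: measurable_funeM.
apply: leeD; first by rewrite integral_cst//= probability_setT mule1.
rewrite ge0_integralZl// ?lee_fin//.
  by apply: lee_wpmul2l; [rewrite lee_fin|exact: integral_sumG].
by move=> w _; rewrite lee_fin.
Qed.

(** Without it [fine] could send an infinite moment to its default value 0, and the real recursion
    would say nothing about [IS]. *)
Let IS_fin l : (l <= m)%N -> IS l \is a fin_num.
Proof.
move=> lm; rewrite ge0_fin_numE ?IS_ge0//; apply: le_lt_trans (IS_le lm) _.
apply: lte_add_pinfty; first exact: ltry.
rewrite lte_mul_pinfty// ?lee_fin//; apply: lte_sum_pinfty => i _.
apply: lte_sum_pinfty => j _; rewrite lte_mul_pinfty// ?lee_fin//.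
exact: phi_fin.
Qed.

Let beta := growth_cst n Kb KV Ks T.

Let u l := fine (IS l).

Let u_le l : (l <= m)%N -> u l <= a + beta * del * \sum_(i < l) u i.+1.
Proof.
move=> lm; rewrite -lee_fin fineK ?IS_fin//; apply: (le_trans (IS_le lm)).
rewrite EFinD leeD2l//.
have -> : (beta * del * \sum_(i < l) u i.+1)%:E =
   (b0%:E * \sum_(i < n) \sum_(j < n) (48 * kappa)%R%:E
     * (del * (2 * Ks ^+ 2) * \sum_(i < l) u i.+1)%R%:E)%E.
  rewrite -EFinM; under [in RHS]eq_bigr do rewrite sumEFin.
  rewrite sumEFin -EFinM; congr EFin.
  have alg (bb N k ks s dl : R) : bb * (N ^+ 2 * (48 * k)) * (2 * ks ^+ 2) * dl * s
    = bb * (N * (N * (48 * k * (dl * (2 * ks ^+ 2) * s)))) by ring.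
  by rewrite !sumr_const_ord /beta /growth_cst alg.
apply: lee_wpmul2l; first by rewrite lee_fin.
apply: lee_sum => i1 _; apply: lee_sum => i2 _; apply: lee_wpmul2l; first by rewrite lee_fin.
apply: (le_trans (jint_phi_le _ _ lm)).
rewrite mulr_sumr -sumEFin; apply: lee_sum => l' _.
rewrite [leRHS]EFinM fineK//; apply: IS_fin; exact: leq_trans lm.
Qed.

Hypothesis small' : growth_cst n Kb KV Ks T * del <= 2^-1.

(** Discrete Gronwall at the last node. As [m * del <= T], the power of [1 + 2 beta del] is at most
    [exp(2 beta T)], so neither the mesh nor the radius is left. *)
Lemma integral_weighted_sup_le :
  (\int[P]_w (path_sup t T (fun k w => expR (- (2^-1 * energy t (q ^~ w) k)) ^+ 2
                                      * sqnorm (X k w - Xb k w)) w)%:E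
   <= (sup_cst n Kb KV T * enorm (x - xb) ^+ 2 * expR (2 * growth_cst n Kb KV Ks T * T))%:E)%E.
Proof.
rewrite -/beta -/a0.
have beta0 : 0 <= beta.
  by apply: mulr_ge0 => //; apply: mulr_ge0 => //; apply: mulr_ge0 => //; exact: exprn_ge0.
rewrite [leLHS](_ : _ = IS m); last by rewrite /IS /S gT.
rewrite -(fineK (IS_fin (leqnn m))) lee_fin -/(u m).
have p1 : 0 <= beta * del <= 2^-1 by rewrite small' andbT mulr_ge0// ltW.
have u0 l : (l <= m)%N -> 0 <= u l by move=> lm; apply: fine_ge0; exact: IS_ge0.
apply: (le_trans (gronwall_discrete a_ge0 p1 u0 u_le (leqnn m))).
rewrite mulrC; apply: ler_wpM2l => //.
apply: (@le_trans _ _ (expR (2 * (beta * del)) ^+ m)).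
  rewrite lerXn2r// ?nnegrE ?expR_ge0 ?expR_ge1Dx//.
  by rewrite addr_ge0// mulr_ge0//; case/andP: p1.
rewrite -expRM_natl ler_expR.
have := gT; rewrite /grid => gT'; have : m%:R * del <= T by have := t0; lra.
move=> /(ler_wpM2l beta0); lra.
Qed.

(** From the second to the first moment by [y <= (lam + y^2 / lam) / 2], with [lam] left free. The
    supremum is attained, so it commutes with the square root and the extended supremum is a
    measurable real function. *)
Lemma integral_ereal_sup_le (lam : R) : 0 < lam ->
  (\int[P]_w ereal_sup
     [set (expR (- (2^-1 * \int[mu]_(s in `[t, k]) (enorm (q s w) ^+ 2)))
           * enorm (X k w - Xb k w))%:E | k in `[t, T]%classic]
   <= (2^-1 * (lam + sup_cst n Kb KV T * expR (2 * growth_cst n Kb KV Ks T * T)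
                     * enorm (x - xb) ^+ 2 / lam))%:E)%E.
Proof.
move=> lam0.
have Ssup w : ereal_sup
    [set (expR (- (2^-1 * \int[mu]_(s in `[t, k]) (enorm (q s w) ^+ 2)))
          * enorm (X k w - Xb k w))%:E | k in `[t, T]%classic]
    = (Num.sqrt (path_sup t T U w))%:E.
  have UE k : expR (- (2^-1 * \int[mu]_(s in `[t, k]) (enorm (q s w) ^+ 2)))
      * enorm (X k w - Xb k w) = Num.sqrt (U k w).
    rewrite /U sqrtrM ?sqr_ge0// sqrtr_sqr ger0_norm; last exact: ltW (E_gt0 k w).
    by rewrite enormE.
  have [k kT [-> kmax]] := path_sup_attained tT U_cont w.
  apply/eqP; rewrite eq_le; apply/andP; split.
    apply: ge_ereal_sup => _ [k' /= k'T <-]; rewrite UE lee_fin ler_wsqrtr//.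
    by apply: kmax; rewrite in_itv in k'T.
  apply: ereal_sup_ubound; exists k; first by rewrite /= in_itv.
  by rewrite UE.
under eq_integral do rewrite Ssup.
have mS : measurable_fun setT (path_sup t T U).
  by have := S_meas (leqnn m); rewrite /S gT.
have S0 w : 0 <= path_sup t T U w by have := S_ge0 w (leqnn m); rewrite /S gT.
have l2 : 0 <= 2^-1 * lam by rewrite mulr_ge0// ltW.
have l2i : 0 <= 2^-1 * lam^-1 by rewrite mulr_ge0// invr_ge0 ltW.
apply: (@le_trans _ _ (\int[P]_w ((2^-1 * lam)%:E
    + (2^-1 * lam^-1)%:E * (path_sup t T U w)%:E))%E).
  apply: ge0_le_integral => //.
  - apply/measurable_EFinP; apply: measurableT_comp mS.
    by apply: continuous_measurable_fun; exact: sqrt_continuous.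
  - apply: emeasurable_funD => //; apply: measurable_funeM; exact/measurable_EFinP.
  - move=> w _; rewrite -EFinM -EFinD lee_fin.
    rewrite -{2}(sqr_sqrtr (S0 w)); move: (Num.sqrt _) => y.
    have -> : 2^-1 * lam + 2^-1 * lam^-1 * y ^+ 2 = y + 2^-1 * lam^-1 * (y - lam) ^+ 2.
      by field; rewrite gt_eqF.
    by rewrite lerDl mulr_ge0// sqr_ge0.
rewrite ge0_integralD//; last 2 first.
- by move=> w _; rewrite -EFinM lee_fin mulr_ge0.
- by apply: measurable_funeM; exact/measurable_EFinP.
rewrite mulrDr EFinD; apply: leeD.
  by rewrite integral_cst//= probability_setT mule1.
rewrite ge0_integralZl// ?lee_fin//; last 2 first.
- exact/measurable_EFinP.
- by move=> w _; rewrite lee_fin.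
have := integral_weighted_sup_le => h.
apply: le_trans (lee_wpmul2l _ h) _; first by rewrite lee_fin.
rewrite -EFinM lee_fin le_eqVlt; apply/orP; left; apply/eqP.
by field; rewrite gt_eqF.
Qed.

End difference_estimate.

(** * Choice of the mesh and of the constant *)

Lemma sup_cst_ge0 (R : realType) n (Kb KV T : R) : 0 <= sup_cst n Kb KV T.
Proof. by rewrite mulr_ge0 ?sqr_ge0// mulr_ge0. Qed.

Lemma growth_cst_ge0 (R : realType) n (Kb KV Ks T : R) : 0 <= growth_cst n Kb KV Ks T.
Proof.
apply: mulr_ge0; last by rewrite mulr_ge0// sqr_ge0.
apply: mulr_ge0; first by rewrite mulr_ge0 ?exprn_ge0// sup_cst_ge0.
by rewrite mulr_ge0 ?sqr_ge0// mulr_ge0// normal_var_ge0.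
Qed.

(** The grid has to end exactly at [T], so the mesh is [(T - t) / m] with [m] large; for [t = T] a
    grid without cells does. *)
Lemma fine_grid (R : realType) (t T r : R) : t <= T -> 0 < r ->
  exists del m, [/\ 0 < del, del <= r & grid t del m = T].
Proof.
rewrite le_eqVlt => /orP[/eqP <- r0|tT r0].
  by exists r, 0%N; rewrite grid0.
have Tt : 0 < T - t by rewrite subr_gt0.
have h0 : 0 <= (T - t) / r by rewrite divr_ge0// ltW.
have := archi_boundP h0; set m := Num.Def.archi_bound _ => hm.
have m0 : 0 < m%:R :> R by exact: le_lt_trans hm.
exists ((T - t) / m%:R), m; split.
- by rewrite divr_gt0.
- by move: hm; rewrite ltr_pdivrMr// => hm; rewrite ler_pdivrMr// mulrC ltW.
- by rewrite /grid mulrC divfK ?gt_eqF// addrC subrK.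
Qed.

Lemma lipschitz_euclid_ge0 (R : realType) n m p (f : 'cV[R]_n -> 'M[R]_(m, p)) :
  lipschitz_euclid f ->
  exists2 K, 0 <= K & forall x y, enorm (f x - f y) <= K * enorm (x - y).
Proof.
move=> [K hK]; exists `|K| => // x y; apply: le_trans (hK x y) _.
by rewrite ler_wpM2r ?enorm_ge0// ler_norm.
Qed.

Theorem lemma3p3 (R : realType) (n : nat) (n_ge1 : (1 <= n)%N)
    (T : R) (T_gt0 : 0 < T)
    (V sigma : 'cV[R]_n -> 'M[R]_n) (b : 'cV[R]_n -> 'cV[R]_n)
    (V_lip : lipschitz_euclid V) (V_bnd : bounded_euclid V)
    (sigma_lip : lipschitz_euclid sigma) (sigma_bnd : bounded_euclid sigma)
    (b_lip : lipschitz_euclid b)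
    (d : measure_display) (Omega : measurableType d) (P : probability Omega R)
    (F : R -> set (set Omega)) (F_filt : filtration T F)
    (W : R -> Omega -> 'cV[R]_n) (W_bm : brownian_motion P T F W) :
  exists2 Lt : R, 0 < Lt &
    forall (rad : R), 0 < rad ->
    forall (q : R -> Omega -> 'cV[R]_n), control F T rad q ->
    forall (x xbar : 'cV[R]_n) (t : R), 0 <= t <= T ->
    forall (X Xbar : R -> Omega -> 'cV[R]_n),
      strong_solution P F T W b V sigma q x t X ->
      strong_solution P F T W b V sigma q xbar t Xbar ->
      (\int[P]_w ereal_sup
         [set (expR (- (2^-1 * \int[@lebesgue_measure R]_(s in `[t, k])
                                  (enorm (q s w) ^+ 2))%R)
               * enorm (X k w - Xbar k w))%:E | k in `[t, T]%classic]
       <= (Lt * enorm (x - xbar))%:E)%E.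

Proof.
have [KV KV0 VL] := lipschitz_euclid_ge0 V_lip; have [CV VB] := V_bnd.
have [Ks Ks0 sL] := lipschitz_euclid_ge0 sigma_lip.
have [Kb Kb0 bL] := lipschitz_euclid_ge0 b_lip.
pose gro := growth_cst n Kb KV Ks T; pose Lam := sup_cst n Kb KV T * expR (2 * gro * T).
have gro0 : 0 <= gro by exact: growth_cst_ge0.
have Lam0 : 0 <= Lam by rewrite mulr_ge0 ?expR_ge0// sup_cst_ge0.
(* The value of [(lam + Lam z^2 / lam) / 2] at [lam = z], the distance of the initial points. It is
   fixed before the radius is introduced. *)
exists (2^-1 * (1 + Lam)); first by rewrite mulr_gt0// ltr_pwDl.
move=> rad _ q hq x xbar t /andP[t0 tT] X Xbar
  [cX aX [M [hM X_eq]]] [cXb aXb [Mb [hMb Xb_eq]]].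
pose c := drift_cst n Kb KV.
have c0 : 0 <= c by exact: drift_cst_ge0.
have r20 : 0 <= rad ^+ 2 by exact: sqr_ge0.
(* A mesh below [1 / (2 D)] satisfies the smallness conditions of the pathwise and of the Gronwall
   argument together; the summand 1 keeps [D] positive. *)
pose D := c + rad ^+ 2 + gro + 1.
have D0 : 0 < D by rewrite /D; lra.
have r0 : 0 < 2^-1 / D by rewrite divr_gt0.
have [del [m [del0 delr gT]]] := fine_grid tT r0.
have delD : c * del + rad ^+ 2 * del + gro * del <= 2^-1.
  by move: delr; rewrite ler_pdivlMr// /D; lra.
have small : c * del + rad ^+ 2 * del <= 2^-1.
  by apply: le_trans delD; rewrite lerDl mulr_ge0// ltW.
have small' : gro * del <= 2^-1.
  by apply: le_trans delD; rewrite lerDr addr_ge0// mulr_ge0// ltW.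
apply/lee_addgt0Pr => eps eps0.
set z := enorm (x - xbar).
have z0 : 0 <= z by exact: enorm_ge0.
(* [lam] is taken as [z + eps] rather than [z], since it must be positive also when the two initial
   points coincide; the excess is [eps / 2]. *)
have l0 : 0 < z + eps by rewrite ltr_wpDl.
apply: le_trans (integral_ereal_sup_le F_filt W_bm Kb0 KV0 bL VL VB sL hq t0 tT cX cXb
  aX aXb hM hMb X_eq Xb_eq del0 gT small small' l0) _.
rewrite -EFinD lee_fin -/z -/gro -/Lam.
have : Lam * z ^+ 2 / (z + eps) <= Lam * z.
  rewrite ler_pdivrMr// expr2 mulrA ler_wpM2l//; last by rewrite lerDl ltW.
  exact: mulr_ge0.
have -> : 2^-1 * (1 + Lam) * z = 2^-1 * (z + Lam * z) by ring.
move: (Lam * z ^+ 2 / _) (Lam * z) => y v; have := eps0; lra.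
Qed.
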